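(* Let $n \in \mathbb{N}$ and let $X_1, \ldots, X_n$ be Banach spaces such that, for every $1 \leq i \leq n$, $X_i$ is isomorphic either to $\ell_{p_i}$ for some $1 \leq p_i < \infty$, or to $c_0$. Then the spaces $X_1 \check{\otimes} \ldots \check{\otimes} X_n$ and $X_1 \hat{\otimes} \ldots \hat{\otimes} X_n$ are subprojective.
   Context: Here $\check{\otimes}$ and $\hat{\otimes}$ denote the (completed) injective and projective tensor products of Banach spaces, respectively. A Banach space $X$ is subprojective if every closed infinite dimensional subspace $Y \subset X$ contains a closed infinite dimensional subspace $Z \subset Y$ that is complemented in $X$. *)

(* Defs.v *)
From HB Require Import structures.
From mathcomp Require Import all_boot all_order all_algebra.
From mathcomp Require Import all_classical all_reals all_analysis.
From mathcomp Require Import complex.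
Set Implicit Arguments.
Unset Strict Implicit.
Unset Printing Implicit Defensive.
Import Order.TTheory GRing.Theory Num.Theory.
Import numFieldNormedType.Exports.
Local Open Scope classical_set_scope.
Local Open Scope ring_scope.

(* Banach spaces are taken over the reals ([cplx = false]) or over the complex
   numbers ([cplx = true]). *)
Definition scalars (R : realType) (cplx : bool) : numFieldType :=
  if cplx then (R[i] : numFieldType) else (R : numFieldType).

Definition real_part (R : realType) (cplx : bool) : scalars R cplx -> R :=
  match cplx return scalars R cplx -> R with
  | true => @complex.Re R
  | false => id
  end.

(* The library norm of a complex space takes its values in the nonnegative
   reals of [R[i]]; [rnorm] is the same norm with values in [R]. *)
Definition rnorm (R : realType) (cplx : bool)
    (V : normedModType (scalars R cplx)) (x : V) : R :=
  real_part `|x|.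

Section Subprojectivity.
Context {K : numFieldType}.

Definition linear_subspace (V : lmodType K) (Y : set V) : Prop :=
  Y 0 /\ forall (a : K) (x y : V), Y x -> Y y -> Y (a *: x + y).

Definition finite_dimensional (V : lmodType K) (Y : set V) : Prop :=
  exists (m : nat) (e : 'I_m -> V), (forall k, Y (e k)) /\
    forall y, Y y -> exists c : 'I_m -> K, y = \sum_(k < m) c k *: e k.

Definition closed_infdim_subspace (V : normedModType K) (Y : set V) : Prop :=
  [/\ linear_subspace Y, closed Y & ~ finite_dimensional Y].

Definition complemented (V : normedModType K) (Z : set V) : Prop :=
  exists P : {linear V -> V},
    [/\ continuous P, (forall x, P (P x) = P x) & range P = Z].

Definition subprojective (V : completeNormedModType K) : Prop :=
  forall Y : set V, closed_infdim_subspace Y ->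
    exists Z : set V,
      [/\ Z `<=` Y, closed_infdim_subspace Z & complemented Z].

End Subprojectivity.

Section SequenceSpaces.
Context {R : realType} {cplx : bool}.
Local Notation K := (scalars R cplx).

Definition abs_pow (p : R) (a : nat -> K^o) : R ^nat :=
  fun k => rnorm (a k) `^ p.

Definition ell (p : R) : set (nat -> K^o) :=
  [set a | cvgn (series (abs_pow p a))].

Definition ell_norm (p : R) (a : nat -> K^o) : R :=
  limn (series (abs_pow p a)) `^ p^-1.

Definition c0 : set (nat -> K^o) := [set a | a @ \oo --> (0 : K^o)].

Definition c0_norm (a : nat -> K^o) : R := sup (range (fun k => rnorm (a k))).

(* [X] is isomorphic to the space of the sequences in [S], normed by [N]:
   a linear bijection of [X] onto [S], bounded together with its inverse. *)
Definition isomorphic_to (X : normedModType K) (S : set (nat -> K^o))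
    (N : (nat -> K^o) -> R) : Prop :=
  exists T : {linear X -> (nat -> K^o)},
    [/\ injective T, range T = S &
      exists c C : R, [/\ 0 < c, 0 < C &
        forall x, c * rnorm x <= N (T x) <= C * rnorm x]].

End SequenceSpaces.

Section AlgebraicTensorProduct.
Context {K : numFieldType} {n : nat}.
Variable X : 'I_n -> lmodType K.

Definition multilinear (f : (forall i, X i) -> K^o) : Prop :=
  forall (x : forall i, X i) (i : 'I_n) (a : K) (y z : X i),
    f (dfwith x i (a *: y + z)) = a *: f (dfwith x i y) + f (dfwith x i z).

Record multilinear_form := MultilinearForm {
  mlf_fun :> (forall i, X i) -> K^o;
  mlf_multilinear : multilinear mlf_fun }.

(* [x_1 (x) ... (x) x_n], as a functional on the multilinear forms; the
   algebraic tensor product is the linear span of these functionals. *)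
Definition elementary (x : forall i, X i) : multilinear_form -> K^o :=
  fun f => f x.

Definition in_tensor : {pred (multilinear_form -> K^o)} := fun u =>
  `[< exists (m : nat) (c : 'I_m -> K) (x : 'I_m -> forall i, X i),
        u = \sum_(k < m) c k *: elementary (x k) >].

Lemma in_tensor_submod_closed : GRing.submod_closed in_tensor.
Proof.
split.
  apply/asboolP; exists 0, (fun=> 0), (fun=> fun=> 0).
  by rewrite big_ord0.
move=> a u v /asboolP[m [c [x ->]]] /asboolP[m' [c' [x' ->]]].
apply/asboolP; exists (m + m')%N,
  (fun k : 'I_(m + m') => match fintype.split k with inl j => a * c j | inr j => c' j end),
  (fun k : 'I_(m + m') => match fintype.split k with inl j => x j | inr j => x' j end).
rewrite big_split_ord /= scaler_sumr; congr (_ + _); apply: eq_bigr => k _.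
  by have /= -> := unsplitK (inl k : 'I_m + 'I_m'); rewrite scalerA.
by have /= -> := unsplitK (inr k : 'I_m + 'I_m').
Qed.

HB.instance Definition _ :=
  GRing.isSubmodClosed.Build K (multilinear_form -> K^o) in_tensor
    in_tensor_submod_closed.

Record tensor := Tensor {
  tensor_val :> multilinear_form -> K^o;
  tensorP : tensor_val \in in_tensor }.

HB.instance Definition _ := [isSub for tensor_val].
HB.instance Definition _ := [Choice of tensor by <:].
HB.instance Definition _ := [SubChoice_isSubLmodule of tensor by <:].

Definition product_fun (phi : forall i, {linear X i -> K^o}) :
    (forall i, X i) -> K^o :=
  fun x => \prod_(i < n) phi i (x i).

Lemma product_fun_multilinear (phi : forall i, {linear X i -> K^o}) :
  multilinear (product_fun phi).
Proof.
move=> x i a y z; rewrite /product_fun.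
have H w : \prod_(j < n) phi j (dfwith x i w j) =
           phi i w * \prod_(j < n | j != i) phi j (x j) :> K.
  rewrite (bigD1 i) //= dfwithin; congr (_ * _).
  by apply: eq_bigr => j ji; rewrite dfwithout // eq_sym.
by rewrite !H linearP mulrDl -mulrA.
Qed.

Definition product_form (phi : forall i, {linear X i -> K^o}) :
  multilinear_form := MultilinearForm (product_fun_multilinear phi).

End AlgebraicTensorProduct.

Section CompletedTensorProducts.
Context {R : realType} {cplx : bool} {n : nat}.
Local Notation K := (scalars R cplx).
Variable X : 'I_n -> completeNormedModType K.

(* If [u] is the sum over [k] of [x_k1 (x) ... (x) x_kn], then
   [u (product_form phi)] is the sum over [k] of [phi_1 x_k1 * ... * phi_n x_kn]. *)
Definition injective_norm (u : tensor X) : R :=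
  sup [set r : R | exists phi : forall i, {linear X i -> K^o},
         (forall i x, rnorm (phi i x) <= rnorm x) /\
         r = rnorm (u (product_form phi))].

Definition projective_norm (u : tensor X) : R :=
  inf [set r : R | exists (m : nat) (x : 'I_m -> forall i, X i),
         (u : multilinear_form X -> K^o) = \sum_(k < m) elementary (x k) /\
         r = \sum_(k < m) \prod_(i < n) rnorm (x k i)].

(* The Banach space [Z] is the completion of [V] for the norm [N], through [J];
   this determines [Z] up to isometric isomorphism. *)
Definition is_completion (V : lmodType K) (N : V -> R)
    (Z : completeNormedModType K) (J : {linear V -> Z}) : Prop :=
  (forall v, rnorm (J v) = N v) /\ dense (range J).

End CompletedTensorProducts.

Definition is_injective_tensor_product (R : realType) (cplx : bool) (n : nat)
    (X : 'I_n -> completeNormedModType (scalars R cplx))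
    (Z : completeNormedModType (scalars R cplx)) : Prop :=
  exists J : {linear tensor X -> Z}, is_completion (@injective_norm _ _ _ X) J.

Definition is_projective_tensor_product (R : realType) (cplx : bool) (n : nat)
    (X : 'I_n -> completeNormedModType (scalars R cplx))
    (Z : completeNormedModType (scalars R cplx)) : Prop :=
  exists J : {linear tensor X -> Z}, is_completion (@projective_norm _ _ _ X) J.

(* Main.v *)
Require Import Defs.
From HB Require Import structures.
From mathcomp Require Import all_boot all_order all_algebra.
From mathcomp Require Import all_classical all_reals all_analysis.
From mathcomp Require Import complex.
From mathcomp Require Import ring lra.
Set Implicit Arguments.
Unset Strict Implicit.
Unset Printing Implicit Defensive.
Import Order.TTheory GRing.Theory Num.Theory.
Import numFieldNormedType.Exports.
Local Open Scope classical_set_scope.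
Local Open Scope ring_scope.

(** The argument runs inside the algebra of coordinate multipliers of the
    completed product Z.  Each factor has a basis for which sequences of modulus
    at most one act as bounded multipliers, so an element of Z has coordinates
    indexed by n-tuples of integers, and any product m_1(j_1) ... m_n(j_n) with
    |m_i| <= 1 multiplies these coordinates boundedly, because both norms are
    uniform crossnorms ([subprojective_of_crossnorm]).

    Let Y be an infinite dimensional subspace.  For a set S of free coordinates,
    the slice projection fixes the coordinates outside S to given values; take
    the smallest S for which some slice projection E is bounded below on an
    infinite dimensional subspace of Y, which then replaces Y.  By minimality,
    fixing one more coordinate gives an operator bounded below on no infinite
    dimensional subspace, and such operators are small on suitable subspaces
    ([small_subspace]); this plays the part of an induction on n.  Removing
    finitely many values of each free coordinate therefore costs little
    ([near_tail]), and a gliding hump yields y_k in Y such that E y_k is almost a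
    z_k living in a cube whose sides in the directions of S are the k-th of
    successive disjoint intervals.

    Such diagonal blocks behave well for two reasons.  Averaging over signs
    shows that the restriction of the coordinates to the union of the diagonal
    cubes is a bounded multiplier ([diagonal_multiplier]).  And if block by block
    one family of diagonal blocks has smaller norms than another, then so do the
    sums, up to a constant ([block_dominated]).  This is the only point where the
    two norms are treated differently: for the injective norm one glues almost
    norming functionals of the blocks ([injective_domination]), for the
    projective norm almost norming elementary tensors ([projective_domination]);
    both rest on the same property in l_p and c_0, where the norm of a sum of
    disjoint blocks depends only on the norms of the blocks.

    With functionals f_k norming z_k (Hahn-Banach) and block projections D_k, the
    map A z = sum_k f_k (D_k z) y_k is consequently bounded, since E is bounded
    below on Y, and A is close to the identity on the closed span W of the y_k.
    Inverting A on W by a Neumann series projects Z onto W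
    ([block_sequence_complemented]). *)

(** * The real valued norm *)
Section RealNorm.
Context {R : realType} {cplx : bool}.
Local Notation K := (scalars R cplx).

Definition of_real (r : R) : K :=
  match cplx return scalars R cplx with true => (r%:C)%C | false => r end.

Lemma of_realD r s : of_real (r + s) = of_real r + of_real s.
Proof. by rewrite /of_real; case: cplx => //; rewrite rmorphD. Qed.

Lemma of_realM r s : of_real (r * s) = of_real r * of_real s.
Proof. by rewrite /of_real; case: cplx => //; rewrite rmorphM. Qed.

Lemma of_real0 : of_real 0 = 0.
Proof. by rewrite /of_real; case: cplx. Qed.

Lemma of_real1 : of_real 1 = 1.
Proof. by rewrite /of_real; case: cplx. Qed.

Lemma of_realN r : of_real (- r) = - of_real r.
Proof. by apply/eqP; rewrite -addr_eq0 -of_realD addNr of_real0. Qed.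

Lemma of_realV r : of_real r^-1 = (of_real r)^-1.
Proof. by rewrite /of_real; case: cplx => //; rewrite fmorphV. Qed.

Lemma of_real_nat k : of_real k%:R = k%:R.
Proof. by rewrite /of_real; case: cplx => //; rewrite rmorph_nat. Qed.

Lemma ler_of_real r s : (of_real r <= of_real s) = (r <= s).
Proof. by rewrite /of_real; case: cplx => //; rewrite lecR. Qed.

Lemma ltr_of_real r s : (of_real r < of_real s) = (r < s).
Proof. by rewrite /of_real; case: cplx => //; rewrite ltcR. Qed.

Lemma of_real_inj : injective of_real.
Proof. by rewrite /of_real; case: cplx => // r s []. Qed.

Lemma normr_rnorm (V : normedModType K) (x : V) : `|x| = of_real (rnorm x).
Proof.
rewrite /rnorm /of_real; have := normr_ge0 x; move: (`|x|).
rewrite /scalars; case: cplx => //= -[a b].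
by rewrite lecE/= => /andP[/eqP -> _].
Qed.

Lemma of_real_pos (e : K) : 0 < e -> exists2 r : R, 0 < r & e = of_real r.
Proof.
rewrite /of_real; move: e; rewrite /scalars; case: cplx => /= [[a b]|e e0].
  by rewrite ltcE/= => /andP[/eqP -> a0]; exists a.
by exists e.
Qed.

Section Norm.
Variable V : normedModType K.
Implicit Types x y : V.

Lemma rnorm_ge0 x : 0 <= rnorm x.
Proof. by rewrite -ler_of_real of_real0 -normr_rnorm. Qed.

Lemma rnormD x y : rnorm (x + y) <= rnorm x + rnorm y.
Proof. by rewrite -ler_of_real of_realD -!normr_rnorm ler_normD. Qed.

Lemma rnormN x : rnorm (- x) = rnorm x.
Proof. by apply: of_real_inj; rewrite -!normr_rnorm normrN. Qed.

Lemma rnormB x y : rnorm (x - y) = rnorm (y - x).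
Proof. by rewrite -rnormN opprB. Qed.

Lemma rnorm0 : rnorm (0 : V) = 0.
Proof. by apply: of_real_inj; rewrite -normr_rnorm normr0 of_real0. Qed.

Lemma rnorm_eq0 x : rnorm x = 0 -> x = 0.
Proof. by move=> x0; apply: normr0_eq0; rewrite normr_rnorm x0 of_real0. Qed.

Lemma rnormZ (a : K) x : rnorm (a *: x) = rnorm (a : K^o) * rnorm x.
Proof. by apply: of_real_inj; rewrite of_realM -!normr_rnorm normrZ. Qed.

Lemma rnorm_triB x y : rnorm x <= rnorm y + rnorm (x - y).
Proof. by rewrite -{1}(subrK y x) addrC; apply: rnormD. Qed.

Lemma rnorm_sum (I : Type) (r : seq I) (P : pred I) (F : I -> V) :
  rnorm (\sum_(i <- r | P i) F i) <= \sum_(i <- r | P i) rnorm (F i).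
Proof.
elim/big_ind2 : _ => [|x a y b xa yb|//]; first by rewrite rnorm0.
by apply: le_trans (rnormD _ _) _; apply: lerD.
Qed.

End Norm.

Definition modulus (a : K) : R := rnorm (a : K^o).

Lemma modulusM a b : modulus (a * b) = modulus a * modulus b.
Proof. exact: (rnormZ (V := K^o)). Qed.

Lemma modulus_ge0 a : 0 <= modulus a.
Proof. exact: rnorm_ge0. Qed.

Lemma modulus_of_real r : 0 <= r -> modulus (of_real r) = r.
Proof.
move=> r0; apply: of_real_inj; rewrite /modulus -normr_rnorm ger0_norm //.
by rewrite -of_real0 ler_of_real.
Qed.

Lemma modulus1 : modulus 1 = 1.
Proof. by rewrite -of_real1 modulus_of_real. Qed.

Lemma modulus0 : modulus 0 = 0.
Proof. exact: rnorm0. Qed.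

Lemma modulusN a : modulus (- a) = modulus a.
Proof. exact: (rnormN (a : K^o)). Qed.

Lemma modulus_eq0 a : modulus a = 0 -> a = 0.
Proof. exact: (@rnorm_eq0 (K^o)). Qed.

Lemma modulus_neq0 a : a != 0 -> 0 < modulus a.
Proof.
move=> a0; rewrite lt_neqAle modulus_ge0 andbT eq_sym.
by apply: contra_neq a0 => /modulus_eq0.
Qed.

Lemma modulusV a : modulus a^-1 = (modulus a)^-1.
Proof.
have [->|a0] := eqVneq a 0; first by rewrite invr0 modulus0 invr0.
have ma : modulus a != 0 by rewrite gt_eqF ?modulus_neq0.
by apply: (mulfI ma); rewrite -modulusM !divff ?modulus1.
Qed.

Lemma modulus_prod (I : Type) (r : seq I) (P : pred I) (F : I -> K) :
  modulus (\prod_(i <- r | P i) F i) = \prod_(i <- r | P i) modulus (F i).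
Proof.
elim/big_ind2 : _ => [|x a y b xa yb|//]; first by rewrite modulus1.
by rewrite modulusM xa yb.
Qed.

Lemma phase (a : K) : exists2 t : K, modulus t = 1 & t * a = of_real (modulus a).
Proof.
have [->|a0] := eqVneq a 0.
  by exists 1; rewrite ?modulus1// mulr0 modulus0 of_real0.
exists (of_real (modulus a) / a).
  rewrite modulusM modulusV modulus_of_real ?modulus_ge0// divff//.
  by rewrite gt_eqF ?modulus_neq0.
by rewrite -mulrA mulVf// mulr1.
Qed.

End RealNorm.
Arguments of_real {R cplx}.
Arguments modulus {R cplx}.

(** * Convergence, closedness and completeness through the real norm *)
Section Metric.
Context {R : realType} {cplx : bool}.
Local Notation K := (scalars R cplx).

Definition rcvg (V : normedModType K) (u : nat -> V) (l : V) : Prop :=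
  forall e : R, 0 < e -> exists N, forall k, (N <= k)%N -> rnorm (u k - l) < e.

Definition rcauchy (V : normedModType K) (u : nat -> V) : Prop :=
  forall e : R, 0 < e -> exists N, forall k l, (N <= k)%N -> (N <= l)%N ->
    rnorm (u k - u l) < e.

Definition rcomplete (V : normedModType K) : Prop :=
  forall u : nat -> V, rcauchy u -> exists l, rcvg u l.

Lemma ball_rnorm (V : normedModType K) (x y : V) (r : R) :
  ball x (of_real r) y <-> rnorm (x - y) < r.
Proof. by rewrite -ball_normE /ball_ /= normr_rnorm ltr_of_real. Qed.

Lemma nbhs_rnorm (V : normedModType K) (x : V) (A : set V) :
  nbhs x A <-> exists2 e : R, 0 < e & forall y, rnorm (x - y) < e -> A y.
Proof.
split=> [/nbhs_ballP[e /= e0 xA]|[e e0 xA]]; last apply/nbhs_ballP.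
  have [r r0 er] := of_real_pos e0; exists r => // y xy.
  by apply: xA; rewrite er; apply/ball_rnorm.
exists (of_real e); first by rewrite /= -of_real0 ltr_of_real.
by move=> y /ball_rnorm; apply: xA.
Qed.

Lemma complete_rcomplete (V : completeNormedModType K) : rcomplete V.
Proof.
move=> u uc; have uu : cauchy (u @ \oo).
  apply/cauchy_ballP => e e0; have [r r0 ->] := of_real_pos e0.
  have [N uN] := uc _ r0; near_simpl.
  exists ([set k | (N <= k)%N], [set k | (N <= k)%N]) => /=.
    by split; exists N.
  by move=> [k l] /= [Nk Nl]; apply/ball_rnorm; apply: uN.
exists (lim (u @ \oo)) => e e0.
have /cauchy_cvg/cvg_ballP := uu.
move=> /(_ (of_real e)); rewrite -of_real0 ltr_of_real => /(_ e0)[N _ uN].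
by exists N => k Nk; rewrite rnormB; apply/ball_rnorm; apply: uN.
Qed.

Lemma closed_rnormP (V : normedModType K) (Y : set V) :
  closed Y <->
  (forall x, (forall e : R, 0 < e -> exists2 y, Y y & rnorm (x - y) < e) -> Y x).
Proof.
split=> [Yc x xY|H].
  apply: Yc => A /nbhs_rnorm[e e0 eA]; have [y Yy xy] := xY _ e0.
  by exists y; split=> //; apply: eA.
move=> x xY; apply: H => e e0.
have /xY[y [Yy]] : nbhs x [set y | rnorm (x - y) < e].
  by apply/nbhs_rnorm; exists e.
by exists y.
Qed.

Lemma dense_rnormP (V : normedModType K) (D : set V) : dense D ->
  forall x (e : R), 0 < e -> exists2 y, D y & rnorm (x - y) < e.
Proof.
move=> Dd x e e0; have [|y [xy Dy]] := Dd _ _ (open_interior [set y | rnorm (x - y) < e]).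
  by exists x; apply/nbhs_rnorm; exists e.
by exists y => //; apply: (interior_subset xy).
Qed.

Lemma bounded_continuous (V W : normedModType K) (f : {linear V -> W}) (C : R) :
  (forall x, rnorm (f x) <= C * rnorm x) -> continuous f.
Proof.
move=> fC x A /nbhs_rnorm[e e0 eA]; apply/nbhs_rnorm.
have C1 : 0 < `|C| + 1 by rewrite ltr_wpDl.
exists (e / (`|C| + 1)); first by rewrite divr_gt0.
move=> y; rewrite ltr_pdivlMr// => xy; apply: eA.
rewrite -linearB; apply: le_lt_trans (fC _) _; apply: le_lt_trans xy.
rewrite mulrC; apply: ler_wpM2l; first exact: rnorm_ge0.
by rewrite (le_trans (ler_norm _))// lerDl.
Qed.


End Metric.

Section Extension.
Context {R : realType} {cplx : bool}.
Local Notation K := (scalars R cplx).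

(** The scalars are treated as a Banach space over themselves; in the complex
    case completeness is that of the real and imaginary parts. *)
Lemma rcomplete_scalars : rcomplete (K^o : normedModType K).
Proof.
rewrite /rcomplete /rcauchy /rcvg /rnorm /scalars /real_part.
case: cplx => /= u uc; last first.
  exact: (@complete_rcomplete R false (R^o : completeNormedModType R) u uc).
have ReIm (g : R[i] -> R) : (forall a b, g (a - b) = g a - g b) ->
    (forall a, `|g a| <= Normc.normc a) ->
    exists l : R, forall e : R, 0 < e ->
      exists N, forall k, (N <= k)%N -> `|g (u k) - l| < e.
  move=> gB gle; apply: (@complete_rcomplete R false (R^o : completeNormedModType R)).
  move=> e e0; have [N uN] := uc _ e0; exists N => k l Nk Nl.
  by apply: le_lt_trans (uN _ _ Nk Nl); rewrite /rnorm/= -gB; apply: gle.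
have [a ua] : exists l : R, forall e : R, 0 < e ->
    exists N, forall k, (N <= k)%N -> `|complex.Re (u k) - l| < e.
  apply: ReIm => [[? ?] [? ?]//|[x y]] /=.
  by rewrite -sqrtr_sqr ler_wsqrtr// lerDl sqr_ge0.
have [b ub] : exists l : R, forall e : R, 0 < e ->
    exists N, forall k, (N <= k)%N -> `|complex.Im (u k) - l| < e.
  apply: ReIm => [[? ?] [? ?]//|[x y]] /=.
  by rewrite -sqrtr_sqr ler_wsqrtr// lerDr sqr_ge0.
exists (a +i* b)%C => e e0; have e2 : 0 < e / 2 by rewrite divr_gt0.
have [N1 u1] := ua _ e2; have [N2 u2] := ub _ e2.
exists (maxn N1 N2) => k; rewrite geq_max => /andP[k1 k2].
move: (u1 _ k1) (u2 _ k2); case: (u k) => x y /= xa yb.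
rewrite -[ltRHS]gtr0_norm// -[ltRHS]sqrtr_sqr ltr_sqrt ?exprn_gt0//.
rewrite -(real_normK (num_real (x - a))) -(real_normK (num_real (y - b))).
have := normr_ge0 (x - a); have := normr_ge0 (y - b); nra.
Qed.

Lemma linear_of (V W : lmodType K) (f : V -> W) : linear f ->
  exists g : {linear V -> W}, forall x, g x = f x.
Proof.
move=> fl; pose m := GRing.isLinear.Build K V W *:%R f fl.
pose g : {linear V -> W} := HB.pack f m.
by exists g.
Qed.

Lemma invn_small (e : R) : 0 < e ->
  exists N, forall k, (N <= k)%N -> k.+1%:R^-1 < e.
Proof.
move=> e0; exists (Num.bound e^-1) => k Nk.
rewrite invf_plt ?posrE//.
apply: lt_le_trans (archi_boundP _) _; first by rewrite invr_ge0 ltW.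
by rewrite ler_nat (leq_trans Nk).
Qed.

Lemma rcvg_unique (V : normedModType K) (u : nat -> V) (l l' : V) :
  rcvg u l -> rcvg u l' -> l = l'.
Proof.
move=> ul ul'; apply/eqP; rewrite -subr_eq0; apply/eqP/rnorm_eq0/le_anti.
rewrite rnorm_ge0 andbT; apply/ler_addgt0Pr => e e0; rewrite add0r.
have e2 : 0 < e / 2 by rewrite divr_gt0.
have [N1 u1] := ul _ e2; have [N2 u2] := ul' _ e2.
have := u1 _ (leq_maxl N1 N2); have := u2 _ (leq_maxr N1 N2).
set v := u _ => v2 v1; have := rnormD (l - v) (v - l').
by rewrite subrKA [rnorm (l - v)]rnormB; lra.
Qed.

Lemma rcvg_lin (V : normedModType K) (u v : nat -> V) (l m : V) (a : K) :
  rcvg u l -> rcvg v m -> rcvg (fun k => a *: u k + v k) (a *: l + m).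
Proof.
move=> ul vm e e0; have a0 : 0 < modulus a + 1 by rewrite ltr_wpDl ?modulus_ge0.
have e2 : 0 < e / 2 / (modulus a + 1) by rewrite !divr_gt0.
have e3 : 0 < e / 2 by rewrite !divr_gt0.
have [N1 u1] := ul _ e2; have [N2 u2] := vm _ e3.
exists (maxn N1 N2) => k; rewrite geq_max => /andP[k1 k2].
rewrite opprD addrACA -scalerBr; apply: le_lt_trans (rnormD _ _) _.
have := u2 _ k2; have := u1 _ k1; rewrite ltr_pdivlMr// rnormZ -/(modulus a) => h1 h2.
have := modulus_ge0 a; have := rnorm_ge0 (u k - l); nra.
Qed.

Lemma rcvg_le (V : normedModType K) (u : nat -> V) (l : V) (C : R) :
  rcvg u l -> (exists N, forall k, (N <= k)%N -> rnorm (u k) <= C) -> rnorm l <= C.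
Proof.
move=> ul [N uC]; apply/ler_addgt0Pr => e e0; have [N1 u1] := ul _ e0.
have := uC _ (leq_maxl N N1); have := u1 _ (leq_maxr N N1); set v := u _ => h1 h2.
by have := rnorm_triB l v; rewrite [rnorm (l - v)]rnormB; lra.
Qed.

(** Operators and functionals are defined on the algebraic tensor product and
    reach its completion only through this extension. *)
Lemma extend_dense (V : lmodType K) (Z W : normedModType K)
    (J : {linear V -> Z}) (A : {linear V -> W}) (C : R) :
  0 <= C -> rcomplete W -> dense (range J) ->
  (forall v, rnorm (A v) <= C * rnorm (J v)) ->
  exists B : {linear Z -> W},
    (forall v, B (J v) = A v) /\ (forall z, rnorm (B z) <= C * rnorm z).
Proof.
move=> C0 Wc Jd AC.
(* The value at [z] is the limit of [A (v k)] along any [v] with [J (v k)]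
   converging to [z]; [Alim] makes it independent of [v]. *)
have appr z : exists v : nat -> V, rcvg (J \o v) z.
  have /choice[v vP] : forall k : nat, exists v, rnorm (z - J v) < k.+1%:R^-1.
    move=> k; have [|_ [v _ <-] zv] := dense_rnormP Jd z (e := k.+1%:R^-1).
      by rewrite invr_gt0 ltr0n.
    by exists v.
  exists v => e /invn_small[N NP]; exists N => k /NP ke; apply: lt_trans ke.
  by rewrite rnormB; apply: vP.
have Acvg z v : rcvg (J \o v) z -> exists l, rcvg (A \o v) l.
  move=> vz; apply: Wc => e e0.
  have C1 : 0 < 2 * (C + 1) by rewrite mulr_gt0// ltr_wpDl.
  pose d := e / (2 * (C + 1)); have d0 : 0 < d by rewrite divr_gt0.
  have de : 2 * (C * d) + 2 * d = e by rewrite /d; field; lra.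
  have [N vN] := vz _ d0; exists N => k l /vN h1 /vN h2.
  rewrite /= -linearB; apply: le_lt_trans (AC _) _; rewrite linearB.
  have := rnormD (J (v k) - z) (z - J (v l)); rewrite subrKA [rnorm (z - _)]rnormB.
  move: h1 h2 => /= /ltW h1 /ltW h2 h.
  have := ler_wpM2l C0 h; rewrite mulrDr.
  have := ler_wpM2l C0 h1; have := ler_wpM2l C0 h2; lra.
have Alim z z' v v' l l' : rcvg (J \o v) z -> rcvg (J \o v') z' ->
    rcvg (A \o v) l -> rcvg (A \o v') l' -> rnorm (l - l') <= C * rnorm (z - z').
  move=> vz vz' vl vl'; apply/ler_addgt0Pr => e e0.
  have C1 : 0 < 2 * (C + 1) by rewrite mulr_gt0// ltr_wpDl.
  pose d := e / (2 * (C + 1)); have d0 : 0 < d by rewrite divr_gt0.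
  have de : 2 * (C * d) + 2 * d = e by rewrite /d; field; lra.
  have [N1 n1] := vz _ d0; have [N2 n2] := vz' _ d0.
  have [N3 n3] := vl _ d0; have [N4 n4] := vl' _ d0.
  pose k := (N1 + N2 + N3 + N4)%N.
  have := n1 k; have := n2 k; have := n3 k; have := n4 k.
  move=> /= h4 h3 h2 h1.
  have {}h1 := h1 ltac:(by rewrite /k -!addnA leq_addr).
  have {}h2 := h2 ltac:(by rewrite /k addnAC -[(N1 + N2)%N]addnC -!addnA leq_addr).
  have {}h3 := h3 ltac:(by rewrite /k addnAC leq_addl).
  have {}h4 := h4 ltac:(by rewrite /k leq_addl).
  have := rnormD (l - A (v k)) (A (v k) - l').
  have := rnormD (A (v k) - A (v' k)) (A (v' k) - l').
  rewrite !subrKA [rnorm (l - A _)]rnormB.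
  have h5 : rnorm (A (v k) - A (v' k)) <= C * rnorm (J (v k) - J (v' k)).
    by rewrite -!linearB; apply: AC.
  have h6 := rnormD (J (v k) - z) (z - J (v' k)).
  have h7 := rnormD (z - z') (z' - J (v' k)).
  rewrite !subrKA [rnorm (z' - J _)]rnormB in h6 h7.
  have h8 : rnorm (J (v k) - J (v' k)) <= d + rnorm (z - z') + d by lra.
  have := ler_wpM2l C0 h8; rewrite !mulrDr; lra.
have /choice[f fP] : forall z, exists l, exists2 v, rcvg (J \o v) z & rcvg (A \o v) l.
  move=> z; have [v vz] := appr z; have [l vl] := Acvg _ _ vz.
  by exists l, v.
have f_uniq z v l : rcvg (J \o v) z -> rcvg (A \o v) l -> f z = l.
  move=> vz vl; have [w wz wl] := fP z.
  have := Alim _ _ _ _ _ _ wz vz wl vl; rewrite subrr rnorm0 mulr0 => h.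
  apply/eqP; rewrite -subr_eq0; apply/eqP/rnorm_eq0/le_anti.
  by rewrite h rnorm_ge0.
have fJ v : f (J v) = A v.
  by apply: (f_uniq _ (fun=> v)) => e e0; exists 0%N => k _; rewrite /= subrr rnorm0.
have fl : linear f.
  move=> a x y; have [v vx vl] := fP x; have [w wy wl] := fP y.
  apply: (f_uniq _ (fun k => a *: v k + w k)).
    have := rcvg_lin a vx wy; congr rcvg; apply: funext => k /=.
    by rewrite linearP.
  have := rcvg_lin a vl wl; congr rcvg; apply: funext => k /=.
  by rewrite linearP.
have [B BP] := linear_of fl; exists B; split=> [v|z]; rewrite BP//.
have [v vz vl] := fP z.
have := @Alim z 0 v (fun=> 0) (f z) 0 vz _ vl; rewrite !subr0; apply.
  by move=> e e0; exists 0%N => k _ /=; rewrite linear0 subrr rnorm0.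
by move=> e e0; exists 0%N => k _ /=; rewrite linear0 subrr rnorm0.
Qed.

End Extension.

(** * The Hahn-Banach theorem *)
(** The Hahn-Banach theorem passes from the reals to the scalars through this
    alternative. *)
Lemma scalars_cases (R : realType) (cplx : bool) (K := scalars R cplx) :
  (forall a : K, exists r, a = of_real r) \/
  exists i : K, [/\ i * i = -1,
    forall a, exists r s, a = of_real r + of_real s * i &
    forall r s, r <= modulus (of_real r + of_real s * i)].
Proof.
rewrite {}/K /of_real /modulus /rnorm /real_part /scalars.
case: cplx => /=; [right|by left=> a; exists a].
exists ('i)%C; split=> [|[a b]|r s]; first by rewrite -expr2 sqr_i.
  by exists a, b; rewrite [LHS]complexE mulrC.
have -> : (r%:C + s%:C * 'i)%C = (r +i* s)%C by rewrite [RHS]complexE mulrC.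
apply: le_trans (ler_norm _) _.
by rewrite /= -sqrtr_sqr ler_wsqrtr// lerDl sqr_ge0.
Qed.

Section HahnBanach.
Context {R : realType} {cplx : bool}.
Local Notation K := (scalars R cplx).
Variables (V : lmodType K) (p : V -> R) (z0 : V).
Hypothesis pD : forall x y, p (x + y) <= p x + p y.
Hypothesis pZ : forall a x, p (a *: x) = modulus a * p x.

Let p0 : p 0 = 0.
Proof. by rewrite -(scale0r (0 : V)) pZ modulus0 mul0r. Qed.

Let p_ge0 x : 0 <= p x.
Proof.
by have := pD x (- x); rewrite subrr -scaleN1r pZ modulusN modulus1 p0; lra.
Qed.

Let pR (t : R) x : p (of_real t *: x) = `|t| * p x.
Proof.
rewrite pZ; congr (_ * _); have [t0|t0] := ger0P t.
  by rewrite modulus_of_real.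
by rewrite -[of_real t]opprK modulusN -of_realN modulus_of_real// oppr_ge0 ltW.
Qed.

(** Partial real functionals are encoded by their graphs, so that the union of
    a chain is again one.  A graph containing [(0, r)] would contain all
    multiples of it, so domination by [p] forces graphs to be functional. *)
Let dominated (A : set (V * R)) : Prop :=
  [/\ forall x r y s, A (x, r) -> A (y, s) -> A (x + y, r + s),
      forall t x r, A (x, r) -> A (of_real t *: x, t * r),
      forall x r, A (x, r) -> r <= p x
    & forall q, A q -> A (z0, p z0)].

(** The value at the new point is the least one allowed by the constraints
    coming from negative multiples of [x]; subadditivity of [p] makes it
    compatible with those coming from positive multiples. *)
Let dominated_extend (A : set (V * R)) (x : V) (q0 : V * R) :
  dominated A -> A q0 ->
  exists r, dominated [set q | exists y s t,
    A (y, s) /\ q = (y + of_real t *: x, s + t * r)].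
Proof.
move=> [AD AZ Ap A0] Aq0.
pose L := [set l | exists y s, A (y, s) /\ l = s - p (y - x)].
have Lub y' s' l : A (y', s') -> L l -> l <= p (y' + x) - s'.
  move=> A' [y [s [Ays ->]]]; have := Ap _ _ (AD _ _ _ _ Ays A').
  by have := pD (y - x) (y' + x); rewrite addrACA addNr addr0; lra.
have Ls : has_sup L.
  split; first by case: q0 Aq0 => y s ys; exists (s - p (y - x)), y, s.
  case: q0 Aq0 => y s ys; exists (p (y + x) - s) => l; exact: Lub.
exists (sup L); split=> [_ _ _ _ [y [s [t [ys [-> ->]]]]] [y' [s' [t' [ys' [-> ->]]]]]
    |t' _ _ [y [s [t [ys [-> ->]]]]]|_ _ [y [s [t [ys [-> ->]]]]]|q _].
- exists (y + y'), (s + s'), (t + t'); split; first exact: AD.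
  by rewrite of_realD scalerDl mulrDl; congr (_, _); rewrite addrACA.
- exists (of_real t' *: y), (t' * s), (t' * t); split; first exact: AZ.
  by rewrite scalerDr scalerA of_realM mulrDr mulrA.
- have [t0|t0|->] := ltrgt0P t; last first.
  + by rewrite mul0r of_real0 scale0r !addr0; apply: Ap.
  + have u0 : 0 < - t by rewrite oppr_gt0.
    have h : (- t)^-1 * s - p (of_real (- t)^-1 *: y - x) <= sup L.
      by apply: (sup_upper_bound Ls); exists (of_real (- t)^-1 *: y), ((- t)^-1 * s); split=> //; apply: AZ.
    have -> : y + of_real t *: x = of_real (- t) *: (of_real (- t)^-1 *: y - x).
      rewrite scalerBr scalerA -of_realM divff ?gt_eqF// of_real1 scale1r.
      by rewrite of_realN scaleNr opprK.
    rewrite pR gtr0_norm//; have := ler_wpM2l (ltW u0) h.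
    by rewrite mulrBr mulrA divff ?gt_eqF// mul1r; lra.
  + have h : sup L <= p (of_real t^-1 *: y + x) - t^-1 * s.
      by apply: ge_sup; [case: Ls|move=> l; apply: Lub; apply: AZ].
    have -> : y + of_real t *: x = of_real t *: (of_real t^-1 *: y + x).
      by rewrite scalerDr scalerA -of_realM divff ?gt_eqF// of_real1 scale1r.
    rewrite pR gtr0_norm//; have := ler_wpM2l (ltW t0) h.
    by rewrite mulrBr mulrA divff ?gt_eqF// mul1r; lra.
- exists z0, (p z0), 0; split; first exact: A0 Aq0.
  by rewrite of_real0 scale0r mul0r !addr0.
Qed.

Let real_hahn_banach : exists g : V -> R,
  [/\ forall x y, g (x + y) = g x + g y, forall t x, g (of_real t *: x) = t * g x,
      forall x, g x <= p x & g z0 = p z0].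
Proof.
have [|A [Adom Amax]] := @Zorn_bigcup (V * R)%type dominated.
  move=> F FP Ftot; split.
  - move=> x r y s [B FB Bx] [C FC Cy].
    have [[BD _ _ _] [CD _ _ _]] := (FP _ FB, FP _ FC).
    have [BC|CB] := Ftot _ _ FB FC; [exists C|exists B] => //.
      exact: CD (BC _ Bx) Cy.
    exact: BD Bx (CB _ Cy).
  - by move=> t x r [B FB Bx]; exists B => //; have [_ + _ _] := FP _ FB; apply.
  - by move=> x r [B FB Bx]; have [_ _ + _] := FP _ FB; apply.
  - by move=> q [B FB Bx]; exists B => //; have [_ _ _ +] := FP _ FB; apply; exact: Bx.
have Amax' B : A `<=` B -> dominated B -> B `<=` A.
  move=> AB Bdom; apply: contrapT => BA; exact: (Amax B (conj AB BA) Bdom).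
have Az : A (z0, p z0).
  apply: contrapT => nA.
  have A0 q : A q -> False by case: Adom => _ _ _ A0 /A0.
  pose B := [set q : V * R | exists t, q = (of_real t *: z0, t * p z0)].
  have Bz : B (z0, p z0) by exists 1; rewrite of_real1 scale1r mul1r.
  apply: nA; apply: (Amax' B) (Bz); first by move=> q /A0.
  split=> [_ _ _ _ [t [-> ->]] [t' [-> ->]]|t' _ _ [t [-> ->]]|_ _ [t [-> ->]]|q _//].
  - by exists (t + t'); rewrite of_realD scalerDl mulrDl.
  - by exists (t' * t); rewrite of_realM scalerA mulrA.
  - by rewrite pR; apply: ler_wpM2r => //; apply: ler_norm.
have [AD AZ Ap _] := Adom.
have A00 : A (0, 0) by have := AZ 0 _ _ Az; rewrite of_real0 scale0r mul0r.
have /choice[g gA] : forall x, exists r, A (x, r).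
  move=> x; have [r Bdom] := dominated_extend x Adom Az.
  exists r; apply: (Amax' _ _ Bdom).
    move=> [y s] ys; exists y, s, 0; split=> //.
    by rewrite of_real0 scale0r mul0r !addr0.
  by exists 0, 0, 1; split=> //; rewrite of_real1 scale1r mul1r !add0r.
have Aun x r s : A (x, r) -> A (x, s) -> r = s.
  move=> xr xs; have le0 t : t * (r - s) <= 0.
    have := AD _ _ _ _ xr (AZ (-1) _ _ xs).
    rewrite of_realN of_real1 scaleN1r subrr mulN1r => /(AZ t)/Ap.
    by rewrite scaler0 p0.
  by have := le0 1; have := le0 (-1); lra.
exists g; split=> [x y|t x|x|].
- exact: Aun (gA _) (AD _ _ _ _ (gA x) (gA y)).
- exact: Aun (gA _) (AZ _ _ _ (gA x)).
- exact: Ap.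
- exact: Aun (gA _) Az.
Qed.


Lemma hahn_banach : exists f : {linear V -> K^o},
  (forall x, modulus (f x) <= p x) /\ f z0 = of_real (p z0).
Proof.
have [g [gD gZ gp gz]] := real_hahn_banach.
suff [f fP fz] : exists2 f : {linear V -> K^o},
    (forall x, modulus (f x) <= p x) & p z0 <= modulus (f z0).
  have [t t1 tf] := phase (f z0).
  have [|h hE] := @linear_of R cplx V K^o (fun x => t * f x).
    by move=> a x y; rewrite linearD linearZ mulrDr /= /GRing.scale/= mulrCA.
  exists h; split=> [x|]; rewrite hE; first by rewrite modulusM t1 mul1r.
  by rewrite tf; congr of_real; apply/le_anti; rewrite fP fz.
have gN x : g (- x) = - g x.
  by rewrite -scaleN1r -of_real1 -of_realN gZ mulN1r.
case: (@scalars_cases R cplx) => [Kr|[i [ii iP ire]]].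
  have [|f fE] := @linear_of R cplx V K^o (fun x => of_real (g x)).
    by move=> a x y; have [r ->] := Kr a; rewrite gD gZ of_realD of_realM.
  have mf x : modulus (f x) = `|g x|.
    rewrite fE; have [t0|t0] := ger0P (g x); first by rewrite modulus_of_real.
    by rewrite -modulusN -of_realN modulus_of_real// oppr_ge0 ltW.
  exists f => [x|]; rewrite mf; last by rewrite gz ler_norm.
  rewrite ler_norml gp andbT lerNl -gN; apply: le_trans (gp _) _.
  by rewrite -scaleN1r pZ modulusN modulus1 mul1r.
(* The complex functional with real part [g]. *)
have [|f fE] := @linear_of R cplx V K^o
    (fun x => of_real (g x) - of_real (g (i *: x)) * i).
  move=> a x y; have [r [s ->]] := iP a.
  have e1 : (of_real r + of_real s * i) *: x + y =
      of_real r *: x + of_real s *: (i *: x) + y.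
    by rewrite scalerDl -scalerA.
  have e2 : i *: ((of_real r + of_real s * i) *: x + y) =
      of_real r *: (i *: x) + of_real s *: - x + i *: y.
    rewrite e1 !scalerDr; congr (_ + _ + _); rewrite !scalerA; first by rewrite mulrC.
    by rewrite mulrAC ii mulN1r scaleNr scalerN.
  rewrite e2 e1 !(gD, gN, gZ) !(of_realD, of_realN, of_realM) /GRing.scale/=.
  by ring: ii.
exists f => [x|]; last by rewrite fE -mulNr -of_realN -gz; apply: ire.
(* Rotating [x] makes [f x] real, hence equal to its real part. *)
have [t t1 tf] := phase (f x).
have : f (t *: x) = of_real (modulus (f x)) by rewrite linearZ.
rewrite fE => e; have := ire (g (t *: x) - modulus (f x)) (- g (i *: (t *: x))).
have := ire (modulus (f x) - g (t *: x)) (g (i *: (t *: x))).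
have -> : of_real (modulus (f x) - g (t *: x)) + of_real (g (i *: (t *: x))) * i = 0.
  by rewrite of_realD of_realN -e; ring.
rewrite modulus0 subr_le0 => h _; apply: le_trans h _; apply: le_trans (gp _) _.
by rewrite pZ t1 mul1r.
Qed.

End HahnBanach.

(** * Infinite dimensional subspaces *)
Section Subspaces.
Context {R : realType} {cplx : bool}.
Local Notation K := (scalars R cplx).

(** Closedness is dropped here: passing to subspaces destroys it, and it is
    recovered by taking closures at the very end. *)
Definition infdim (V : lmodType K) (Y : set V) : Prop :=
  linear_subspace Y /\ ~ finite_dimensional Y.

Section Linear.
Variables (V : lmodType K) (Y : set V).
Hypothesis Ylin : linear_subspace Y.

Lemma subspaceD x y : Y x -> Y y -> Y (x + y).
Proof. by move=> Yx Yy; have := Ylin.2 1 _ _ Yx Yy; rewrite scale1r. Qed.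

Lemma subspaceZ a x : Y x -> Y (a *: x).
Proof. by move=> Yx; have := Ylin.2 a _ _ Yx Ylin.1; rewrite addr0. Qed.

Lemma subspaceB x y : Y x -> Y y -> Y (x - y).
Proof. by move=> Yx Yy; rewrite -scaleN1r; apply/subspaceD/subspaceZ. Qed.

Lemma subspace_sum (I : Type) (r : seq I) (P : pred I) (F : I -> V) :
  (forall i, P i -> Y (F i)) -> Y (\sum_(i <- r | P i) F i).
Proof. by move=> YF; elim/big_ind: _ => //; [exact: Ylin.1|exact: subspaceD]. Qed.

End Linear.

(** If the kernel were spanned by finitely many vectors, adding one vector on
    which [g] does not vanish would span [Y]. *)
Lemma infdim_kernel (V : lmodType K) (Y : set V) (g : {linear V -> K^o}) :
  infdim Y -> infdim [set y | Y y /\ g y = 0].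
Proof.
move=> [Yl Yinf]; split.
  split=> [|a x y [Yx gx] [Yy gy]]; first by rewrite /= linear0; split=> //; exact: Yl.1.
  by rewrite /= linearP gx gy scaler0 addr0; split=> //; apply: Yl.2.
move=> [m [e [eY eP]]]; apply: Yinf.
have [[y0 [Yy0 gy0]]|H] := pselect (exists y, Y y /\ g y <> 0); last first.
  exists m, e; split=> [k|y Yy]; first by case: (eY k).
  by apply: eP; split=> //; apply: contrapT => gy; apply: H; exists y.
exists m.+1, (fun k => if unlift ord0 k is Some j then e j else y0); split=> [k|y Yy].
  by case: unliftP => [j _|_] //; case: (eY j).
have [|c cE] := eP (y - (g y / g y0 : K) *: y0).
  split; first by apply: subspaceB => //; apply: subspaceZ.
  rewrite linearB linearZ /= /GRing.scale /= mulfVK ?subrr//; exact/eqP.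
exists (fun k => if unlift ord0 k is Some j then c j else g y / g y0).
rewrite big_ord_recl unlift_none; under eq_bigr => k _ do rewrite liftK.
by rewrite -cE addrC subrK.
Qed.

Lemma infdim_kernels (V : lmodType K) (I : eqType) (s : seq I) (g : I -> {linear V -> K^o})
    (Y : set V) :
  infdim Y -> infdim [set y | Y y /\ forall i, i \in s -> g i y = 0].
Proof.
elim: s Y => [|i s IH] Y Yinf.
  suff -> : [set y | Y y /\ forall i, i \in [::] -> g i y = 0] = Y by [].
  by apply/seteqP; split=> [y []|].
have /IH := infdim_kernel (g i) Yinf; congr infdim; apply/seteqP; split=> y /=.
  by move=> [[Yy gy] H]; split=> // j; rewrite inE => /predU1P[->//|]; apply: H.
move=> [Yy H]; split; first by split=> //; apply: H; rewrite mem_head.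
by move=> j js; apply: H; rewrite inE js orbT.
Qed.

Lemma infdim_neq0 (V : lmodType K) (Y : set V) : infdim Y -> exists2 y, Y y & y <> 0.
Proof.
move=> [Yl Yinf]; apply: contrapT => H; apply: Yinf.
exists 0%N, (fun=> 0); split=> [[]//|y Yy]; exists (fun=> 0); rewrite big_ord0.
by apply: contrapT => y0; apply: H; exists y.
Qed.

Definition independent (V : lmodType K) (y : nat -> V) : Prop :=
  forall (M : nat) (a : nat -> K), \sum_(k < M) a k *: y k = 0 ->
    forall k, (k < M)%N -> a k = 0.

(** More vectors than generators: the matrix of their coefficients has a
    nonzero row kernel, which is a linear relation. *)
Lemma independent_infdim (V : lmodType K) (Y : set V) (y : nat -> V) :
  linear_subspace Y -> (forall k, Y (y k)) -> independent y -> infdim Y.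
Proof.
move=> Yl Yy yi; split=> // -[m [e [eY eP]]].
have /choice[c cP] : forall k, exists c : 'I_m -> K, y k = \sum_(l < m) c l *: e l.
  by move=> k; apply: eP.
pose C : 'M[K]_(m.+1, m) := \matrix_(k, l) c k l.
have /rowV0Pn[v /sub_kermxP vC v0] : kermx C != 0.
  by rewrite kermx_eq0 /row_free neq_ltn (leq_ltn_trans (rank_leq_col _)).
pose a k := v 0 (inord k : 'I_m.+1).
have : \sum_(k < m.+1) a k *: y k = 0.
  under eq_bigr => k _ do rewrite cP scaler_sumr.
  rewrite exchange_big /= big1// => l _.
  under eq_bigr => k _ do rewrite scalerA.
  rewrite -scaler_suml; suff -> : \sum_(k < m.+1) a k * c k l = 0 by rewrite scale0r.
  have := congr1 (fun B : 'rV_m => B 0 l) vC; rewrite !mxE => E; rewrite -[RHS]E.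
  by apply: eq_bigr => k _; rewrite mxE /a inord_val.
move=> /yi a0; case/eqP: v0; apply/rowP => k; rewrite mxE.
by have := a0 k (ltn_ord k); rewrite /a inord_val.
Qed.

Definition lin_span (V : lmodType K) (y : nat -> V) : set V :=
  [set w | exists M (a : nat -> K), w = \sum_(k < M) a k *: y k].

Lemma sum_widen (V : lmodType K) (y : nat -> V) (a : nat -> K) M N : (M <= N)%N ->
  \sum_(k < M) a k *: y k = \sum_(k < N) (if (k < M)%N then a k else 0) *: y k.
Proof.
move=> MN; rewrite (big_ord_widen N (fun k => a k *: y k) MN) big_mkcond /=.
by apply: eq_bigr => k _; case: ifP; rewrite ?scale0r.
Qed.

Lemma lin_span_subspace (V : lmodType K) (y : nat -> V) : linear_subspace (lin_span y).
Proof.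
split=> [|a _ _ [M [b ->]] [N [c ->]]]; first by exists 0%N, (fun=> 0); rewrite big_ord0.
rewrite (sum_widen y b (leq_maxl M N)) (sum_widen y c (leq_maxr M N)).
exists (maxn M N), (fun k => a * (if (k < M)%N then b k else 0) + (if (k < N)%N then c k else 0)).
rewrite scaler_sumr -big_split /=; apply: eq_bigr => k _.
by rewrite scalerDl scalerA.
Qed.

Lemma lin_span_sub (V : lmodType K) (y : nat -> V) (Y : set V) :
  linear_subspace Y -> (forall k, Y (y k)) -> lin_span y `<=` Y.
Proof.
move=> Yl Yy _ [M [a ->]]; apply: subspace_sum => // k _; exact: subspaceZ.
Qed.

Lemma lin_span_mem (V : lmodType K) (y : nat -> V) k : lin_span y (y k).
Proof.
exists k.+1, (fun l => (l == k)%:R); rewrite big_ord_recr /= eqxx scale1r.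
rewrite big1 ?add0r// => l _; rewrite ltn_eqF ?scale0r//; exact: ltn_ord.
Qed.

End Subspaces.

(** * Closures *)
Section Closures.
Context {R : realType} {cplx : bool}.
Local Notation K := (scalars R cplx).
Variable V : normedModType K.
Implicit Types Y W : set V.

Definition rclosure Y : set V :=
  [set x | forall e : R, 0 < e -> exists2 y, Y y & rnorm (x - y) < e].

Lemma sub_rclosure Y : Y `<=` rclosure Y.
Proof. by move=> y Yy e e0; exists y => //; rewrite subrr rnorm0. Qed.

Lemma rclosure_closed Y : closed (rclosure Y).
Proof.
apply/closed_rnormP => x xY e e0; have e2 : 0 < e / 2 by rewrite divr_gt0.
have [z zY xz] := xY _ e2; have [y Yy zy] := zY _ e2; exists y => //.
by have := rnormD (x - z) (z - y); rewrite subrKA; lra.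
Qed.

Lemma rclosure_sub Y W : closed W -> Y `<=` W -> rclosure Y `<=` W.
Proof.
move=> /closed_rnormP Wc YW x xY; apply: Wc => e e0.
by have [y Yy xy] := xY _ e0; exists y => //; apply: YW.
Qed.

Lemma rclosure_subspace Y : linear_subspace Y -> linear_subspace (rclosure Y).
Proof.
move=> Yl; split=> [|a x y xY yY e e0]; first exact/sub_rclosure/Yl.1.
have e2 : 0 < e / 2 by rewrite divr_gt0.
have a1 : 0 < modulus a + 1 by rewrite ltr_wpDl ?modulus_ge0.
have [y' Yy' yy'] := yY _ e2.
have [|x' Yx' xx'] := xY (e / 2 / (modulus a + 1)); first by rewrite divr_gt0.
exists (a *: x' + y'); first exact: Yl.2.
rewrite opprD addrACA -scalerBr; apply: le_lt_trans (rnormD _ _) _.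
rewrite ltr_pdivlMr// in xx'; rewrite rnormZ -/(modulus a).
have := modulus_ge0 a; have := rnorm_ge0 (x - x'); nra.
Qed.

Lemma rcvg_rclosure Y (u : nat -> V) l : rcvg u l -> (forall k, Y (u k)) -> rclosure Y l.
Proof.
move=> ul uY e e0; have [N uN] := ul _ e0; exists (u N) => //.
by rewrite rnormB; apply: uN.
Qed.

Lemma rclosure_le (U W : normedModType K) (f : {linear V -> U}) (g : {linear V -> W})
    (C D : R) Y :
  (forall x, rnorm (f x) <= C * rnorm x) -> (forall x, rnorm (g x) <= D * rnorm x) ->
  (forall y, Y y -> rnorm (f y) <= rnorm (g y)) ->
  forall x, rclosure Y x -> rnorm (f x) <= rnorm (g x).
Proof.
move=> fC gD fg x xY; apply/ler_addgt0Pr => e e0.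
have CD : 0 < `|C| + `|D| + 1 by rewrite ltr_wpDl ?addr_ge0.
have [|y Yy xy] := xY (e / (`|C| + `|D| + 1)); first by rewrite divr_gt0.
rewrite ltr_pdivlMr// in xy.
have h1 := rnorm_triB (f x) (f y); rewrite -linearB in h1.
have h2 : rnorm (g y) <= rnorm (g x) + rnorm (g (x - y)).
  by rewrite linearB rnormB; apply: rnorm_triB.
have := fg _ Yy; have := fC (x - y); have := gD (x - y).
have := ler_norm C; have := ler_norm D; have := rnorm_ge0 (x - y); nra.
Qed.

End Closures.

(** * Operators close to the identity on a subspace *)
Section Neumann.
Context {R : realType} {cplx : bool}.
Local Notation K := (scalars R cplx).

Lemma geometric_cauchy (V : normedModType K) (u : nat -> V) (c : R) :
  (forall k, rnorm (u k.+1 - u k) <= c * 2^-1 ^+ k) -> rcauchy u.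
Proof.
move=> uc e e0.
have c0 : 0 <= c by have := le_trans (rnorm_ge0 _) (uc 0%N); rewrite expr0 mulr1.
have h k l : rnorm (u (k + l)%N - u k) <= c * 2^-1 ^+ k * (2 - 2 * 2^-1 ^+ l).
  elim: l => [|l IH]; first by rewrite addn0 subrr rnorm0 expr0; lra.
  rewrite addnS -(subrKA (u (k + l)%N)); apply: le_trans (rnormD _ _) _.
  have := uc (k + l)%N; rewrite exprD exprS.
  move: IH; set x := 2^-1 ^+ k; set y := 2^-1 ^+ l; nra.
have h2 k l : rnorm (u (k + l)%N - u k) <= 2 * c * 2^-1 ^+ k.
  apply: le_trans (h k l) _.
  have : 0 <= c * 2^-1 ^+ k * 2^-1 ^+ l by rewrite !mulr_ge0// exprn_ge0// invr_ge0.
  lra.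
have c4 : 0 < 4 * c + 1 by lra.
have [N NP] : exists N, 2^-1 ^+ N < e / (4 * c + 1).
  have [N NP] := @invn_small R (e / (4 * c + 1)) ltac:(by rewrite divr_gt0).
  exists N; apply: le_lt_trans (NP N (leqnn N)).
  by rewrite exprVn lef_pV2 ?posrE ?exprn_gt0// -natrX ler_nat ltn_expl.
exists N => k l Nk Nl; rewrite -(subrKA (u N)); apply: le_lt_trans (rnormD _ _) _.
rewrite [rnorm (u N - _)]rnormB.
have := h2 N (k - N)%N; have := h2 N (l - N)%N; rewrite !subnKC//.
rewrite ltr_pdivlMr// in NP; have : 0 <= 2^-1 ^+ N :> R by rewrite exprn_ge0// invr_ge0.
nra.
Qed.

(** On [W] the operator [A] is invertible, and [A] followed by this inverse is a
    projection onto [W].  The inverse image of [A z] is the limit of the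
    iteration [w := w + A (z - w)], whose error is halved at each step. *)
Lemma neumann_complemented (Z : completeNormedModType K) (W : set Z)
    (A : {linear Z -> Z}) (C : R) :
  0 <= C -> (forall z, rnorm (A z) <= C * rnorm z) ->
  linear_subspace W -> closed W -> (forall z, W (A z)) ->
  (forall w, W w -> rnorm (A w - w) <= 2^-1 * rnorm w) ->
  complemented W.
Proof.
move=> C0 AC Wl Wc WA Aw.
have low w : W w -> rnorm w <= 2 * rnorm (A w).
  by move=> /Aw; have := rnorm_triB w (A w); rewrite [rnorm (w - _)]rnormB; lra.
have ex z : exists2 w, W w & A w = A z.
  pose w := fix w k := if k is k'.+1 then w k' + A (z - w k') else 0.
  have Ww k : W (w k).
    by elim: k => [|k IH] /=; [exact: Wl.1|apply: subspaceD].
  have r k : rnorm (A (z - w k)) <= rnorm (A z) * 2^-1 ^+ k.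
    elim: k => [|k IH] /=; first by rewrite subr0 expr0 mulr1.
    rewrite opprD addrA linearB rnormB; apply: le_trans (Aw _ (WA _)) _.
    by rewrite exprS mulrCA; apply: ler_wpM2l => //; rewrite invr_ge0.
  have [l wl] : exists l, rcvg w l.
    apply: complete_rcomplete; apply: (@geometric_cauchy _ _ (rnorm (A z))) => k /=.
    by rewrite addrAC subrr add0r.
  have Wlim : W l.
    by apply: (rclosure_sub Wc (Y := W)) => //; apply: rcvg_rclosure wl Ww.
  exists l => //; apply: (@rcvg_unique _ _ _ (fun k => A (w k))) => e e0.
    have [|N wN] := wl (e / (C + 1)); first by rewrite divr_gt0// ltr_wpDl.
    exists N => k /wN; rewrite ltr_pdivlMr ?ltr_wpDl// -linearB => h.
    by apply: le_lt_trans (AC _) _; have := rnorm_ge0 (w k - l); nra.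
  have c0 : 0 < rnorm (A z) + 1 by rewrite ltr_wpDl ?rnorm_ge0.
  have [N NP] := @invn_small R (e / (rnorm (A z) + 1)) ltac:(by rewrite divr_gt0).
  exists N => k /NP; rewrite ltr_pdivlMr// => h; rewrite rnormB -linearB.
  apply: le_lt_trans (r k) _; apply: le_lt_trans h.
  have k2 : 2^-1 ^+ k <= k.+1%:R^-1 :> R.
    by rewrite exprVn lef_pV2 ?posrE ?exprn_gt0// -natrX ler_nat ltn_expl.
  have : 0 <= 2^-1 ^+ k :> R by rewrite exprn_ge0// invr_ge0.
  move: k2; set x := 2^-1 ^+ k; set y := _^-1 => xy x0.
  have := ler_wpM2l (rnorm_ge0 (A z)) xy; rewrite mulrDr mulr1 mulrC; lra.
have /choice[p pP] : forall z, exists w, W w /\ A w = A z.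
  by move=> z; have [w] := ex z; exists w.
have uniq v w : W v -> W w -> A v = A w -> v = w.
  move=> Wv Ww vw; apply/eqP; rewrite -subr_eq0; apply/eqP/rnorm_eq0.
  have := low _ (subspaceB Wl Wv Ww); rewrite linearB vw subrr rnorm0 mulr0.
  by have := rnorm_ge0 (v - w); lra.
have pl : linear p.
  move=> a x y; apply: uniq; [by case: (pP (a *: x + y))| |].
    by apply: Wl.2; [case: (pP x)|case: (pP y)].
  by rewrite (pP _).2 !linearP (pP x).2 (pP y).2.
have [P PE] := linear_of pl; exists P; split.
- apply: (@bounded_continuous _ _ _ _ _ (2 * C)) => x; rewrite PE.
  have := low _ (pP x).1; rewrite (pP x).2; have := AC x; lra.
- by move=> x; rewrite !PE; apply: uniq; rewrite ?(pP _).2//; case: (pP (p x)); case: (pP x).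
- apply/seteqP; split=> [_ [x _ <-]|w Ww]; first by rewrite PE; case: (pP x).
  by exists w => //; rewrite PE; apply: uniq => //; case: (pP w).
Qed.

End Neumann.

(** * Coordinate multipliers *)
Section Multipliers.
Context {R : realType} {cplx : bool} {n : nat}.
Local Notation K := (scalars R cplx).
Variables (Z : completeNormedModType K) (hat : ('I_n -> nat) -> {linear Z -> K^o}).

Definition is_multiplier (mu : ('I_n -> nat) -> K) (T : {linear Z -> Z}) : Prop :=
  forall z j, hat j (T z) = mu j * hat j z.

(** Norm bounds are carried along because the multipliers used later form
    infinite families that must be bounded uniformly. *)
Definition multiplier (mu : ('I_n -> nat) -> K) (C : R) : Prop :=
  exists2 T : {linear Z -> Z}, is_multiplier mu T & forall z, rnorm (T z) <= C * rnorm z.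

Definition box (B : 'I_n -> pred nat) (j : 'I_n -> nat) : K :=
  [forall i, B i (j i)]%:R.

Lemma box_prod B j : box B j = \prod_(i < n) (B i (j i))%:R.
Proof.
rewrite /box; have [/forallP h|/forallPn[i hi]] := boolP [forall i, B i (j i)].
  by rewrite big1// => i _; rewrite h.
by rewrite (bigD1 i)//= (negbTE hi) mul0r.
Qed.

Lemma boxM B B' j :
  box B j * box B' j = box (fun i l => B i l && B' i l) j.
Proof.
rewrite /box -natrM mulnb; congr (_%:R); congr nat_of_bool; apply/andP/forallP.
  by move=> [/forallP h /forallP h'] i; rewrite h h'.
by move=> h; split; apply/forallP => i; case/andP: (h i).
Qed.

Definition block (S : {set 'I_n}) (j0 : 'I_n -> nat) (a b : nat) : ('I_n -> nat) -> K :=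
  box (fun i l => if i \in S then (a <= l < b)%N else l == j0 i).

Definition slice (S : {set 'I_n}) (j0 : 'I_n -> nat) : ('I_n -> nat) -> K :=
  box (fun i l => (i \in S) || (l == j0 i)).

Definition corner (N : nat) : ('I_n -> nat) -> K := box (fun _ l => (l < N)%N).

Variable C0 : R.
Hypothesis C0_ge1 : 1 <= C0.
Hypothesis hat_inj : forall z, (forall j, hat j z = 0) -> z = 0.
Hypothesis product_multiplier : forall m : 'I_n -> nat -> K,
  (forall i l, modulus (m i l) <= 1) ->
  multiplier (fun j => \prod_(i < n) m i (j i)) C0.

Lemma hat_eq z w : (forall j, hat j z = hat j w) -> z = w.
Proof.
move=> zw; apply/eqP; rewrite -subr_eq0; apply/eqP/hat_inj => j.
by rewrite linearB zw subrr.
Qed.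

Lemma multiplier_ext mu nu C : (forall j, mu j = nu j) -> multiplier mu C -> multiplier nu C.
Proof. by move=> mn [T Tm TC]; exists T => // z j; rewrite Tm mn. Qed.

Lemma multiplierM mu nu C D : 0 <= C -> multiplier mu C -> multiplier nu D ->
  multiplier (fun j => mu j * nu j) (C * D).
Proof.
move=> C0' [T Tm TC] [U Um UD].
exists (T \o U : {linear Z -> Z}) => [z j|z] /=; first by rewrite Tm Um mulrA.
by apply: le_trans (TC _) _; rewrite -mulrA; apply: ler_wpM2l.
Qed.

Lemma multiplier_avg mu nu C : multiplier mu C -> multiplier nu C ->
  multiplier (fun j => (mu j + nu j) / 2) C.
Proof.
move=> [T Tm TC] [U Um UC].
have [|W WE] := @linear_of _ _ Z Z (fun z => of_real 2^-1 *: (T z + U z)).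
  by move=> a x y; rewrite !linearP !scalerDr !scalerA [of_real _ * a]mulrC addrACA.
exists W => [z j|z]; rewrite WE.
  have half : of_real 2^-1 = 2^-1 :> K by rewrite of_realV of_real_nat.
  by rewrite linearZ linearD /= Tm Um half /GRing.scale/=; ring.
rewrite rnormZ -/(modulus _) modulus_of_real ?invr_ge0//.
by have := rnormD (T z) (U z); have := TC z; have := UC z; lra.
Qed.

Lemma box_multiplier B : multiplier (box B) C0.
Proof.
apply: multiplier_ext (product_multiplier (m := fun i l => (B i l)%:R) _).
  by move=> j; rewrite box_prod.
by move=> i l; case: (B i l); rewrite ?modulus1 ?modulus0 ?ler01.
Qed.

(** Injectivity of the coordinates determines the operator of a multiplier, so
    that naming one is harmless; [0] stands for functions without operator. *)
Definition op (mu : ('I_n -> nat) -> K) : {linear Z -> Z} :=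
  xget (\0 : {linear Z -> Z}) (is_multiplier mu).

Lemma hat_op mu C : multiplier mu C -> forall z j, hat j (op mu z) = mu j * hat j z.
Proof. by move=> [T Tm _]; apply: (@xgetPex _ _ (is_multiplier mu)); exists T. Qed.

Lemma op_bound mu C : multiplier mu C -> forall z, rnorm (op mu z) <= C * rnorm z.
Proof.
move=> muC z; have [T Tm TC] := muC; suff -> : op mu z = T z by [].
by apply: hat_eq => j; rewrite (hat_op muC) Tm.
Qed.

Lemma hat_box B z j : hat j (op (box B) z) = box B j * hat j z.
Proof. exact: hat_op (box_multiplier B) _ _. Qed.

Lemma box_bound B z : rnorm (op (box B) z) <= C0 * rnorm z.
Proof. exact: op_bound (box_multiplier B) _. Qed.

Section Diagonal.
Variable N_ : nat -> nat.
Hypothesis N_homo : {homo N_ : a b / (a <= b)%N}.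

Lemma block_unique k k' l :
  (N_ k <= l < N_ k.+1)%N -> (N_ k' <= l < N_ k'.+1)%N -> k = k'.
Proof.
move=> /andP[h1 h2] /andP[h3 h4]; apply/eqP; rewrite eqn_leq; apply/andP; split.
  rewrite leqNgt; apply/negP => /N_homo h; have := leq_trans h h1; by rewrite leqNgt h4.
rewrite leqNgt; apply/negP => /N_homo h; have := leq_trans h h3; by rewrite leqNgt h2.
Qed.

Lemma block_exists M l : (N_ 0 <= l < N_ M)%N -> exists2 k, (k < M)%N & (N_ k <= l < N_ k.+1)%N.
Proof.
elim: M => [|M IH]; first by case/andP => h1 h2; have := leq_ltn_trans h1 h2; rewrite ltnn.
move=> /andP[h1 h2]; have [h|h] := ltnP l (N_ M).
  by have [|k kM kl] := IH; [rewrite h1|exists k => //; apply: ltnW].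
by exists M => //; rewrite h.
Qed.

Let ind k l : K := (N_ k <= l < N_ k.+1)%N%:R.

Let prod_pair (a b : nat -> K) (i i' : 'I_n) j : i != i' ->
  \prod_(k < n) (if k == i then a (j k) else if k == i' then b (j k) else 1) =
  a (j i) * b (j i').
Proof.
move=> ii'; have i'i : (i' == i) = false by rewrite eq_sym; apply/negbTE.
rewrite (bigD1 i)//= eqxx (bigD1 i') ?i'i//= eqxx.
by rewrite big1 ?mulr1// => k /andP[/negbTE -> /negbTE ->].
Qed.

(** Two coordinates are forced into a common block by averaging over signs
    attached to the blocks.  The blocks are added one at a time: if [x] and [y]
    are the indicators of the new block at the two coordinates, then
    [(a + x) (b + y)] and [(a - x) (b - y)] average to [a b + x y].  The bound
    does not grow with the number of blocks, since both factors keep modulus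
    at most one. *)
Lemma pair_multiplier (i i' : 'I_n) M : i != i' ->
  multiplier (fun j => \sum_(k < M) ind k (j i) * ind k (j i')) C0.
Proof.
move=> ii'.
suff H : forall a b : nat -> K,
    (forall l, modulus (a l) <= 1) -> (forall l, modulus (b l) <= 1) ->
    (forall k l, (k < M)%N -> (N_ k <= l < N_ k.+1)%N -> a l = 0 /\ b l = 0) ->
    multiplier (fun j => a (j i) * b (j i') + \sum_(k < M) ind k (j i) * ind k (j i')) C0.
  apply: multiplier_ext (H (fun=> 0) (fun=> 0) _ _ _) => [j|l|l|//]; rewrite ?modulus0//.
  by rewrite mul0r add0r.
elim: M => [|M IH] a b a1 b1 ab0.
  apply: multiplier_ext (product_multiplier
    (m := fun k l => if k == i then a l else if k == i' then b l else 1) _).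
    by move=> j; rewrite big_ord0 addr0 prod_pair.
  by move=> k l; case: ifP => _ //; case: ifP => _ //; rewrite modulus1.
have sgn (s : K) : modulus s <= 1 -> multiplier (fun j =>
    (a (j i) + s * ind M (j i)) * (b (j i') + s * ind M (j i')) +
    \sum_(k < M) ind k (j i) * ind k (j i')) C0.
  move=> s1; apply: (IH (fun l => a l + s * ind M l) (fun l => b l + s * ind M l)).
  - move=> l; rewrite /ind; case: (boolP (N_ M <= l < N_ M.+1)%N) => h.
      by rewrite (ab0 M l _ h).1// add0r mulr1.
    by rewrite mulr0 addr0.
  - move=> l; rewrite /ind; case: (boolP (N_ M <= l < N_ M.+1)%N) => h.
      by rewrite (ab0 M l _ h).2// add0r mulr1.
    by rewrite mulr0 addr0.
  - move=> k l kM kl; have [-> ->] := ab0 _ _ (ltnW kM) kl; rewrite !add0r /ind.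
    case: (boolP (N_ M <= l < N_ M.+1)%N) => h; last by rewrite mulr0.
    by move: kM; rewrite (block_unique kl h) ltnn.
have s1 : modulus (1 : K) <= 1 by rewrite modulus1.
have s2 : modulus (-1 : K) <= 1 by rewrite modulusN modulus1.
apply: multiplier_ext (multiplier_avg (sgn 1 s1) (sgn (-1) s2)) => j.
rewrite big_ord_recr /=; set s := \sum_(k < M) _; set x := ind M _; set y := ind M _.
by field.
Qed.

(** Forcing every coordinate in [S] into the block of [i0] leaves exactly the
    diagonal cubes. *)
Lemma diagonal_multiplier (S : {set 'I_n}) j0 (i0 : 'I_n) M : i0 \in S ->
  multiplier (fun j => \sum_(k < M) block S j0 (N_ k) (N_ k.+1) j) (C0 * C0 ^+ n).
Proof.
move=> i0S.
pose F i : ('I_n -> nat) -> K := fun j =>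
  if (i \in S) && (i != i0) then \sum_(k < M) ind k (j i0) * ind k (j i) else 1.
have c0 : 0 <= C0 := le_trans ler01 C0_ge1.
have Fm i : multiplier (F i) C0.
  rewrite /F; case: (boolP ((i \in S) && (i != i0))) => [/andP[_ ii0]|_].
    by apply: pair_multiplier; rewrite eq_sym.
  apply: multiplier_ext (box_multiplier (fun _ => predT)) => j.
  by rewrite box_prod big1.
have Fprod : forall s : seq 'I_n,
    multiplier (fun j => block S j0 (N_ 0) (N_ M) j * \prod_(i <- s) F i j) (C0 * C0 ^+ size s).
  elim=> [|i s IH].
    rewrite expr0 mulr1; apply: multiplier_ext (box_multiplier _) => j.
    by rewrite big_nil mulr1.
  rewrite /= exprS; apply: multiplier_ext (multiplierM c0 (Fm i) IH) => j.
  by rewrite big_cons mulrCA.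
have := Fprod (enum 'I_n); rewrite size_enum_ord; apply: multiplier_ext => j.
rewrite big_enum /=.
have [j0M|nj0] := boolP (N_ 0 <= j i0 < N_ M)%N; last first.
  rewrite /block /box; case: forallP => [/(_ i0)|_]; first by rewrite i0S (negbTE nj0).
  rewrite mul0r big1// => k _; case: forallP => // /(_ i0); rewrite i0S => /andP[h1 h2].
  case/negP: nj0; rewrite (leq_trans _ h1) ?N_homo//=.
  by rewrite (leq_trans h2)// N_homo.
have [k kM kj] := block_exists j0M.
have indk k' : ind k' (j i0) = (k' == k)%:R.
  rewrite /ind; case: eqP => [->|k'k]; first by rewrite kj.
  by case: (boolP (N_ k' <= _ < _)%N) => // h; case: k'k; apply: block_unique h kj.
have FE i : F i j = if (i \in S) && (i != i0) then ind k (j i) else 1.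
  rewrite /F; case: ifP => // _; rewrite (bigD1 (Ordinal kM))//= indk eqxx mul1r.
  rewrite big1 ?addr0// => k' k'k; rewrite indk; case: eqP => [E|_]; last by rewrite mul0r.
  by case/eqP: k'k; apply: val_inj.
under eq_bigr do rewrite FE.
rewrite [RHS](bigD1 (Ordinal kM))//= [X in _ = _ + X]big1 ?addr0; last first.
  move=> k' k'k; rewrite /block /box; case: forallP => // /(_ i0); rewrite i0S => h.
  by case/eqP: k'k; apply: val_inj; apply: block_unique h kj.
rewrite /block !box_prod -big_split /=; apply: eq_bigr => i _.
have [iS|] := boolP (i \in S); last by rewrite /= mulr1.
have [->|ii0] := eqVneq i i0; first by rewrite /= mulr1 j0M kj.
rewrite /= /ind -natrM mulnb; congr (_%:R); congr nat_of_bool.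
apply/andP/idP => [[]//|h]; split=> //; case/andP: h => h1 h2.
by rewrite (leq_trans _ h1) ?N_homo//= (leq_trans h2)// N_homo.
Qed.

End Diagonal.
End Multipliers.

(** * Gliding humps *)
Section GlidingHump.
Context {R : realType} {cplx : bool} {n : nat}.
Local Notation K := (scalars R cplx).
Variables (Z : completeNormedModType K) (hat : ('I_n -> nat) -> {linear Z -> K^o}).
Variable C0 : R.
Hypothesis C0_ge1 : 1 <= C0.
Hypothesis hat_inj : forall z, (forall j, hat j z = 0) -> z = 0.
Hypothesis product_multiplier : forall m : 'I_n -> nat -> K,
  (forall i l, modulus (m i l) <= 1) ->
  multiplier hat (fun j => \prod_(i < n) m i (j i)) C0.
Local Notation P N := (op hat (corner N)).
Hypothesis corner_cvg : forall z (e : R), 0 < e ->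
  exists N0, forall N, (N0 <= N)%N -> rnorm (z - P N z) < e.

Let hatB := hat_box product_multiplier.
Let bndB := box_bound hat_inj product_multiplier.
Let C0_ge0 : 0 <= C0. Proof. exact: le_trans C0_ge1. Qed.

Lemma corner_mul N N' z : (N <= N')%N -> P N (P N' z) = P N z.
Proof.
move=> NN'; apply: (hat_eq hat_inj) => j; rewrite !hatB mulrA boxM; congr (_ * _).
rewrite /box; congr (_%:R); congr nat_of_bool; apply: eq_forallb => i.
by case: (ltnP (j i) N) => // /leq_trans ->.
Qed.

Lemma corner_mulr N N' z : (N <= N')%N -> P N' (P N z) = P N z.
Proof.
move=> NN'; apply: (hat_eq hat_inj) => j; rewrite !hatB mulrA boxM; congr (_ * _).
rewrite /box; congr (_%:R); congr nat_of_bool; apply: eq_forallb => i.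
by case: (ltnP (j i) N) => [/leq_trans ->//|_]; rewrite andbF.
Qed.

Lemma corner_kernel (Y : set Z) N : infdim Y ->
  exists Y', [/\ infdim Y', Y' `<=` Y & forall y, Y' y -> P N y = 0].
Proof.
move=> Yinf.
have := infdim_kernels (enum {ffun 'I_n -> 'I_N}) (fun k => hat (fun i => k i)) Yinf.
move=> Y'inf; eexists; split; [exact: Y'inf|by move=> y []|move=> y [_ y0]].
apply: hat_inj => j; rewrite hatB /box; case: forallP => [jN|_]; last by rewrite mul0r.
have -> : j = (fun i => [ffun i => Ordinal (jN i)] i : nat).
  by apply: funext => i; rewrite ffunE.
by rewrite y0 ?mulr0// mem_enum.
Qed.

(** [y k] lives, up to [d k], between the cubes of sides [N_ k] and [N_ k.+1]. *)
Definition humps (y : nat -> Z) (N_ : nat -> nat) (d : nat -> R) : Prop :=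
  forall k, [/\ (N_ k < N_ k.+1)%N, rnorm (y k) = 1, P (N_ k) (y k) = 0
    & rnorm (y k - P (N_ k.+1) (y k)) <= d k].

Lemma gliding_hump (good : nat -> nat -> Z -> Prop) (d : nat -> R) (N0 : nat) :
  (forall k, 0 < d k) ->
  (forall N k, exists y, [/\ rnorm y = 1, P N y = 0 & good k N y]) ->
  exists y N_, [/\ humps y N_ d, (N0 <= N_ 0)%N & forall k, good k (N_ k) (y k)].
Proof.
move=> d0 ex.
have /choice[f fP] : forall kN : nat * nat, exists yN : Z * nat,
    [/\ rnorm yN.1 = 1, P kN.2 yN.1 = 0, good kN.1 kN.2 yN.1, (kN.2 < yN.2)%N
      & rnorm (yN.1 - P yN.2 yN.1) <= d kN.1].
  move=> [k N]; have [y [y1 y0 yg]] := ex N k.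
  have [N1 N1P] := corner_cvg y (d0 k); exists (y, maxn N1 N.+1); split=> //=.
    exact: leq_maxr.
  exact/ltW/N1P/leq_maxl.
pose N_ := fix N_ k := if k is k'.+1 then (f (k', N_ k')).2 else N0.
exists (fun k => (f (k, N_ k)).1), N_; split=> // k; first by split=> /=; case: (fP (k, N_ k)).
by case: (fP (k, N_ k)).
Qed.

Lemma argmax_nat (f : nat -> R) M : (0 < M)%N ->
  exists2 m, (m < M)%N & forall k, (k < M)%N -> f k <= f m.
Proof.
elim: M => // -[_ _|M IH _]; first by exists 0%N => // -[].
have [//|m mM mP] := IH; have [h|h] := leP (f m) (f M.+1).
  exists M.+1 => // k; rewrite ltnS leq_eqVlt => /predU1P[->//|/mP/le_trans]; exact.
exists m => [|k]; first exact: ltnW.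
by rewrite ltnS leq_eqVlt => /predU1P[->|/mP//]; apply: ltW.
Qed.

(** The difference of two successive corner projections isolates the largest
    coefficient: applied to the sum it reproduces that term, with errors
    controlled by the coefficient itself times the small numbers [d l]. *)
Lemma hump_coef y N_ d (M : nat) (a : nat -> K) k :
  humps y N_ d -> \sum_(l < M) d l <= (4 * C0)^-1 -> (k < M)%N ->
  modulus (a k) <= 4 * C0 * rnorm (\sum_(l < M) a l *: y l).
Proof.
move=> hy dM kM; set w := \sum_(l < M) _.
have [//|m mM mP] := @argmax_nat (fun l => modulus (a l)) M.
  exact: leq_ltn_trans kM.
apply: le_trans (mP _ kM) _; set A := modulus (a m).
have N_homo : {homo N_ : i j / (i <= j)%N}.
  by apply: homo_leq => //; [exact: leq_trans|move=> i; apply: ltnW; case: (hy i)].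
pose G z := P (N_ m.+1) z - P (N_ m) z.
have Gl l : rnorm (G (y l) - (l == m)%:R *: y l) <= 2 * C0 * d l.
  have [lm|ml|->] := ltngtP l m.
  - rewrite scale0r subr0; have [_ _ _ dl] := hy l.
    have -> : G (y l) = P (N_ m.+1) (y l - P (N_ l.+1) (y l)) - P (N_ m) (y l - P (N_ l.+1) (y l)).
      set v := P (N_ l.+1) (y l).
      have e1 : P (N_ m.+1) v = v by apply: corner_mulr; apply: N_homo; rewrite ltnS ltnW.
      have e2 : P (N_ m) v = v by apply: corner_mulr; apply: N_homo.
      by rewrite !linearB /= e1 e2 /G opprK [- _ + v]addrC addrA subrK.
    apply: le_trans (rnormD _ _) _; rewrite rnormN.
    have := bndB (fun _ l => (l < N_ m.+1)%N) (y l - P (N_ l.+1) (y l)).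
    have := bndB (fun _ l => (l < N_ m)%N) (y l - P (N_ l.+1) (y l)).
    have := ler_wpM2l C0_ge0 dl; rewrite /corner; lra.
  - rewrite scale0r subr0 /G; have [_ _ yl dl] := hy l.
    rewrite -(corner_mul (y l) (N_homo _ _ ml)) -(corner_mul (y l) (N_homo _ _ (ltnW ml))) yl.
    rewrite !linear0 addr0 rnorm0 !mulr_ge0//; apply: le_trans dl; exact: rnorm_ge0.
  - rewrite scale1r /G; have [_ _ -> dm] := hy m; rewrite subr0 rnormB.
    have : 0 <= d m by apply: le_trans dm; apply: rnorm_ge0.
    by have := C0_ge1; nra.
have E : a m *: y m = G w - \sum_(l < M) a l *: (G (y l) - (l == m :> nat)%:R *: y l).
  under eq_bigr do rewrite scalerBr.
  rewrite big_split /= sumrN opprB.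
  have -> : G w = \sum_(l < M) a l *: G (y l).
    rewrite /G /w [in LHS]linear_sum [X in _ - X]linear_sum -sumrB.
    by apply: eq_bigr => l _; rewrite [in LHS]linearZ [X in _ - X]linearZ scalerBr.
  rewrite addrC subrK (bigD1 (Ordinal mM))//= eqxx scale1r big1 ?addr0// => l lm.
  by rewrite -val_eqE /= in lm; rewrite (negbTE lm) scale0r scaler0.
have [_ ym _ _] := hy m.
have : A <= rnorm (G w) + A * (2 * C0 * \sum_(l < M) d l).
  have AE : A = rnorm (a m *: y m) by rewrite rnormZ ym mulr1.
  rewrite [X in X <= _]AE E; apply: le_trans (rnormD _ _) _.
  rewrite rnormN; apply: lerD => //; apply: le_trans (rnorm_sum _ _ _) _.
  rewrite !mulr_sumr; apply: ler_sum => l _; rewrite rnormZ.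
  apply: ler_pM; rewrite ?rnorm_ge0//; exact: mP.
have : rnorm (G w) <= 2 * C0 * rnorm w.
  apply: le_trans (rnormD _ _) _; rewrite rnormN.
  have := bndB (fun _ l => (l < N_ m.+1)%N) w; have := bndB (fun _ l => (l < N_ m)%N) w.
  rewrite /corner; lra.
have : 2 * C0 * \sum_(l < M) d l <= 2^-1.
  apply: le_trans (ler_wpM2l _ dM) _; first by rewrite mulr_ge0.
  by rewrite invfM; have : C0 != 0 by [rewrite gt_eqF// (lt_le_trans ltr01)]; move=> c; rewrite le_eqVlt; apply/orP; left; apply/eqP; field.
have : 0 <= A by apply: modulus_ge0.
set s := \sum_(l < M) d l; set x := 2 * C0 * s; nra.
Qed.

Lemma hump_independent y N_ d : humps y N_ d ->
  (forall M, \sum_(l < M) d l <= (4 * C0)^-1) -> independent y.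
Proof.
move=> hy dM M a a0 k kM; apply: modulus_eq0; apply/le_anti.
by rewrite modulus_ge0 andbT; have := hump_coef a hy (dM M) kM; rewrite a0 rnorm0 mulr0.
Qed.

Lemma geometric_sum (q : R) M : 0 <= q -> \sum_(l < M) q * 2^-1 ^+ l.+1 <= q.
Proof.
move=> q0; suff -> : \sum_(l < M) q * 2^-1 ^+ l.+1 = q * (1 - 2^-1 ^+ M).
  have : 0 <= 2^-1 ^+ M :> R by rewrite exprn_ge0// invr_ge0.
  by set x := 2^-1 ^+ M; nra.
elim: M => [|M IH]; first by rewrite big_ord0 expr0 subrr mulr0.
by rewrite big_ord_recr /= IH !exprS; field.
Qed.

Lemma normalize (z : Z) : z <> 0 -> exists2 a : K, modulus a = (rnorm z)^-1 & rnorm (a *: z) = 1.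
Proof.
move=> z0; have z1 : rnorm z != 0 by apply/eqP => /rnorm_eq0.
have z2 : 0 <= (rnorm z)^-1 by rewrite invr_ge0 rnorm_ge0.
exists (of_real (rnorm z)^-1); first exact: modulus_of_real.
by rewrite rnormZ -/(modulus _) modulus_of_real// mulVf.
Qed.

(** Choose humps [y k] on which [E] is summably small.  Coefficients are bounded
    by the norm of the sum, so [E] is small on the whole span. *)
Lemma small_subspace (E : {linear Z -> Z}) (Y : set Z) (e : R) :
  infdim Y ->
  (forall (Y' : set Z) (c : R), infdim Y' -> Y' `<=` Y -> 0 < c ->
    exists2 y, Y' y & rnorm (E y) < c * rnorm y) ->
  0 < e ->
  exists Y', [/\ infdim Y', Y' `<=` Y & forall y, Y' y -> rnorm (E y) <= e * rnorm y].
Proof.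
move=> Yinf Esing e0; have C4 : 0 < 4 * C0 by rewrite mulr_gt0// (lt_le_trans ltr01).
have half k : 0 < 2^-1 ^+ k :> R by rewrite exprn_gt0// invr_gt0.
pose d k : R := (4 * C0)^-1 * 2^-1 ^+ k.+1.
pose q k : R := e * (4 * C0)^-1 * 2^-1 ^+ k.+1.
have d0 k : 0 < d k by rewrite mulr_gt0// invr_gt0.
have q0 k : 0 < q k by rewrite !mulr_gt0// invr_gt0.
have [|y [N_ [hy _ yg]]] :=
    @gliding_hump (fun k _ y => Y y /\ rnorm (E y) <= q k) d 0%N d0.
  move=> N k; have [Y' [Y'inf Y'Y Y'N]] := corner_kernel N Yinf.
  have [y Yy Ey] := Esing _ _ Y'inf Y'Y (q0 k).
  have y0 : y <> 0 by move=> y0; move: Ey; rewrite y0 linear0 rnorm0 mulr0 ltxx.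
  have [a am a1] := normalize y0; exists (a *: y).
  have Yay : Y' (a *: y) by apply: subspaceZ => //; case: Y'inf.
  split=> //; [exact: Y'N|split; first exact: Y'Y].
  have y1 : 0 < rnorm y by rewrite lt_neqAle rnorm_ge0 andbT eq_sym; apply/eqP => /rnorm_eq0.
  by rewrite linearZ rnormZ -/(modulus a) am mulrC ler_pdivrMr// ltW.
have dM M : \sum_(l < M) d l <= (4 * C0)^-1.
  by apply: geometric_sum; rewrite invr_ge0 ltW.
have Yl := Yinf.1.
exists (lin_span y); split.
- apply: (@independent_infdim _ _ _ _ y); [exact: lin_span_subspace|exact: lin_span_mem|].
  exact: hump_independent hy dM.
- by apply: lin_span_sub => // k; case: (yg k).
move=> _ [M [a ->]]; set w := \sum_(l < M) _; rewrite /w linear_sum.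
apply: le_trans (rnorm_sum _ _ _) _; rewrite -/w.
have : \sum_(l < M) 4 * C0 * rnorm w * q l <= e * rnorm w.
  rewrite -mulr_sumr; have h : \sum_(l < M) q l <= e * (4 * C0)^-1.
    by apply: geometric_sum; rewrite mulr_ge0 ?invr_ge0 ?ltW.
  apply: le_trans (ler_wpM2l _ h) _; first by rewrite mulr_ge0 ?rnorm_ge0 ?ltW.
  by rewrite mulrCA mulrAC divff ?mul1r// gt_eqF.
apply: le_trans; apply: ler_sum => l _; rewrite linearZ rnormZ.
apply: ler_pM; [exact: rnorm_ge0|exact: rnorm_ge0| |by case: (yg l)].
exact: hump_coef hy (dM M) _.
Qed.

End GlidingHump.

(** * Subprojectivity from multipliers *)
Section Abstract.
Context {R : realType} {cplx : bool} {n : nat}.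
Local Notation K := (scalars R cplx).
Variables (Z : completeNormedModType K) (hat : ('I_n -> nat) -> {linear Z -> K^o}).
Variable C0 : R.
Hypothesis C0_ge1 : 1 <= C0.
Hypothesis hat_inj : forall z, (forall j, hat j z = 0) -> z = 0.
Hypothesis product_multiplier : forall m : 'I_n -> nat -> K,
  (forall i l, modulus (m i l) <= 1) ->
  multiplier hat (fun j => \prod_(i < n) m i (j i)) C0.
Local Notation P N := (op hat (corner N)).
Hypothesis corner_cvg : forall z (e : R), 0 < e ->
  exists N0, forall N, (N0 <= N)%N -> rnorm (z - P N z) < e.
Variable Z0 : set Z.
Hypothesis Z0_dense : forall z (e : R), 0 < e -> exists2 v, Z0 v & rnorm (z - v) < e.
Hypothesis Z0_scale : forall a z, Z0 z -> Z0 (a *: z).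
Hypothesis Z0_box : forall B z, Z0 z -> Z0 (op hat (box B) z).
Hypothesis block_domination : forall (S : {set 'I_n}) (j0 : 'I_n -> nat), S != finset.set0 ->
  exists C : R, forall (N_ : nat -> nat) (M : nat) (z w : nat -> Z),
    {homo N_ : a b / (a <= b)%N} ->
    (forall k, (k < M)%N -> let D := op hat (block S j0 (N_ k) (N_ k.+1)) in
       [/\ Z0 (z k), Z0 (w k), D (z k) = z k, D (w k) = w k & rnorm (z k) <= rnorm (w k)]) ->
    rnorm (\sum_(k < M) z k) <= C * rnorm (\sum_(k < M) w k).

Let hatB := hat_box product_multiplier.
Let bndB := box_bound hat_inj product_multiplier.
Let C0_gt0 : 0 < C0. Proof. exact: lt_le_trans C0_ge1. Qed.
Let C0_ge0 : 0 <= C0. Proof. exact: ltW. Qed.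

Let op_comp B B' z : op hat (box B) (op hat (box B') z) =
  op hat (box (fun i l => B i l && B' i l)) z.
Proof. by apply: (hat_eq hat_inj) => j; rewrite !hatB mulrA boxM. Qed.

Let op_ext B B' z : (forall i, B i =1 B' i) -> op hat (box B) z = op hat (box B') z.
Proof.
move=> BB; apply: (hat_eq hat_inj) => j; rewrite !hatB /box; congr (_%:R * _).
by congr nat_of_bool; apply: eq_forallb => i; rewrite BB.
Qed.

(** ** Subspaces concentrated near the far slices *)

Definition upd (j0 : 'I_n -> nat) (i : 'I_n) (l : nat) : 'I_n -> nat :=
  fun i' => if i' == i then l else j0 i'.

Definition tail_slice (S : {set 'I_n}) (j0 : 'I_n -> nat) (N : nat) : ('I_n -> nat) -> K :=
  box (fun i l => if i \in S then (N <= l)%N else l == j0 i).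

Let peeled (S : {set 'I_n}) (j0 : 'I_n -> nat) (L : seq ('I_n * nat)) : ('I_n -> nat) -> K :=
  box (fun i l => ((i \in S) || (l == j0 i)) && ((i, l) \notin L)).

(** [peeled S j0 L] removes from the slice the values listed in [L].  Removing one
    value [l] of the coordinate [i] costs at most the projection to the smaller
    slice where [i] is fixed to [l]. *)
Lemma peel (S : {set 'I_n}) j0 (L : seq ('I_n * nat)) z (e : R) :
  (forall i l, (i, l) \in L -> i \in S) ->
  (forall i l, (i, l) \in L -> rnorm (op hat (slice (S :\ i) (upd j0 i l)) z) <= e) ->
  rnorm (op hat (slice S j0) z - op hat (peeled S j0 L) z) <= (size L)%:R * (C0 * e).
Proof.
elim: L => [|[i l] L IH] LS Le.
  rewrite (@op_ext _ (fun i l => ((i \in S) || (l == j0 i)) && ((i, l) \notin [::]))).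
    by rewrite subrr rnorm0 mul0r.
  by move=> i l; rewrite in_nil andbT.
have iS : i \in S by apply: (LS i l); rewrite mem_head.
have -> : op hat (peeled S j0 ((i, l) :: L)) z = op hat (peeled S j0 L) z -
    op hat (box (fun i' l' => (i', l') \notin L)) (op hat (slice (S :\ i) (upd j0 i l)) z).
  apply: (hat_eq hat_inj) => j; rewrite linearB !hatB mulrA boxM -mulrBl; congr (_ * _).
  have [ji|ji] := eqVneq (j i) l.
    rewrite [box _ j](_ : _ = 0); last first.
      rewrite /box; case: forallP => // /(_ i); by rewrite ji mem_head andbF.
    apply/esym/eqP; rewrite subr_eq0; apply/eqP; congr (_%:R); congr nat_of_bool.
    apply: eq_forallb => i'; rewrite andbC; congr (_ && _).
    rewrite in_setD1 /upd; by case: (eqVneq i' i) => [->|//]; rewrite iS ji eqxx.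
  rewrite [X in _ - X](_ : _ = 0) ?subr0; last first.
    rewrite /box; case: forallP => // /(_ i); rewrite in_setD1 eqxx /upd eqxx /= (negbTE ji).
    by rewrite andbF.
  congr (_%:R); congr nat_of_bool; apply: eq_forallb => i'.
  rewrite inE negb_or xpair_eqE; by case: (eqVneq i' i) => [->|//]; rewrite (negbTE ji).
rewrite opprB addrA addrAC; apply: le_trans (rnormD _ _) _.
rewrite [size _]/= -addn1 natrD mulrDl mul1r; apply: lerD.
  apply: IH => i' l' h; [apply: (LS i' l')|apply: Le]; by rewrite inE h orbT.
apply: le_trans (bndB _ _) _; apply: ler_wpM2l => //; apply: Le; exact: mem_head.
Qed.

Definition singular_on (Y : set Z) (E : {linear Z -> Z}) : Prop :=
  forall (Y' : set Z) (c : R), infdim Y' -> Y' `<=` Y -> 0 < c ->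
    exists2 y, Y' y & rnorm (E y) < c * rnorm y.

Lemma small_on_slices (S : {set 'I_n}) j0 (Y : set Z) (L : seq ('I_n * nat)) (e : R) :
  infdim Y -> 0 < e ->
  (forall i l, i \in S -> singular_on Y (op hat (slice (S :\ i) (upd j0 i l)))) ->
  (forall i l, (i, l) \in L -> i \in S) ->
  exists Y', [/\ infdim Y', Y' `<=` Y & forall y i l, Y' y -> (i, l) \in L ->
    rnorm (op hat (slice (S :\ i) (upd j0 i l)) y) <= e * rnorm y].
Proof.
move=> Yinf e0 sing; elim: L => [_|[i l] L IH LS]; first by exists Y; split=> // y i l _; rewrite in_nil.
have [|Y1 [Y1inf Y1Y Y1s]] := IH; first by move=> i' l' h; apply: (LS i' l'); rewrite inE h orbT.
have iS : i \in S by apply: (LS i l); rewrite mem_head.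
have [|Y2 [Y2inf Y2Y1 Y2s]] := small_subspace C0_ge1 hat_inj product_multiplier corner_cvg
    (E := op hat (slice (S :\ i) (upd j0 i l))) Y1inf _ e0.
  by move=> Y' c Y'inf Y'Y1; apply: sing => //; apply: subset_trans Y1Y.
exists Y2; split=> //; first exact: subset_trans Y1Y.
move=> y i' l' Yy; rewrite inE => /predU1P[[-> ->]|h]; first exact: Y2s.
by apply: Y1s => //; apply: Y2Y1.
Qed.

(** Each discarded value costs a singular operator, which passing to a smaller
    subspace makes small. *)
Lemma near_tail (S : {set 'I_n}) j0 (Y : set Z) (N : nat) (e : R) :
  infdim Y -> 0 < e ->
  (forall i l, i \in S -> singular_on Y (op hat (slice (S :\ i) (upd j0 i l)))) ->
  exists Y', [/\ infdim Y', Y' `<=` Y & forall y, Y' y ->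
    rnorm (op hat (slice S j0) y - op hat (tail_slice S j0 N) y) <= e * rnorm y].
Proof.
move=> Yinf e0 sing.
pose L := [seq (i, l) | i <- enum S, l <- iota 0 N].
have LP i l : ((i, l) \in L) = (i \in S) && (l < N)%N.
  apply/allpairsP/andP => [[[i' l'] /= [h1 h2 [-> ->]]]|[h1 h2]].
    by move: h1 h2; rewrite mem_enum mem_iota add0n.
  by exists (i, l); rewrite /= mem_enum mem_iota.
have q0 : 0 < (size L)%:R * C0 + 1 by rewrite ltr_wpDl// mulr_ge0.
have [|i l|Y' [Y'inf Y'Y Y's]] := small_on_slices (L := L) (e := e / ((size L)%:R * C0 + 1)) Yinf _ sing.
- by rewrite divr_gt0.
- by rewrite LP => /andP[].
exists Y'; split=> // y Yy.
have -> : op hat (tail_slice S j0 N) y = op hat (peeled S j0 L) y.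
  by apply: op_ext => i l; rewrite LP; case: (i \in S); rewrite //= ?andbT// leqNgt.
apply: le_trans (peel (e := e / ((size L)%:R * C0 + 1) * rnorm y) _ _) _.
- by move=> i l; rewrite LP => /andP[].
- by move=> i l h; apply: Y's.
rewrite !mulrA; apply: ler_wpM2r; first exact: rnorm_ge0.
rewrite ler_pdivrMr// mulrC; apply: ler_wpM2l; first exact: ltW.
by rewrite lerDl.
Qed.


(** ** Block sequences span complemented subspaces *)

Section BlockSequence.
Variables (S : {set 'I_n}) (j0 : 'I_n -> nat) (i0 : 'I_n).
Hypothesis i0S : i0 \in S.
Variable N_ : nat -> nat.
Hypothesis N_homo : {homo N_ : a b / (a <= b)%N}.
Let D k := op hat (block S j0 (N_ k) (N_ k.+1)).
Variable z_ : nat -> Z.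
Hypothesis Z0z : forall k, Z0 (z_ k).
Hypothesis Dz : forall k, D k (z_ k) = z_ k.
Hypothesis z_neq0 : forall k, 0 < rnorm (z_ k).

Let block_disjoint k l z : k <> l -> D k (D l z) = 0.
Proof.
move=> kl; apply: hat_inj => j; rewrite !hatB mulrA boxM /box.
case: forallP => [/(_ i0)|_]; last by rewrite mul0r.
rewrite i0S => /andP[h1 h2]; case: kl; exact: (block_unique N_homo h1 h2).
Qed.

(** [g k] is a norming functional of [z_ k] composed with the block projection
    and normalised to take the value one at [z_ k]. *)
Lemma norming_functionals : exists g : nat -> {linear Z -> K^o}, forall k,
  g k (z_ k) = 1 /\ forall z, modulus (g k z) * rnorm (z_ k) <= rnorm (D k z).
Proof.
suff H : forall k, exists g : {linear Z -> K^o},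
    g (z_ k) = 1 /\ forall z, modulus (g z) * rnorm (z_ k) <= rnorm (D k z).
  by have [g gP] := choice H; exists g.
move=> k; have [f [fle fz]] := hahn_banach (z_ k) (@rnormD _ _ Z) (@rnormZ _ _ Z).
have zk0 : of_real (rnorm (z_ k)) != 0 :> K.
  by apply/eqP; rewrite -of_real0 => /of_real_inj h; have := z_neq0 k; rewrite h ltxx.
have [|g gE] := @linear_of _ _ Z K^o (fun z => f (D k z) / of_real (rnorm (z_ k))).
  by move=> a x y; rewrite !linearP mulrDl /GRing.scale/= mulrA.
exists g; split=> [|z]; rewrite gE; first by rewrite Dz fz divff.
rewrite modulusM modulusV modulus_of_real ?rnorm_ge0// mulfVK ?gt_eqF//; exact: fle.
Qed.

Variable g : nat -> {linear Z -> K^o}.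
Hypothesis gz : forall k, g k (z_ k) = 1.
Hypothesis g_le : forall k z, modulus (g k z) * rnorm (z_ k) <= rnorm (D k z).

Lemma g_vanish k z : D k z = 0 -> g k z = 0.
Proof.
move=> Dz0; apply: modulus_eq0; apply/le_anti; rewrite modulus_ge0 andbT.
by have := g_le k z; rewrite Dz0 rnorm0 pmulr_lle0.
Qed.

Lemma g_biorthogonal k l : g k (z_ l) = (k == l)%:R.
Proof.
have [->|kl] := eqVneq k l; first exact: gz.
by apply: g_vanish; rewrite -Dz block_disjoint//; apply/eqP.
Qed.

Lemma g_slice k z : g k (op hat (slice S j0) z) = g k z.
Proof.
apply/eqP; rewrite -subr_eq0 -linearB; apply/eqP/g_vanish.
rewrite linearB /= /D op_comp; apply/eqP; rewrite subr_eq0; apply/eqP.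
by apply: op_ext => i l; case: (i \in S); rewrite /= ?andbT ?andbb.
Qed.

Lemma g_corner k N z : (N <= N_ k)%N -> g k (P N z) = 0.
Proof.
move=> Nk; apply: g_vanish; apply: hat_inj => j; rewrite !hatB mulrA boxM /box.
case: forallP => [/(_ i0)|_]; last by rewrite mul0r.
by rewrite i0S => /andP[/andP[h1 _] h2]; have := leq_trans h2 (leq_trans Nk h1); rewrite ltnn.
Qed.

(** By the choice of [g], the blocks [g k z *: z_ k] have smaller norms than the
    blocks [D k z], whose sum is the diagonal part of [z]. *)
Lemma block_projection_bound (CU : R) : 0 <= CU ->
  (forall (N' : nat -> nat) (M : nat) (z w : nat -> Z),
    {homo N' : a b / (a <= b)%N} ->
    (forall k, (k < M)%N -> let D := op hat (block S j0 (N' k) (N' k.+1)) in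
       [/\ Z0 (z k), Z0 (w k), D (z k) = z k, D (w k) = w k & rnorm (z k) <= rnorm (w k)]) ->
    rnorm (\sum_(k < M) z k) <= CU * rnorm (\sum_(k < M) w k)) ->
  forall M m z, rnorm (\sum_(k < m) g (M + k)%N z *: z_ (M + k)%N) <=
    CU * (C0 * C0 ^+ n) * rnorm z.
Proof.
move=> CU0 dom M m z; set C1 := CU * _.
have C1_ge0 : 0 <= C1 by rewrite !mulr_ge0// exprn_ge0.
have [|f fE] := @linear_of _ _ Z Z (fun z => \sum_(k < m) g (M + k)%N z *: z_ (M + k)%N).
  move=> a x y; rewrite scaler_sumr -big_split; apply: eq_bigr => k _ /=.
  by rewrite linearP scalerDl scalerA.
have [|h hE] := @linear_of _ _ Z Z (fun z => of_real C1 *: z).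
  by move=> a x y; rewrite scalerDr !scalerA mulrC.
have hn x : rnorm (h x) = C1 * rnorm x by rewrite hE rnormZ -/(modulus _) modulus_of_real.
rewrite -fE -hn; apply: (@rclosure_le _ _ _ _ _ f h (\sum_(k < m) C0) C1 Z0).
- move=> x; rewrite fE; apply: le_trans (rnorm_sum _ _ _) _; rewrite mulr_suml.
  by apply: ler_sum => k _; rewrite rnormZ; apply: le_trans (g_le _ _) (bndB _ _).
- by move=> x; rewrite hn.
- move=> v Zv; rewrite fE hn.
  pose N' k := N_ (M + k)%N.
  have N'_homo : {homo N' : a b / (a <= b)%N}.
    by move=> a b ab; apply: N_homo; rewrite leq_add2l.
  have := dom N' m (fun k => g (M + k)%N v *: z_ (M + k)%N) (fun k => D (M + k)%N v) N'_homo.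
  move=> h1; apply: le_trans (h1 _) _.
    move=> k _; rewrite /N' addnS; split.
    + exact: Z0_scale.
    + exact: Z0_box.
    + by rewrite linearZ; congr (_ *: _); apply: Dz.
    + by rewrite op_comp; apply: op_ext => i l; rewrite andbb.
    + by rewrite rnormZ; apply: g_le.
  rewrite -mulrA; apply: ler_wpM2l => //.
  have dm := diagonal_multiplier C0_ge1 product_multiplier N'_homo j0 m i0S.
  suff -> : \sum_(k < m) D (M + k)%N v = op hat (fun j => \sum_(k < m) block S j0 (N' k) (N' k.+1) j) v.
    by have := op_bound hat_inj dm v.
  apply: (hat_eq hat_inj) => j; rewrite (hat_op dm) linear_sum mulr_suml.
  by apply: eq_bigr => k _; rewrite hatB /N' addnS.
- by move=> e e0; apply: Z0_dense.
Qed.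


Variables (Y : set Z) (y_ : nat -> Z) (d t : nat -> R) (c C1 : R).
Let E := op hat (slice S j0).
Let C2 := c^-1 * (C1 + 2 * C0 / c).
Hypothesis c_gt0 : 0 < c.
Hypothesis C1_ge0 : 0 <= C1.
Hypothesis block_bound : forall M m z,
  rnorm (\sum_(k < m) g (M + k)%N z *: z_ (M + k)%N) <= C1 * rnorm z.
Hypothesis Ylin : linear_subspace Y.
Hypothesis Yy : forall k, Y (y_ k).
Hypothesis Elow : forall y, Y y -> c * rnorm y <= rnorm (E y).
Hypothesis z_low : forall k, c / 2 <= rnorm (z_ k).
Hypothesis hy : humps hat y_ N_ d.
Hypothesis d_sum : forall M, \sum_(k < M) d k <= (4 * C0)^-1.
Hypothesis yz : forall k, rnorm (E (y_ k) - z_ k) <= t k.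
Hypothesis t_sum : forall M m, \sum_(k < m) t (M + k)%N <= 1.
Hypothesis t_small : forall M, \sum_(k < M) t k <= (8 * C0 * (C2 + 1))^-1.

Let C2_ge0 : 0 <= C2.
Proof. by rewrite mulr_ge0 ?invr_ge0 ?(ltW c_gt0)// addr_ge0// divr_ge0 ?mulr_ge0 ?(ltW c_gt0). Qed.

(** [E] is bounded below on [Y], and [E (y_ k)] may be replaced by [z_ k] at
    the cost of the summable errors [t k]. *)
Let partial M m z : rnorm (\sum_(k < m) g (M + k)%N z *: y_ (M + k)%N) <= C2 * rnorm z.
Proof.
set s := \sum_(k < m) _.
have Ys : Y s by apply: subspace_sum => // k _; apply: subspaceZ.
rewrite /C2 -mulrA -ler_pdivrMl ?invr_gt0// invrK; apply: le_trans (Elow Ys) _.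
have g2 k : modulus (g k z) <= 2 * C0 / c * rnorm z.
  have h1 := le_trans (g_le k z) (bndB _ z).
  have h2 := ler_wpM2l (modulus_ge0 (g k z)) (z_low k).
  have cc : c / 2 * (2 * C0 / c * rnorm z) = C0 * rnorm z by field; rewrite gt_eqF.
  rewrite -(ler_pM2l (x := c / 2)) ?divr_gt0// cc mulrC; exact: le_trans h2 h1.
have -> : E s = \sum_(k < m) g (M + k)%N z *: z_ (M + k)%N +
    \sum_(k < m) g (M + k)%N z *: (E (y_ (M + k)%N) - z_ (M + k)%N).
  rewrite -big_split linear_sum /=; apply: eq_bigr => k _.
  by rewrite linearZ -scalerDr addrC subrK.
apply: le_trans (rnormD _ _) _; rewrite mulrDl; apply: lerD => //.
apply: le_trans (rnorm_sum _ _ _) _.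
have h : \sum_(k < m) 2 * C0 / c * rnorm z * t (M + k)%N <= 2 * C0 / c * rnorm z.
  rewrite -mulr_sumr -[leRHS]mulr1; apply: ler_wpM2l => //.
  by rewrite mulr_ge0 ?rnorm_ge0// divr_ge0 ?mulr_ge0// ltW.
by apply: le_trans h; apply: ler_sum => k _; rewrite rnormZ; apply: ler_pM; rewrite ?rnorm_ge0//; exact: g2.
Qed.

Let N_ge k : (k <= N_ k)%N.
Proof. by elim: k => // k /leq_ltn_trans; apply; case: (hy k). Qed.

Let psum z M : Z := \sum_(k < M) g k z *: y_ k.

Let psum_cvg z : exists l, rcvg (psum z) l.
Proof.
apply: complete_rcomplete => e e0.
have C2' : 0 < C2 + 1 by rewrite ltr_wpDl.
have [|N NP] := corner_cvg z (e := e / (C2 + 1)); first by rewrite divr_gt0.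
have step M m : (N <= M)%N -> rnorm (psum z (M + m) - psum z M) < e.
  move=> NM; rewrite /psum big_split_ord /= addrAC subrr add0r.
  have -> : \sum_(k < m) g (M + k)%N z *: y_ (M + k)%N =
      \sum_(k < m) g (M + k)%N (z - P N z) *: y_ (M + k)%N.
    apply: eq_bigr => k _; rewrite linearB /= (g_corner (N := N)) ?subr0//.
    by apply: leq_trans (N_ge _); rewrite (leq_trans NM)// leq_addr.
  apply: le_lt_trans (partial _ _ _) _.
  have := NP N (leqnn N); rewrite ltr_pdivlMr//; have := rnorm_ge0 (z - P N z); nra.
exists N => k l Nk Nl; have [kl|lk] := leqP k l.
  by rewrite rnormB -(subnKC kl); apply: step.
by rewrite -(subnKC (ltnW lk)); apply: step.
Qed.

(** With [A z] the sum of the series [g k z *: y_ k], one has [A (z_ k) = y_ k] and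
    [A \o E = A], so [A (y_ k) - y_ k = A (E (y_ k) - z_ k)] is small; the
    coefficient bound for humps extends this to their closed span. *)
Lemma block_sequence_complemented :
  closed_infdim_subspace (rclosure (lin_span y_)) /\ complemented (rclosure (lin_span y_)).
Proof.
set W := rclosure _.
have Wl : linear_subspace W by apply/rclosure_subspace/lin_span_subspace.
have Wc : closed W by apply: rclosure_closed.
split.
  split=> //; suff [] : infdim W by [].
  apply: (@independent_infdim _ _ _ _ y_) => //.
    by move=> k; apply/sub_rclosure/lin_span_mem.
  exact: (hump_independent C0_ge1 hat_inj product_multiplier hy).
have [a aP] := choice psum_cvg.
have al : linear a.
  move=> b x y; apply: rcvg_unique (aP _) _.
  have := rcvg_lin b (aP x) (aP y); congr rcvg; apply: funext => M.
  rewrite /psum scaler_sumr -big_split; apply: eq_bigr => k _ /=.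
  by rewrite linearP scalerDl scalerA.
have [A AE] := linear_of al.
have AC z : rnorm (A z) <= C2 * rnorm z.
  rewrite AE; apply: (rcvg_le (aP z)); exists 0%N => M _; exact: partial 0%N M z.
have Az k : A (z_ k) = y_ k.
  rewrite AE; apply: rcvg_unique (aP _) _ => e e0; exists k.+1 => M kM.
  rewrite /psum (bigD1 (Ordinal kM))//= g_biorthogonal eqxx scale1r big1 ?addr0 ?subrr ?rnorm0//.
  by move=> l lk; rewrite g_biorthogonal -val_eqE /= in lk *; rewrite (negbTE lk) scale0r.
have AEz z : A (E z) = A z.
  rewrite !AE; apply: rcvg_unique (aP _) _; have := aP z; congr rcvg.
  by apply: funext => M; apply: eq_bigr => k _; rewrite g_slice.
have Ay k : rnorm (A (y_ k) - y_ k) <= C2 * t k.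
  rewrite -{2}(Az k) -AEz -linearB; apply: le_trans (AC _) _; exact: ler_wpM2l.
have c8 : 0 < 8 * C0 * (C2 + 1) by rewrite !mulr_gt0// ltr_wpDl.
have Aw w : lin_span y_ w -> rnorm (A w - w) <= 2^-1 * rnorm w.
  move=> [M [b ->]]; set w' := \sum_(k < M) _.
  have -> : A w' - w' = \sum_(k < M) b k *: (A (y_ k) - y_ k).
    rewrite /w' linear_sum -sumrB; apply: eq_bigr => k _.
    by rewrite linearZ scalerBr.
  apply: le_trans (rnorm_sum _ _ _) _.
  have h : \sum_(k < M) 4 * C0 * rnorm w' * (C2 * t k) <= 2^-1 * rnorm w'.
    rewrite -mulr_sumr -mulr_sumr.
    apply: (@le_trans _ _ (4 * C0 * rnorm w' * (C2 * (8 * C0 * (C2 + 1))^-1))).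
      apply: ler_wpM2l; first by rewrite !mulr_ge0// rnorm_ge0.
      exact: ler_wpM2l.
    have -> : 4 * C0 * rnorm w' * (C2 * (8 * C0 * (C2 + 1))^-1) =
        2^-1 * rnorm w' * (C2 / (C2 + 1)).
      by field; rewrite !gt_eqF// ltr_wpDl.
    rewrite -[leRHS]mulr1; apply: ler_wpM2l; first by rewrite mulr_ge0 ?rnorm_ge0 ?invr_ge0.
    by rewrite ler_pdivrMr ?ltr_wpDl// mul1r lerDl.
  apply: le_trans h; apply: ler_sum => k _; rewrite rnormZ.
  apply: ler_pM; rewrite ?rnorm_ge0//.
  exact: (hump_coef C0_ge1 hat_inj product_multiplier b hy (d_sum M) (ltn_ord k)).
apply: (neumann_complemented C2_ge0 AC Wl Wc).
  move=> z; rewrite AE; apply: rcvg_rclosure (aP z) _ => M; exists M, (fun k => g k z).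
  by [].
have [|B BE] := @linear_of _ _ Z Z (fun z => A z - z).
  by move=> b x y; rewrite linearP scalerBr opprD addrACA.
have [|H HE] := @linear_of _ _ Z Z (fun z => of_real 2^-1 *: z).
  by move=> b x y; rewrite scalerDr !scalerA mulrC.
have Hn x : rnorm (H x) = 2^-1 * rnorm x.
  by rewrite HE rnormZ -/(modulus _) modulus_of_real// invr_ge0.
move=> w Ww; rewrite -BE -Hn.
apply: (rclosure_le (f := B) (g := H) (C := C2 + 1) (D := 2^-1) _ _ _ Ww).
- move=> x; rewrite BE; apply: le_trans (rnormD _ _) _; rewrite rnormN mulrDl mul1r.
  by rewrite lerD2r.
- by move=> x; rewrite Hn.
- by move=> x /Aw; rewrite BE Hn.
Qed.

End BlockSequence.


(** The humps are chosen inside [Y] with [E y] close to its restriction to the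
    tail of the slice; truncating at the next corner puts [E y] close to a
    block, which density moves into [Z0]. *)
Lemma complemented_near_slice (S : {set 'I_n}) j0 (Y : set Z) (c : R) :
  S != finset.set0 -> infdim Y -> 0 < c ->
  (forall y, Y y -> c * rnorm y <= rnorm (op hat (slice S j0) y)) ->
  (forall i l, i \in S -> singular_on Y (op hat (slice (S :\ i) (upd j0 i l)))) ->
  exists W, [/\ W `<=` rclosure Y, closed_infdim_subspace W & complemented W].
Proof.
move=> S0 Yinf c0 Elow sing; have /set0Pn[i0 i0S] := S0.
set E := op hat (slice S j0) in Elow *.
have [CU dom] := block_domination j0 S0.
pose CU' := `|CU|; pose C1 := CU' * (C0 * C0 ^+ n).
have C1_ge0 : 0 <= C1 by rewrite /C1 /CU' !mulr_ge0// exprn_ge0.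
pose C2 := c^-1 * (C1 + 2 * C0 / c).
have C2_ge0 : 0 <= C2.
  by rewrite mulr_ge0 ?invr_ge0 ?(ltW c0)// addr_ge0// divr_ge0 ?mulr_ge0 ?(ltW c0).
have c8 : 0 < 8 * C0 * (C2 + 1) by rewrite !mulr_gt0// ltr_wpDl.
(* [q / 2] bounds all errors [t k] and [q] their sum: [c / 2] keeps the norm
   of [z k] above [c / 2], the last term is what the Neumann series needs. *)
pose q := Num.min (Num.min 1 (c / 2)) (8 * C0 * (C2 + 1))^-1.
have q0 : 0 < q by rewrite /q !lt_min ltr01 invr_gt0 c8 divr_gt0.
have q1 : q <= 1 by rewrite /q !ge_min lexx.
have qc : q <= c / 2 by rewrite /q !ge_min lexx orbT.
have q8 : q <= (8 * C0 * (C2 + 1))^-1 by rewrite /q !ge_min lexx !orbT.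
have half k : 0 < 2^-1 ^+ k :> R by rewrite exprn_gt0// invr_gt0.
pose t k : R := q * 2^-1 ^+ k.+1.
have t0 k : 0 < t k by rewrite mulr_gt0.
(* Three errors of size [C0 * d k] add up between [E (y k)] and [z k]. *)
pose d k := t k / (3 * C0).
have d0 k : 0 < d k by rewrite divr_gt0// mulr_gt0.
have td k : 3 * C0 * d k = t k by rewrite /d mulrC mulfVK// gt_eqF// mulr_gt0.
have t_le k : t k <= q / 2.
  rewrite /t exprS; apply: ler_wpM2l; first exact: ltW.
  by rewrite -[leRHS]mulr1; apply: ler_wpM2l; rewrite ?invr_ge0// exprn_ile1// ?invr_ge0// invf_le1 ?ler1n.
have d_sum M : \sum_(k < M) d k <= (4 * C0)^-1.
  apply: (@le_trans _ _ (\sum_(k < M) t k)).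
    apply: ler_sum => k _; rewrite -td -[leLHS]mul1r; apply: ler_wpM2r; first exact: ltW.
    by have := C0_ge1; lra.
  apply: le_trans (geometric_sum _ (ltW q0)) _; apply: le_trans q8 _.
  rewrite lef_pV2 ?posrE// ?mulr_gt0//.
  have : 0 <= C0 * C2 by apply: mulr_ge0.
  by have := C0_ge1; rewrite mulrDr; lra.
(* Beyond [N0] the corners do not cut the values fixed by the slice. *)
pose N0 := (\sum_(i < n) j0 i).+1.
have j0N0 i : (j0 i < N0)%N by rewrite ltnS (bigD1 i)//= leq_addr.
have [//|y [N_ [hy N0N yg]]] := @gliding_hump _ _ _ _ _ corner_cvg
    (fun k N y => Y y /\ rnorm (E y - op hat (tail_slice S j0 N) y) <= d k) d N0 d0.
  move=> N k; have [Y1 [Y1inf Y1Y Y1s]] := near_tail N Yinf (d0 k) sing.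
  have [Y2 [Y2inf Y2Y1 Y2N]] := corner_kernel hat_inj product_multiplier N Y1inf.
  have [y Yy /normalize[a _ a1]] := infdim_neq0 Y2inf.
  have Yay : Y2 (a *: y) by apply: subspaceZ => //; case: Y2inf.
  exists (a *: y); split=> //; [exact: Y2N|split; first exact/Y1Y/Y2Y1].
  by have := Y1s _ (Y2Y1 _ Yay); rewrite a1 mulr1.
have N_homo : {homo N_ : i j / (i <= j)%N}.
  by apply: homo_leq => //; [exact: leq_trans|move=> i; apply: ltnW; case: (hy i)].
pose D k := op hat (block S j0 (N_ k) (N_ k.+1)).
have [v vP] : exists v : nat -> Z, forall k, Z0 (v k) /\ rnorm (y k - v k) < d k.
  have H k : exists x : Z, Z0 x /\ rnorm (y k - x) < d k.
    by have [x Zx yx] := Z0_dense (y k) (d0 k); exists x.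
  by have [x xP] := choice H; exists x.
pose z k := D k (v k).
have Dz k : D k (z k) = z k by rewrite /z /D op_comp; apply: op_ext => i l; rewrite andbb.
have yz k : rnorm (E (y k) - z k) <= t k.
  have [_ yg2] := yg k; have [Nk y1 _ yd] := hy k; have [_ yv] := vP k.
  set T := op hat (tail_slice S j0 (N_ k)) in yg2.
  have -> : E (y k) - z k = E (y k - P (N_ k.+1) (y k)) +
      P (N_ k.+1) (E (y k) - T (y k)) + D k (y k - v k).
    rewrite !linearB /=.
    have -> : E (P (N_ k.+1) (y k)) = P (N_ k.+1) (E (y k)).
      by rewrite !op_comp; apply: op_ext => i l; rewrite andbC.
    have -> : P (N_ k.+1) (T (y k)) = D k (y k).
      rewrite op_comp; apply: op_ext => i l; case: (i \in S); first by rewrite andbC.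
      case: eqP => [->|_]; last by rewrite andbF.
      by rewrite andbT (leq_trans (j0N0 i))// (leq_trans N0N)// N_homo.
    by rewrite !subrKA.
  rewrite -td; apply: le_trans (rnormD _ _) _.
  apply: le_trans (lerD (rnormD _ _) (lexx _)) _.
  have h1 := le_trans (bndB (fun i l => (i \in S) || (l == j0 i)) _) (ler_wpM2l C0_ge0 yd).
  have h2 := le_trans (bndB (fun _ l => (l < N_ k.+1)%N) _) (ler_wpM2l C0_ge0 yg2).
  have h3 : rnorm (D k (y k - v k)) <= C0 * d k.
    by apply: le_trans (bndB _ _) (ler_wpM2l C0_ge0 (ltW yv)).
  by move: h1 h2 h3; rewrite -/(slice S j0) -/(corner _) -/E; lra.
have z_low k : c / 2 <= rnorm (z k).
  have [Yy _] := yg k; have [_ y1 _ _] := hy k.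
  have := Elow _ Yy; rewrite y1 mulr1; have := rnorm_triB (E (y k)) (z k).
  by have := yz k; have := t_le k; lra.
have z0 k : 0 < rnorm (z k) by apply: lt_le_trans (z_low k); rewrite divr_gt0.
have [g gP] := norming_functionals Dz z0.
have gz k := (gP k).1; have g_le k := (gP k).2.
have [] := @block_sequence_complemented S j0 i0 i0S N_ N_homo z Dz z0 g gz g_le
    Y y d t c C1 c0 C1_ge0 _ Yinf.1 _ Elow z_low hy d_sum yz _ _.
- have Z0z k : Z0 (z k) by apply: Z0_box; case: (vP k).
  apply: (block_projection_bound i0S N_homo Z0z Dz g_le); first exact: normr_ge0.
  move=> N' M x w N'h H; apply: le_trans (dom _ _ _ _ N'h H) _.
  by apply: ler_wpM2r; [exact: rnorm_ge0|exact: ler_norm].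
- by move=> k; case: (yg k).
- move=> M m; apply: le_trans q1; apply: le_trans (geometric_sum m (ltW q0)).
  apply: ler_sum => k _; apply: ler_wpM2l; first exact: ltW.
  by rewrite -addnS exprD; apply: ler_piMl; rewrite ?exprn_ge0 ?exprn_ile1 ?invr_ge0// invf_le1 ?ler1n.
- by move=> M; apply: le_trans (geometric_sum M (ltW q0)) q8.
move=> h1 h2; exists (rclosure (lin_span y)); split=> //.
apply: rclosure_sub; first exact: rclosure_closed.
apply: lin_span_sub; first exact/rclosure_subspace/Yinf.1.
by move=> k; apply: sub_rclosure; case: (yg k).
Qed.

(** Minimality of [S] makes every further restriction singular.  [S] is not
    empty, since a slice without free coordinate is one dimensional. *)
Theorem subprojective_of_multipliers : subprojective Z.
Proof.
move=> Y [Yl Yc Yinf].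
pose Q s := exists (S : {set 'I_n}) (j0 : 'I_n -> nat) (Y' : set Z) (c : R),
  [/\ #|S| = s, infdim Y', Y' `<=` Y, 0 < c &
      forall y, Y' y -> c * rnorm y <= rnorm (op hat (slice S j0) y)].
have exQ : exists s, `[< Q s >].
  exists #|(finset.setTfor 'I_n)|; apply/asboolP; exists (finset.setTfor 'I_n), (fun=> 0%N), Y, 1; split=> // y _.
  rewrite mul1r; suff -> : op hat (slice (finset.setTfor 'I_n) (fun=> 0%N)) y = y by [].
  apply: (hat_eq hat_inj) => j; rewrite hatB box_prod big1 ?mul1r// => i _.
  by rewrite finset.in_setT.
case: (ex_minnP exQ) => s /asboolP[S [j0 [Y' [c [Ss Y'inf Y'Y c0 Elow]]]]] smin.
have S0 : S != finset.set0.
  apply/eqP => S0; have Kinf := infdim_kernel (hat j0) Y'inf.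
  have [y [Yy y0] /eqP/negP] := infdim_neq0 Kinf; apply.
  suff Ey : op hat (slice S j0) y = 0.
    have := Elow _ Yy; rewrite Ey rnorm0 pmulr_rle0// => h; apply/eqP/rnorm_eq0/le_anti.
    by rewrite h rnorm_ge0.
  apply: hat_inj => j; rewrite hatB /box; case: forallP => [h|_]; last by rewrite mul0r.
  suff -> : j = j0 by rewrite y0 mulr0.
  by apply: funext => i; have := h i; rewrite S0 finset.in_set0 => /eqP.
have [i l iS Y1 c1 Y1inf Y1Y' c10|W [WY Winf Wc]] := complemented_near_slice S0 Y'inf c0 Elow.
  apply: contrapT => H; suff : (s <= #|S :\ i|)%N.
    by rewrite -Ss (cardsD1 i S) iS add1n ltnn.
  apply: smin; apply/asboolP; exists (S :\ i), (upd j0 i l), Y1, c1; split=> //.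
    exact: subset_trans Y'Y.
  by move=> y Yy; rewrite leNgt; apply/negP => h; apply: H; exists y.
exists W; split=> //; apply: subset_trans WY _; exact: rclosure_sub.
Qed.

End Abstract.

(** * Sequence spaces *)
Section SequenceNorms.
Context {R : realType} {cplx : bool}.
Local Notation K := (scalars R cplx).

(** What l_p and c_0 have in common.  The last field compares sums of blocks
    whose norms are compared up to a factor [L]; the factor absorbs the
    distortion of an isomorphism. *)
Record block_monotone_norm (S : set (nat -> K^o)) (N : (nat -> K^o) -> R) : Prop := {
  seq_ideal : forall a b : nat -> K^o, S a ->
    (forall l, modulus (b l) <= modulus (a l)) -> S b /\ N b <= N a;
  seq_entry : forall (a : nat -> K^o) l, S a -> modulus (a l) <= N a;
  seq_tail : forall (a : nat -> K^o) (e : R), S a -> 0 < e ->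
    exists M0, forall M, (M0 <= M)%N -> N (fun l => if (l < M)%N then 0 else a l) < e;
  seq_unit : forall l, S (fun k => (k == l)%:R);
  seq_block : forall (L : R) (N_ : nat -> nat) (M : nat) (v w : nat -> nat -> K^o),
    0 <= L -> {homo N_ : a b / (a <= b)%N} ->
    (forall k, (k < M)%N -> [/\ S (v k), S (w k),
       forall l, ~~ (N_ k <= l < N_ k.+1)%N -> v k l = 0 /\ w k l = 0
       & N (v k) <= L * N (w k)]) ->
    S (fun l => \sum_(k < M) w k l) ->
    N (fun l => \sum_(k < M) v k l) <= L * N (fun l => \sum_(k < M) w k l) }.

Lemma at_most_one_block (N_ : nat -> nat) (M : nat) (v : nat -> nat -> K^o) l :
  {homo N_ : a b / (a <= b)%N} ->
  (forall k l, (k < M)%N -> ~~ (N_ k <= l < N_ k.+1)%N -> v k l = 0) ->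
  (exists2 k, (k < M)%N & forall k', (k' < M)%N -> k' != k -> v k' l = 0) \/
  (forall k, (k < M)%N -> v k l = 0).
Proof.
move=> N_homo v0.
have [[k [kM kl]]|H] := pselect (exists k, (k < M)%N /\ (N_ k <= l < N_ k.+1)%N).
  left; exists k => // k' k'M /eqP k'k; apply: v0 => //; apply/negP => k'l.
  by apply: k'k; apply: (block_unique N_homo k'l kl).
by right=> k kM; apply: v0 => //; apply/negP => kl; apply: H; exists k.
Qed.

Section Ell.
Variable p : R.
Hypothesis p_ge1 : 1 <= p.
Let p_gt0 : 0 < p. Proof. exact: lt_le_trans p_ge1. Qed.
Let p_neq0 : p != 0. Proof. by rewrite gt_eqF. Qed.

Let pp (a : nat -> K^o) M : R := \sum_(k < M) modulus (a k) `^ p.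
Let s (a : nat -> K^o) : R := limn (series (abs_pow p a)).

Let ppE a : series (abs_pow p a) = pp a.
Proof. by apply: funext => M; rewrite /series /= big_mkord. Qed.

Let pp_homo a : {homo pp a : x y / (x <= y)%N >-> x <= y}.
Proof. by rewrite -ppE; apply: nondecreasing_series => k _ _; apply: powR_ge0. Qed.

Let ell_le a M : ell p a -> pp a M <= s a.
Proof.
move=> ea; rewrite /s ppE; apply: nondecreasing_cvgn_le; first exact: pp_homo.
by rewrite -ppE.
Qed.

Let ell_of a C : (forall M, pp a M <= C) -> ell p a /\ s a <= C.
Proof.
move=> aC; have ea : cvgn (series (abs_pow p a)).
  rewrite ppE; apply: nondecreasing_is_cvgn; first exact: pp_homo.
  by exists C => _ [M _ <-].
split=> //; rewrite /s; apply: limr_le => //; near=> M; by rewrite ppE.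
Unshelve. all: by end_near. Qed.

Let s_ge0 a : ell p a -> 0 <= s a.
Proof. by move=> /(ell_le 0%N); rewrite /pp big_ord0. Qed.

Let ell_normK a : ell p a -> ell_norm p a `^ p = s a.
Proof. by move=> ea; rewrite /ell_norm -powRrM mulVf// powRr1// s_ge0. Qed.

Let normK_le a : ell p a -> ell_norm p a `^ p <= s a.
Proof. by move=> ea; rewrite ell_normK. Qed.

Let normK_ge a : ell p a -> s a <= ell_norm p a `^ p.
Proof. by move=> ea; rewrite ell_normK. Qed.

Let le_norm a b : ell p a -> s b <= s a -> 0 <= s b -> ell_norm p b <= ell_norm p a.
Proof.
move=> ea ba b0; apply: ge0_ler_powR; rewrite ?nnegrE ?invr_ge0 ?(ltW p_gt0)//.
exact: s_ge0.
Qed.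

Let pow_le (x y : R) : 0 <= x -> x <= y -> x `^ p <= y `^ p.
Proof.
move=> x0 xy; apply: ge0_ler_powR; rewrite ?nnegrE ?(ltW p_gt0)//.
exact: le_trans xy.
Qed.

Let root_le (x y : R) : 0 <= x -> 0 <= y -> x `^ p <= y `^ p -> x <= y.
Proof.
move=> x0 y0 /(@ge0_ler_powR _ p^-1 _ _ _); rewrite !nnegrE !powR_ge0 invr_ge0 (ltW p_gt0).
by rewrite -!powRrM divff// !powRr1//; apply.
Qed.

(** The power sums of disjoint blocks add up, which is why the norm of a sum of
    blocks is determined by the norms of the blocks. *)
Let pp_sum (N_ : nat -> nat) (M n : nat) (v : nat -> nat -> K^o) :
  {homo N_ : a b / (a <= b)%N} ->
  (forall k l, (k < M)%N -> ~~ (N_ k <= l < N_ k.+1)%N -> v k l = 0) ->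
  pp (fun l => \sum_(k < M) v k l) n = \sum_(k < M) pp (v k) n.
Proof.
move=> N_homo v0; rewrite /pp exchange_big /=; apply: eq_bigr => l _.
have [[k kM kl]|H] := at_most_one_block l N_homo v0.
  rewrite (bigD1 (Ordinal kM))//= [RHS](bigD1 (Ordinal kM))//= !big1 ?addr0// => k'; rewrite -val_eqE /= => k'k.
    by rewrite kl// modulus0 powR0.
  by rewrite kl.
rewrite !big1 ?modulus0 ?powR0// => k _; by rewrite H// modulus0 powR0.
Qed.

Lemma ell_block_monotone : block_monotone_norm (ell p) (ell_norm p).
Proof.
split.
- move=> a b ea ba; have [|eb sb] := @ell_of b (s a).
    move=> M; apply: le_trans (ell_le M ea); apply: ler_sum => k _.
    by apply: pow_le => //; apply: modulus_ge0.
  by split; [exact: eb|exact: (le_norm ea sb (s_ge0 eb))].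
- move=> a l ea; apply: root_le; [exact: modulus_ge0|exact: powR_ge0|].
  rewrite ell_normK//; apply: le_trans (ell_le l.+1 ea).
  by rewrite /pp big_ord_recr /= lerDr sumr_ge0// => k _; apply: powR_ge0.
- move=> a e ea e0; have ep : 0 < e `^ p by rewrite powR_gt0.
  have := ea; rewrite /ell /= => /cvgrPdist_lt /(_ _ ep)[M0 _ M0P].
  exists M0 => M MM; have := M0P M MM; rewrite /= ppE -/(s a) => h.
  pose b l : K^o := if (l < M)%N then 0 else a l.
  have ppb m : pp b m <= s a - pp a M.
    have [mM|/ltnW Mm] := leqP m M.
      rewrite /pp big1 ?subr_ge0 ?ell_le// => k _; rewrite /b (leq_trans _ mM)//.
      by rewrite modulus0 powR0.
    rewrite lerBrDr; apply: le_trans (ell_le m ea); rewrite /pp -(subnKC Mm) !big_split_ord /=.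
    rewrite big1 ?add0r; last by move=> k _; rewrite /b ltn_ord modulus0 powR0.
    rewrite [leRHS]addrC; apply: lerD => //; apply: ler_sum => k _.
    by rewrite /b ltnNge leq_addr.
  have [eb sb] := ell_of ppb.
  rewrite -/b ltNge; apply/negP => /(pow_le (ltW e0)); rewrite ell_normK// => h2.
  have h3 := le_lt_trans (ler_norm _) h.
  have h4 := lt_le_trans h3 (le_trans h2 sb).
  by rewrite /s ppE ltxx in h4.
- move=> l; suff : forall M, pp (fun k => (k == l)%:R) M <= 1 by move/ell_of => [].
  move=> M; apply: le_trans (pp_homo _ (leq_addl l.+1 M)) _.
  rewrite /pp big_split_ord /= big_ord_recr /= eqxx modulus1 powR1 !big1 ?add0r ?addr0//.
    by move=> k _; rewrite gtn_eqF ?modulus0 ?powR0// ltn_addr.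
  by move=> k _; rewrite ltn_eqF ?modulus0 ?powR0.
- move=> L N_ M v w L0 N_homo H Sw.
  have v0 k l : (k < M)%N -> ~~ (N_ k <= l < N_ k.+1)%N -> v k l = 0.
    by move=> kM kl; have [_ _ /(_ _ kl)[]] := H _ kM.
  have w0 k l : (k < M)%N -> ~~ (N_ k <= l < N_ k.+1)%N -> w k l = 0.
    by move=> kM kl; have [_ _ /(_ _ kl)[]] := H _ kM.
  have sw : \sum_(k < M) s (w k) <= s (fun l => \sum_(k < M) w k l).
    apply: le_trans (ell_le (N_ M) Sw); rewrite (pp_sum _ N_homo w0).
    apply: ler_sum => k _; have [_ ew _ _] := H _ (ltn_ord k).
    apply: (ell_of _).2 => m; have [mM|/ltnW Mm] := leqP m (N_ M); first exact: pp_homo.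
    rewrite /pp -(subnKC Mm) big_split_ord /= [X in _ + X]big1 ?addr0// => l _.
    rewrite w0 ?modulus0 ?powR0// negb_and -leqNgt; apply/orP; right.
    by apply: leq_trans (N_homo _ _ (ltn_ord k)) _; rewrite leq_addr.
  have [|ev sv] := @ell_of (fun l => \sum_(k < M) v k l)
      (L `^ p * s (fun l => \sum_(k < M) w k l)).
    move=> m; rewrite (pp_sum _ N_homo v0).
    apply: le_trans (ler_wpM2l (powR_ge0 _ _) sw); rewrite mulr_sumr.
    apply: ler_sum => k _; have [ev ew _ vw] := H _ (ltn_ord k).
    apply: le_trans (ell_le m ev) _; rewrite -!ell_normK// -powRM ?powR_ge0//.
    by apply: pow_le => //; apply: powR_ge0.
  apply: root_le; rewrite ?mulr_ge0 ?powR_ge0//.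
  rewrite powRM; [|exact: L0|exact: powR_ge0].
  apply: (le_trans (normK_le ev)); apply: (le_trans sv).
  exact: (ler_wpM2l (powR_ge0 _ _) (normK_ge Sw)).
Qed.

End Ell.

Let c0P (a : nat -> K^o) : c0 a <-> forall e : R, 0 < e ->
  exists N0, forall l, (N0 <= l)%N -> modulus (a l) < e.
Proof.
split=> [ca e e0|H].
  have /cvg_ballP := ca.
  move=> /(_ (of_real e)); rewrite -of_real0 ltr_of_real => /(_ e0)[N0 _ N0P].
  exists N0 => l Nl; have /ball_rnorm := N0P l Nl.
  by rewrite of_real0 sub0r rnormN.
apply/cvg_ballP => e e0; have [r r0 ->] := of_real_pos e0; have [N0 N0P] := H r r0.
by exists N0 => // l /N0P h; apply/ball_rnorm; rewrite sub0r rnormN.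
Qed.

Let c0_sup (a : nat -> K^o) : c0 a -> has_sup (range (fun k => rnorm (a k))).
Proof.
move=> /c0P /(_ 1 ltr01)[N0 N0P]; split; first by exists (rnorm (a 0%N)), 0%N.
exists (1 + \sum_(k < N0) modulus (a k)) => _ [l _ <-].
have h : 0 <= \sum_(k < N0) modulus (a k) by apply: sumr_ge0 => k _; apply: modulus_ge0.
have [lN|Nl] := ltnP l N0; last by have := N0P l Nl; rewrite /modulus in h *; lra.
rewrite (bigD1 (Ordinal lN))//=.
have : 0 <= \sum_(k < N0 | k != Ordinal lN) modulus (a k).
  by apply: sumr_ge0 => k _; apply: modulus_ge0.
rewrite /modulus; lra.
Qed.

Let c0_entry (a : nat -> K^o) l : c0 a -> modulus (a l) <= c0_norm a.
Proof. by move=> ca; apply: sup_upper_bound (c0_sup ca) _ _; exists l. Qed.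

Let c0_le (a : nat -> K^o) C : (forall l, modulus (a l) <= C) -> c0_norm a <= C.
Proof.
move=> aC; apply: ge_sup; first by exists (rnorm (a 0%N)), 0%N.
by move=> _ [l _ <-]; exact: aC.
Qed.

Lemma c0_block_monotone : block_monotone_norm c0 c0_norm.
Proof.
split.
- move=> a b ca ba; split; last by apply: c0_le => l; apply: le_trans (ba l) (c0_entry _ ca).
  apply/c0P => e e0; have [N0 N0P] := (c0P _).1 ca _ e0; exists N0 => l /N0P.
  exact: le_lt_trans.
- by move=> a l ca; apply: c0_entry.
- move=> a e ca e0; have e2 : 0 < e / 2 by rewrite divr_gt0.
  have [N0 N0P] := (c0P _).1 ca _ e2; exists N0 => M MM.
  apply: (@le_lt_trans _ _ (e / 2)); last lra.
  apply: c0_le => l; case: ltnP => Ml; first by rewrite modulus0 ltW.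
  exact/ltW/N0P/(leq_trans MM).
- move=> l; apply/c0P => e e0; exists l.+1 => k kl.
  by rewrite gtn_eqF// modulus0.
- move=> L N_ M v w L0 N_homo H Sw.
  have v0 k l : (k < M)%N -> ~~ (N_ k <= l < N_ k.+1)%N -> v k l = 0.
    by move=> kM kl; have [_ _ /(_ _ kl)[]] := H _ kM.
  have w0 k l : (k < M)%N -> ~~ (N_ k <= l < N_ k.+1)%N -> w k l = 0.
    by move=> kM kl; have [_ _ /(_ _ kl)[]] := H _ kM.
  have W0 : 0 <= c0_norm (fun l => \sum_(k < M) w k l).
    by apply: le_trans (c0_entry 0%N Sw); apply: modulus_ge0.
  have wW k : (k < M)%N -> c0_norm (w k) <= c0_norm (fun l => \sum_(k < M) w k l).
    move=> kM; apply: c0_le => l; have [kl|kl] := boolP (N_ k <= l < N_ k.+1)%N; last first.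
      by rewrite w0// modulus0.
    have [[k' k'M k'l]|h] := at_most_one_block l N_homo w0; last by rewrite h// modulus0.
    have [kk'|kk'] := eqVneq k k'; last by rewrite k'l// modulus0.
    apply: le_trans (c0_entry l Sw); rewrite (bigD1 (Ordinal kM))//= big1 ?addr0//.
    by move=> k2; rewrite -val_eqE /= kk' => h; apply: k'l.
  apply: c0_le => l; have [[k kM kl]|h] := at_most_one_block l N_homo v0; last first.
    by rewrite big1 ?modulus0 ?mulr_ge0// => k _; apply: h.
  rewrite (bigD1 (Ordinal kM))//= big1 ?addr0; last first.
    by move=> k2; rewrite -val_eqE /= => h; apply: kl.
  have [cv cw _ vw] := H _ kM; apply: le_trans (c0_entry l cv) _; apply: le_trans vw _.
  by apply: ler_wpM2l => //; apply: wW.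
Qed.

End SequenceNorms.

(** * Coordinates on spaces isomorphic to sequence spaces *)
Section Coordinates.
Context {R : realType} {cplx : bool}.
Local Notation K := (scalars R cplx).

(** The properties of the unit vector basis that survive an isomorphism, with a
    single constant for all of them. *)
Record coordinates (X : completeNormedModType K) (T : nat -> {linear X -> K^o}) (B : R) :
    Prop := {
  coord_ge1 : 1 <= B;
  coord_inj : forall x, (forall l, T l x = 0) -> x = 0;
  coord_le : forall l x, modulus (T l x) <= B * rnorm x;
  coord_mul : forall m : nat -> K, (forall l, modulus (m l) <= 1) ->
    exists A : {linear X -> X}, (forall l x, T l (A x) = m l * T l x) /\
      forall x, rnorm (A x) <= B * rnorm x;
  coord_cvg : forall x (e : R), 0 < e -> exists M0, forall M x', (M0 <= M)%N ->
    (forall l, T l x' = if (l < M)%N then T l x else 0) -> rnorm (x - x') < e;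
  coord_unit : forall l, exists x, forall k, T k x = (k == l)%:R;
  coord_block : forall (N_ : nat -> nat) (M : nat) (v w : nat -> X),
    {homo N_ : a b / (a <= b)%N} ->
    (forall k, (k < M)%N ->
       (forall l, ~~ (N_ k <= l < N_ k.+1)%N -> T l (v k) = 0 /\ T l (w k) = 0) /\
       rnorm (v k) <= rnorm (w k)) ->
    rnorm (\sum_(k < M) v k) <= B * rnorm (\sum_(k < M) w k) }.

Lemma coord_eq (X : completeNormedModType K) (T : nat -> {linear X -> K^o}) (B : R) (x y : X) :
  coordinates T B -> (forall l, T l x = T l y) -> x = y.
Proof.
move=> TB xy; apply/eqP; rewrite -subr_eq0; apply/eqP/(coord_inj TB) => l.
by rewrite linearB xy subrr.
Qed.

Lemma coordinates_le (X : completeNormedModType K) (T : nat -> {linear X -> K^o}) (B B' : R) :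
  B <= B' -> coordinates T B -> coordinates T B'.
Proof.
move=> BB [B1 Ti Tl Tm Tc Tu Tb].
have up (V : normedModType K) (x : V) : B * rnorm x <= B' * rnorm x.
  by apply: ler_wpM2r => //; apply: rnorm_ge0.
split=> //; first exact: le_trans BB.
- by move=> l x; apply: le_trans (Tl l x) (up _ _).
- move=> m /Tm[A [AT AB]]; exists A; split=> // x; exact: le_trans (AB x) (up _ _).
- by move=> N_ M v w Nh H; apply: le_trans (Tb N_ M v w Nh H) (up _ _).
Qed.

Lemma isomorphic_coordinates (X : completeNormedModType K) (S : set (nat -> K^o))
    (N : (nat -> K^o) -> R) :
  block_monotone_norm S N -> isomorphic_to X S N ->
  exists (T : nat -> {linear X -> K^o}) (B : R), coordinates T B.
Proof.
move=> SN [T [Tinj TS [c [C [c0 C0 cC]]]]].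
have low x : rnorm x <= c^-1 * N (T x).
  by rewrite -ler_pdivrMl ?invr_gt0// invrK; case/andP: (cC x).
have upp x : N (T x) <= C * rnorm x by case/andP: (cC x).
have ST x : S (T x) by rewrite -TS; exists x.
have [ev evE] : exists ev : nat -> {linear X -> K^o}, forall l x, ev l x = T x l.
  have H l : exists e : {linear X -> K^o}, forall x, e x = T x l.
    by apply: (@linear_of R cplx X K^o (fun x => T x l)) => a x y; rewrite linearP.
  by have [e eP] := choice H; exists e.
have pre b : S b -> exists x, T x = b by rewrite -TS => -[x _ <-]; exists x.
pose r := C / c; have r0 : 0 < r by apply: divr_gt0.
have rE : c^-1 * C = r by rewrite mulrC.
pose B := 1 + C + r + r * r; have rr0 : 0 < r * r by apply: mulr_gt0.
have Bup (q : R) (V : normedModType K) (x : V) : q <= B -> q * rnorm x <= B * rnorm x.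
  by move=> qB; apply: ler_wpM2r => //; apply: rnorm_ge0.
exists ev, B; split.
- by rewrite /B; lra.
- move=> x x0; apply: Tinj; rewrite linear0; apply: funext => l.
  by rewrite -evE x0.
- move=> l x; rewrite evE; apply: le_trans (seq_entry SN l (ST x)) _.
  by apply: le_trans (upp x) (Bup _ _ _ _); rewrite /B; lra.
- move=> m m1.
  have mS x : S (fun l => m l * T x l) /\ N (fun l => m l * T x l) <= N (T x).
    apply: (seq_ideal SN) => // l; rewrite modulusM -[leRHS]mul1r.
    by apply: ler_wpM2r; [apply: modulus_ge0|].
  have [a aE] := choice (fun x => pre _ (mS x).1).
  have [|A AE] := @linear_of R cplx X X a.
    move=> b x y; apply: Tinj; rewrite linearP !aE; apply: funext => l.
    by rewrite linearP /= mulrDr mulrCA.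
  exists A; split=> [l x|x]; first by rewrite AE !evE aE.
  rewrite AE; apply: le_trans (low _) _; rewrite aE.
  apply: (@le_trans _ _ (r * rnorm x)); last by apply: Bup; rewrite /B; lra.
  rewrite -rE -mulrA; apply: ler_wpM2l; first by rewrite invr_ge0 ltW.
  exact: le_trans (mS x).2 (upp x).
- move=> x e e0; have ce : 0 < c * e by apply: mulr_gt0.
  have [M0 M0P] := seq_tail SN (ST x) ce; exists M0 => M x' MM x'E.
  apply: le_lt_trans (low _) _; rewrite -ltr_pdivlMl ?invr_gt0// invrK.
  have -> : T (x - x') = (fun l => if (l < M)%N then 0 else T x l).
    apply: funext => l; rewrite -evE linearB x'E evE; case: ifP => _.
      by rewrite subrr.
    by rewrite subr0.
  exact: M0P.
- by move=> l; have [x xE] := pre _ (seq_unit SN l); exists x => k; rewrite evE xE.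
- move=> N_ M v w Nh H.
  have TE (u : nat -> X) : T (\sum_(k < M) u k) = (fun l => \sum_(k < M) T (u k) l).
    apply: funext => l; rewrite -evE linear_sum; apply: eq_bigr => k _.
    by rewrite evE.
  have := @seq_block _ _ S N SN r N_ M (fun k => T (v k)) (fun k => T (w k)) (ltW r0) Nh.
  rewrite -!TE => /(_ _ (ST _)) h.
  apply: le_trans (low _) _; apply: (@le_trans _ _ (r * r * rnorm (\sum_(k < M) w k))); last first.
    by apply: Bup; rewrite /B; lra.
  have -> : r * r * rnorm (\sum_(k < M) w k) = c^-1 * (r * (C * rnorm (\sum_(k < M) w k))).
    by rewrite -{1}rE; ring.
  apply: ler_wpM2l; first by rewrite invr_ge0 ltW.
  apply: le_trans (h _) _; last by apply: ler_wpM2l => //; apply: ltW.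
  move=> k kM; have [vw0 vw] := H _ kM; split=> // [l /vw0|]; first by rewrite !evE.
  apply: le_trans (upp _) _; apply: (@le_trans _ _ (C * rnorm (w k))).
    by apply: ler_wpM2l => //; apply: ltW.
  rewrite /r -mulrA; apply: ler_wpM2l; first exact: ltW.
  exact: low.
Qed.

End Coordinates.

(** * The algebraic tensor product *)
Section TensorAlgebra.
Context {K : numFieldType} {n : nat}.
Variable X : 'I_n -> lmodType K.

Lemma multi_ext (x y : forall i, X i) : (forall i, x i = y i) -> x = y.
Proof. by move=> xy; apply: functional_extensionality_dep. Qed.

Lemma elementary_in (x : forall i, X i) : elementary x \in @in_tensor K n X.
Proof.
apply/asboolP; exists 1%N, (fun=> 1), (fun=> x).
by rewrite big_ord1 scale1r.
Qed.

Definition elem (x : forall i, X i) : tensor X := Tensor (elementary_in x).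

Lemma tensor_ext (u v : tensor X) : (forall f, u f = v f) -> u = v.
Proof. by move=> uv; apply: val_inj; apply: funext. Qed.

Definition eval_form (f : multilinear_form X) (u : tensor X) : K^o := u f.

Lemma eval_form_linear f : linear (eval_form f).
Proof. by move=> a u v. Qed.

HB.instance Definition _ f :=
  GRing.isLinear.Build K (tensor X) K^o *:%R (eval_form f) (eval_form_linear f).

Lemma tensor_span (u : tensor X) :
  exists (m : nat) (c : 'I_m -> K) (x : 'I_m -> forall i, X i),
    u = \sum_(k < m) c k *: elem (x k).
Proof.
have /asboolP[m [c [x ux]]] := tensorP u; exists m, c, x.
apply: tensor_ext => f; rewrite -/(eval_form f _) -/(eval_form f (\sum_(_ < _) _)).
rewrite linear_sum /eval_form ux fct_sumE; apply: eq_bigr => k _.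
by rewrite -/(eval_form f _) linearZ.
Qed.

Lemma eq_on_elem (V : lmodType K) (F G : {linear tensor X -> V}) :
  (forall x, F (elem x) = G (elem x)) -> forall u, F u = G u.
Proof.
move=> FG u; have [m [c [x ->]]] := tensor_span u.
by rewrite !linear_sum; apply: eq_bigr => k _; rewrite !linearZ FG.
Qed.

Lemma elem_lin (x : forall i, X i) i (a : K) (y z : X i) :
  elem (dfwith x i (a *: y + z)) = a *: elem (dfwith x i y) + elem (dfwith x i z).
Proof. by apply: tensor_ext => f; apply: mlf_multilinear. Qed.

Lemma elemB (x : forall i, X i) i (y z : X i) :
  elem (dfwith x i (y - z)) = elem (dfwith x i y) - elem (dfwith x i z).
Proof. by rewrite addrC -scaleN1r elem_lin scaleN1r addrC. Qed.

Lemma elem0 (x : forall i, X i) i : elem (dfwith x i 0) = 0.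
Proof. by rewrite -(subrr 0) elemB subrr. Qed.

Lemma elemZ (x : forall i, X i) i (a : K) (y : X i) :
  elem (dfwith x i (a *: y)) = a *: elem (dfwith x i y).
Proof. by rewrite -[a *: y]addr0 elem_lin elem0 addr0. Qed.

Lemma elem_sum (x : forall i, X i) i (M : nat) (y : nat -> X i) :
  elem (dfwith x i (\sum_(l < M) y l)) = \sum_(l < M) elem (dfwith x i (y l)).
Proof.
elim: M => [|M IH]; first by rewrite !big_ord0 elem0.
rewrite !big_ord_recr /= -IH addrC -[y M]scale1r elem_lin !scale1r addrC.
by [].
Qed.

Lemma dfwith_id (x : forall i, X i) i : dfwith x i (x i) = x.
Proof. by apply: multi_ext => j; case: dfwithP. Qed.

(** The scalars are moved out one coordinate at a time. *)
Lemma elem_scale (a : 'I_n -> K) (x : forall i, X i) :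
  elem (fun i => a i *: x i) = (\prod_(i < n) a i) *: elem x.
Proof.
suff H : forall s : seq 'I_n, uniq s ->
    elem (fun i => if i \in s then a i *: x i else x i) = (\prod_(i <- s) a i) *: elem x.
  have := H _ (enum_uniq 'I_n); rewrite big_enum /= => <-.
  by congr elem; apply: multi_ext => i; rewrite mem_enum.
elim=> [_|i s IH /andP[iNs /IH {}IH]]; first by rewrite big_nil scale1r.
pose y : forall j, X j := fun j => if j \in s then a j *: x j else x j.
rewrite big_cons -scalerA -IH -/y.
have -> : elem (fun j => if j \in i :: s then a j *: x j else x j) = elem (dfwith y i (a i *: y i)).
  congr elem; apply: multi_ext => j; case: dfwithP => [|j' ij]; rewrite /y inE.
    by rewrite eqxx (negbTE iNs).
  by rewrite eq_sym (negbTE ij).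
by rewrite elemZ dfwith_id.
Qed.

Section Lift.
Variable A : forall i, {linear X i -> X i}.

Lemma pullback_multilinear (f : multilinear_form X) :
  multilinear (fun x => f (fun i => A i (x i))).
Proof.
move=> x i a y z.
have E v : (fun j => A j (dfwith x i v j)) = dfwith (fun j => A j (x j)) i (A i v).
  apply: multi_ext => j; case: (dfwithP (fun j => A j (x j))) => [|j' ij]; first by rewrite dfwithin.
  by rewrite dfwithout.
by rewrite !E linearP mlf_multilinear.
Qed.

Definition pullback f : multilinear_form X := MultilinearForm (pullback_multilinear f).

(** The lifted operator acts on functionals of forms by pulling forms back; on
    elementary tensors it applies [A] to every factor. *)
Lemma tlift_in (u : tensor X) : (fun f => u (pullback f)) \in @in_tensor K n X.
Proof.
have [m [c [x ->]]] := tensor_span u; apply/asboolP.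
exists m, c, (fun k i => A i (x k i)); apply: funext => f.
rewrite -/(eval_form (pullback f) _) linear_sum fct_sumE; apply: eq_bigr => k _.
by rewrite linearZ.
Qed.

Definition tlift (u : tensor X) : tensor X := Tensor (tlift_in u).

Lemma tlift_linear : linear tlift.
Proof. by move=> a u v; apply: tensor_ext. Qed.

HB.instance Definition _ :=
  GRing.isLinear.Build K (tensor X) (tensor X) *:%R tlift tlift_linear.

Lemma tlift_elem x : tlift (elem x) = elem (fun i => A i (x i)).
Proof. exact: tensor_ext. Qed.

Lemma tlift_product (u : tensor X) (phi psi : forall i, {linear X i -> K^o}) :
  (forall i x, psi i x = phi i (A i x)) ->
  tlift u (product_form phi) = u (product_form psi).
Proof.
move=> pp; congr (tensor_val u _); rewrite /product_form /pullback /=.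
set f := (fun x => _); set g := product_fun psi.
have fg : f = g.
  by apply: funext => x; rewrite /f /g /product_fun /=; apply: eq_bigr => i _; rewrite pp.
move: (pullback_multilinear _) (product_fun_multilinear psi); rewrite -/f -/g.
rewrite fg => p q; congr MultilinearForm; exact: Prop_irrelevance.
Qed.

End Lift.

Lemma product_form_scale (u : tensor X) (phi psi : forall i, {linear X i -> K^o}) (a : 'I_n -> K) :
  (forall i x, psi i x = a i * phi i x) ->
  u (product_form psi) = (\prod_(i < n) a i) * u (product_form phi).
Proof.
move=> pp; have [m [c [x ->]]] := tensor_span u.
rewrite -/(eval_form _ _) -[in RHS]/(eval_form _ _) !linear_sum mulr_sumr.
apply: eq_bigr => k _; rewrite !linearZ.
change (c k * \prod_(i < n) psi i (x k i) = (\prod_(i < n) a i) * (c k * \prod_(i < n) phi i (x k i))).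
rewrite mulrCA -big_split; congr (_ * _).
by apply: eq_bigr => i _; rewrite pp.
Qed.

Lemma tlift_product_scale (A : forall i, {linear X i -> X i}) (u : tensor X)
    (phi psi : forall i, {linear X i -> K^o}) (a : 'I_n -> K) :
  (forall i x, phi i (A i x) = a i * psi i x) ->
  tlift A u (product_form phi) = (\prod_(i < n) a i) * u (product_form psi).
Proof.
move=> h; rewrite -(product_form_scale u (psi := fun i => phi i \o A i) h).
exact: tlift_product.
Qed.

End TensorAlgebra.

(** * Completions of tensor products of spaces with coordinates *)
Section Crossnorm.
Context {R : realType} {cplx : bool} {n : nat}.
Local Notation K := (scalars R cplx).
Variables (X : 'I_n -> completeNormedModType K).
Variables (T : forall i, nat -> {linear X i -> K^o}) (B : R).
Hypothesis coordT : forall i, coordinates (T i) B.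

Definition tbox (Pr : forall i, pred nat -> {linear X i -> X i}) (q : 'I_n -> pred nat) :
  {linear tensor X -> tensor X} := tlift (fun i => Pr i (q i)).

(** The side in direction [i] of a diagonal cube. *)
Definition block_pred (S : {set 'I_n}) (j0 : 'I_n -> nat) (a b : nat) : 'I_n -> pred nat :=
  fun i l => if i \in S then (a <= l < b)%N else l == j0 i.

(** The property separating the two norms from general crossnorms: it is what
    makes operators acting on each diagonal block uniformly bounded. *)
Definition block_dominated (Pr : forall i, pred nat -> {linear X i -> X i})
    (N : tensor X -> R) : Prop :=
  forall (S : {set 'I_n}) (j0 : 'I_n -> nat), S != finset.set0 ->
  exists C : R, forall (N_ : nat -> nat) (M : nat) (u v : nat -> tensor X),
    {homo N_ : a b / (a <= b)%N} ->
    (forall k, (k < M)%N -> let D := tbox Pr (block_pred S j0 (N_ k) (N_ k.+1)) in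
       N (D (u k)) <= N (D (v k))) ->
    N (\sum_(k < M) tbox Pr (block_pred S j0 (N_ k) (N_ k.+1)) (u k)) <=
    C * N (\sum_(k < M) tbox Pr (block_pred S j0 (N_ k) (N_ k.+1)) (v k)).

Record coordinate_projections (Pr : forall i, pred nat -> {linear X i -> X i}) : Prop := {
  projE : forall i q l x, T i l (Pr i q x) = (q l)%:R * T i l x;
  proj_le : forall i q x, rnorm (Pr i q x) <= B * rnorm x }.

Lemma coordinate_projections_exist : exists Pr, coordinate_projections Pr.
Proof.
have H i : exists P : pred nat -> {linear X i -> X i}, forall q,
    (forall l x, T i l (P q x) = (q l)%:R * T i l x) /\
    forall x, rnorm (P q x) <= B * rnorm x.
  have H q : exists A : {linear X i -> X i},
      (forall l x, T i l (A x) = (q l : bool)%:R * T i l x) /\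
      forall x, rnorm (A x) <= B * rnorm x.
    apply: (coord_mul (coordT i) (m := fun l => (q l)%:R)) => l.
    by case: (q l); rewrite ?modulus1 ?modulus0.
  by have [P PP] := choice H; exists P.
exists (fun i => projT1 (cid (H i))); split=> i q; first by move=> l x; have [] := projT2 (cid (H i)) q.
by move=> x; have [] := projT2 (cid (H i)) q.
Qed.

Lemma unit_vectors_exist : exists e : forall i, nat -> X i,
  forall i l k, T i k (e i l) = (k == l)%:R.
Proof.
have H i : exists e : nat -> X i, forall l k, T i k (e l) = (k == l)%:R.
  by have [e eP] := choice (coord_unit (coordT i)); exists e.
exists (fun i => projT1 (cid (H i))) => i l k; exact: projT2 (cid (H i)) l k.
Qed.

Variable Pr : forall i, pred nat -> {linear X i -> X i}.
Hypothesis PrP : coordinate_projections Pr.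
Variable e : forall i, nat -> X i.
Hypothesis eP : forall i l k, T i k (e i l) = (k == l)%:R.

Lemma proj_ext i q q' x : q =1 q' -> Pr i q x = Pr i q' x.
Proof. by move=> qq; apply: (coord_eq (coordT _)) => l; rewrite !(projE PrP) qq. Qed.

Lemma proj_comp i q q' x : Pr i q (Pr i q' x) = Pr i (fun l => q l && q' l) x.
Proof. by apply: (coord_eq (coordT _)) => l; rewrite !(projE PrP) mulrA -natrM mulnb. Qed.

Lemma proj_point i l x : Pr i (pred1 l) x = T i l x *: e i l.
Proof.
apply: (coord_eq (coordT _)) => k; rewrite (projE PrP) linearZ /= eP /GRing.scale /= mulrC.
by case: eqP => [->|]; rewrite ?mulr0.
Qed.

Lemma proj_initial i N x :
  Pr i (fun l => (l < N)%N) x = \sum_(l < N) Pr i (pred1 (l : nat)) x.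
Proof.
apply: (coord_eq (coordT _)) => k; rewrite (projE PrP) linear_sum /=.
under eq_bigr => l _ do rewrite (projE PrP).
rewrite -mulr_suml; congr (_ * _).
have [kN|Nk] := ltnP k N.
  rewrite (bigD1 (Ordinal kN))//= eqxx big1 ?addr0// => l.
  by rewrite -val_eqE /= eq_sym => /negbTE ->.
by rewrite big1// => l _; rewrite /= gtn_eqF// (leq_trans (ltn_ord l)).
Qed.

Variables (Z : completeNormedModType K) (J : {linear tensor X -> Z}).
Hypothesis Jdense : dense (range J).
Hypothesis J_lift : forall (A : forall i, {linear X i -> X i}) (C : R), 0 <= C ->
  (forall i x, rnorm (A i x) <= C * rnorm x) ->
  forall u, rnorm (J (tlift A u)) <= C ^+ n * rnorm (J u).
Hypothesis J_elem : forall x : (forall i, X i),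
  rnorm (J (elem x)) <= \prod_(i < n) rnorm (x i).
Hypothesis J_form : forall (phi : forall i, {linear X i -> K^o}) (C : R), 0 <= C ->
  (forall i x, modulus (phi i x) <= C * rnorm x) ->
  forall u : tensor X, modulus (u (product_form phi)) <= C ^+ n * rnorm (J u).

Hypothesis n_gt0 : (0 < n)%N.
Let B_ge1 : 1 <= B. Proof. exact: coord_ge1 (coordT (Ordinal n_gt0)). Qed.
Let B_ge0 : 0 <= B. Proof. exact: le_trans B_ge1. Qed.
Let C0 := B ^+ n.
Let C0_ge1 : 1 <= C0. Proof. exact: exprn_ege1. Qed.
Let C0_ge0 : 0 <= C0. Proof. exact: le_trans C0_ge1. Qed.

Lemma eq_on_dense (W : normedModType K) (f g : {linear Z -> W}) (C D : R) :
  (forall z, rnorm (f z) <= C * rnorm z) -> (forall z, rnorm (g z) <= D * rnorm z) ->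
  (forall u, f (J u) = g (J u)) -> forall z, f z = g z.
Proof.
move=> fC gD fg z.
have [|h hE] := @linear_of _ _ Z W (fun z => f z - g z).
  by move=> a x y; rewrite [f _]linearP [g _]linearP scalerBr opprD addrACA.
apply/eqP; rewrite -subr_eq0 -hE; apply/eqP/rnorm_eq0/le_anti; rewrite rnorm_ge0 andbT.
have -> : 0 = rnorm ((\0 : {linear Z -> W}) z) by rewrite rnorm0.
apply: (@rclosure_le _ _ _ _ _ h \0 (C + D) 0 (range J)).
- move=> x; rewrite hE; apply: le_trans (rnormD _ _) _; rewrite rnormN mulrDl.
  exact: lerD.
- by move=> x; rewrite rnorm0 mul0r.
- by move=> _ [u _ <-]; rewrite hE fg subrr.
- by move=> r r0; apply: dense_rnormP.
Qed.

Let hat0 (j : 'I_n -> nat) : {linear tensor X -> K^o} :=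
  eval_form (product_form (fun i => T i (j i))).

Let hat0_lift (A : forall i, {linear X i -> X i}) (m : 'I_n -> nat -> K) j u :
  (forall i l x, T i l (A i x) = m i l * T i l x) ->
  hat0 j (tlift A u) = (\prod_(i < n) m i (j i)) * hat0 j u.
Proof.
move=> AT.
exact: (tlift_product_scale u (fun i => AT i (j i))).
Qed.

Let hat_ex : exists hat : ('I_n -> nat) -> {linear Z -> K^o},
  (forall j u, hat j (J u) = hat0 j u) /\ (forall j z, modulus (hat j z) <= C0 * rnorm z).
Proof.
have H j : exists h : {linear Z -> K^o},
    (forall u, h (J u) = hat0 j u) /\ (forall z, modulus (h z) <= C0 * rnorm z).
  apply: (extend_dense C0_ge0 rcomplete_scalars Jdense) => u.
  by apply: J_form => // i x; apply: coord_le.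
have [h hP] := choice H.
by exists h; split=> j; case: (hP j).
Qed.

Section Hat.
Variable hat : ('I_n -> nat) -> {linear Z -> K^o}.
Hypothesis hatJ : forall j u, hat j (J u) = hat0 j u.
Hypothesis hat_le : forall j z, modulus (hat j z) <= C0 * rnorm z.

Let lift_multiplier (A : forall i, {linear X i -> X i}) (m : 'I_n -> nat -> K) :
  (forall i x, rnorm (A i x) <= B * rnorm x) ->
  (forall i l x, T i l (A i x) = m i l * T i l x) ->
  exists U : {linear Z -> Z}, [/\ forall u, U (J u) = J (tlift A u),
    forall z, rnorm (U z) <= C0 * rnorm z &
    is_multiplier hat (fun j => \prod_(i < n) m i (j i)) U].
Proof.
move=> AB AT.
have [U [UJ UC]] := extend_dense (A := J \o tlift A : {linear tensor X -> Z}) C0_ge0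
  (@complete_rcomplete _ _ Z) Jdense (J_lift B_ge0 AB).
exists U; split=> // z j.
set c := \prod_(i < n) _.
have [|h hE] := @linear_of _ _ Z K^o (fun z => c * hat j z).
  by move=> a x y; rewrite linearP mulrDr /GRing.scale /= mulrCA.
rewrite -hE.
apply: (@eq_on_dense _ (hat j \o U : {linear Z -> K^o}) h (C0 * C0) (modulus c * C0)) => [x|x|u] /=.
- apply: le_trans (hat_le _ _) _; rewrite -mulrA; exact: ler_wpM2l.
- rewrite hE -/(modulus _) modulusM -mulrA; apply: ler_wpM2l => //; exact: modulus_ge0.
- by rewrite hE UJ !hatJ (hat0_lift _ _ AT).
Qed.

Let hat_product_multiplier (m : 'I_n -> nat -> K) :
  (forall i l, modulus (m i l) <= 1) ->
  multiplier hat (fun j => \prod_(i < n) m i (j i)) C0.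
Proof.
move=> m1; have H i := coord_mul (coordT i) (m1 i).
have [|i l x|U [_ UC Um]] := @lift_multiplier (fun i => projT1 (cid (H i))) m.
- by move=> i x; have [_] := projT2 (cid (H i)).
- by have [h _] := projT2 (cid (H i)).
by exists U.
Qed.

Let box_multiplier_ex (q : 'I_n -> pred nat) : exists U : {linear Z -> Z},
  [/\ forall u, U (J u) = J (tbox Pr q u),
    forall z, rnorm (U z) <= C0 * rnorm z & is_multiplier hat (box q) U].
Proof.
have [||U [UJ UC Um]] := @lift_multiplier (fun i => Pr i (q i)) (fun i l => (q i l)%:R).
- by move=> i x; apply: proj_le.
- by move=> i l x; rewrite (projE PrP).
by exists U; split=> // z j; rewrite Um box_prod.
Qed.

(** A corner is a finite set of multi-indices, and its coordinates are resolved
    into points one at a time.  This estimate is what makes the coordinates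
    determine the elements of the completion. *)
Let corner_bound N : exists (L : seq ('I_n -> nat)) (C : R), 0 <= C /\
  forall u, rnorm (J (tbox Pr (fun _ l => (l < N)%N) u)) <=
    C * \sum_(j <- L) modulus (hat0 j u).
Proof.
suff H : forall s : seq 'I_n, uniq s -> forall j0 : 'I_n -> nat,
    exists (L : seq ('I_n -> nat)) (C : R), 0 <= C /\
      forall u, rnorm (J (tbox Pr (fun i l => if i \in s then (l < N)%N else l == j0 i) u)) <=
        C * \sum_(j <- L) modulus (hat0 j u).
  have [L [C [C_ge0 LC]]] := H _ (enum_uniq 'I_n) (fun=> 0%N).
  exists L, C; split=> // u; have := LC u; congr (rnorm (J _) <= _).
  apply: eq_on_elem => x; rewrite /tbox /= !tlift_elem; congr elem.
  by apply: multi_ext => i; apply: proj_ext => l; rewrite mem_enum.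
elim=> [_ j0|i s IH /andP[iNs /IH {}IH] j0].
  exists [:: j0], (rnorm (J (elem (fun i => e i (j0 i))))); split; first exact: rnorm_ge0.
  move=> u; rewrite big_seq1 mulrC -rnormZ -linearZ /= le_eqVlt; apply/orP; left.
  apply/eqP; congr (rnorm (J _)).
  have [|F FE] := @linear_of _ _ (tensor X) (tensor X)
      (fun u => hat0 j0 u *: elem (fun i => e i (j0 i))).
    by move=> a x y; rewrite linearP scalerDl scalerA.
  rewrite -FE; apply: eq_on_elem => x; rewrite FE /tbox /= tlift_elem -elem_scale; congr elem.
  by apply: multi_ext => i; rewrite -proj_point; apply: proj_ext.
have [L LP] := choice (fun l : nat => IH (upd j0 i l)).
have [C CP] := choice LP.
exists (flatten [seq L l | l <- iota 0 N]), (\sum_(l < N) C l).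
have C_ge0 l : 0 <= C l by case: (CP l).
split; first by apply: sumr_ge0.
move=> u.
have -> : tbox Pr (fun i' l => if i' \in i :: s then (l < N)%N else l == j0 i') u =
    \sum_(l < N) tbox Pr (fun i' l' => if i' \in s then (l' < N)%N else l' == upd j0 i l i') u.
  have [|F FE] := @linear_of _ _ (tensor X) (tensor X) (fun u => \sum_(l < N)
      tbox Pr (fun i' l' => if i' \in s then (l' < N)%N else l' == upd j0 i l i') u).
    move=> a x y; rewrite scaler_sumr -big_split; apply: eq_bigr => l _.
    by rewrite linearP.
  rewrite -FE; apply: eq_on_elem => x; rewrite FE /tbox /= tlift_elem.
  pose y i' := Pr i' (fun l' => if i' \in i :: s then (l' < N)%N else l' == j0 i') (x i').
  have -> : elem y = elem (dfwith y i (\sum_(l < N) Pr i (pred1 (l : nat)) (x i))).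
    congr elem; apply: multi_ext => i'; case: dfwithP => // .
    by rewrite -proj_initial /y; apply: proj_ext => l; rewrite mem_head.
  rewrite (elem_sum _ _ (fun l => Pr i (pred1 l) (x i))); apply: eq_bigr => l _.
  rewrite tlift_elem; congr elem; apply: multi_ext => i'; case: dfwithP => [|i2 ii2].
    by apply: proj_ext => l'; rewrite (negbTE iNs) /upd eqxx.
  by apply: proj_ext => l'; rewrite inE /upd eq_sym (negbTE ii2).
rewrite linear_sum; apply: le_trans (rnorm_sum _ _ _) _; rewrite mulr_suml.
apply: ler_sum => l _; have [_ h] := CP (l : nat); apply: le_trans (h u) _; apply: ler_wpM2l => //.
rewrite big_flatten /= big_map.
have lN : (l : nat) \in iota 0 N by rewrite mem_iota /= ltn_ord.
rewrite (big_rem (l : nat) lN) /= lerDl; apply: sumr_ge0 => k _.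
by apply: sumr_ge0 => j _; apply: modulus_ge0.
Qed.


(** The factors of [x] are replaced by those of [y] one at a time. *)
Let elem_diff (x y : forall i, X i) (M d : R) : 1 <= M -> 0 <= d ->
  (forall i, rnorm (x i) <= M) -> (forall i, rnorm (y i) <= M) ->
  (forall i, rnorm (x i - y i) <= d) ->
  rnorm (J (elem x) - J (elem y)) <= n%:R * (d * M ^+ n).
Proof.
move=> M1 d0 xM yM xy.
pose h k : forall i, X i := fun i => if (i < k)%N then y i else x i.
have step k : (k < n)%N -> rnorm (J (elem (h k)) - J (elem (h k.+1))) <= d * M ^+ n.
  move=> kn; pose i := Ordinal kn.
  have -> : h k = dfwith (h k) i (x i).
    apply: multi_ext => i'; case: dfwithP => [|//]; by rewrite /h ltnn.
  have -> : h k.+1 = dfwith (h k) i (y i).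
    apply: multi_ext => i'; case: dfwithP => [|i2 ii2]; rewrite /h; first by rewrite leqnn.
    by rewrite ltnS leq_eqVlt -[(i2 == k :> nat)]/(i2 == i) eq_sym (negbTE ii2).
  rewrite -linearB -elemB; apply: le_trans (J_elem _) _.
  rewrite (bigD1 i)//= dfwithin; apply: ler_pM; rewrite ?rnorm_ge0//.
    by apply: prodr_ge0 => i' _; apply: rnorm_ge0.
  have -> : M ^+ n = \prod_(i < n) M by rewrite prodr_const card_ord.
  rewrite [leRHS](bigD1 i)//=.
  have h1 : \prod_(i' < n | i' != i) rnorm (dfwith (h k) i (x i - y i) i') <=
      \prod_(i' < n | i' != i) M.
    apply: ler_prod => i' ii'; rewrite rnorm_ge0 dfwithout 1?eq_sym//.
    by rewrite /= /h; case: ifP.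
  apply: le_trans h1 _; apply: ler_peMl => //; apply: prodr_ge0 => i' _.
  exact: le_trans M1.
have H k : (k <= n)%N -> rnorm (J (elem x) - J (elem (h k))) <= k%:R * (d * M ^+ n).
  elim: k => [_|k IH kn].
    have -> : h 0%N = x by apply: multi_ext.
    by rewrite subrr rnorm0 mul0r.
  rewrite -(subrKA (J (elem (h k)))); apply: le_trans (rnormD _ _) _.
  rewrite -addn1 natrD mulrDl mul1r addn1; apply: lerD; last exact: step.
  by apply: IH; apply: ltnW.
have := H n (leqnn n); have -> // : h n = y.
by apply: multi_ext => i; rewrite /h ltn_ord.
Qed.

Let elem_corner_cvg (x : forall i, X i) (d : R) : 0 < d ->
  exists N0, forall N, (N0 <= N)%N ->
    rnorm (J (elem x) - J (tbox Pr (fun _ l => (l < N)%N) (elem x))) < d.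
Proof.
move=> d0; pose M := B * (1 + \sum_(i < n) rnorm (x i)).
have sge0 : 0 <= \sum_(i < n) rnorm (x i) by apply: sumr_ge0 => i _; apply: rnorm_ge0.
have xM i : rnorm (x i) <= 1 + \sum_(i < n) rnorm (x i).
  rewrite (bigD1 i)//= addrCA lerDl addr_ge0//; apply: sumr_ge0 => i' _; exact: rnorm_ge0.
have BM : 1 + \sum_(i < n) rnorm (x i) <= M.
  rewrite /M; apply: ler_peMl => //; lra.
have M1 : 1 <= M by lra.
have q0 : 0 < n%:R * M ^+ n + 1 by rewrite ltr_wpDl// mulr_ge0// exprn_ge0//; lra.
pose q := d / (n%:R * M ^+ n + 1); have qpos : 0 < q by rewrite divr_gt0.
have cv i := coord_cvg (coordT i) (x i) qpos.
pose f i := projT1 (cid (cv i)).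
exists (\max_(i < n) f i) => N NN; rewrite /tbox /= tlift_elem.
apply: le_lt_trans (elem_diff (M := M) (d := q) M1 (ltW qpos) _ _ _) _.
- by move=> i; apply: le_trans BM.
- move=> i; apply: le_trans (proj_le PrP _ _) _; rewrite /M; exact: ler_wpM2l.
- move=> i; apply: ltW; apply: (projT2 (cid (cv i)) N).
    by apply: leq_trans NN; apply: (leq_bigmax i).
  by move=> l; rewrite (projE PrP); case: ifP; rewrite ?mul1r ?mul0r.
- have qd : q * (n%:R * M ^+ n + 1) = d by rewrite /q mulfVK ?gt_eqF.
  by rewrite mulrCA; move: qd; rewrite mulrDr mulr1; lra.
Qed.

Let corner_converges z (d : R) : 0 < d ->
  exists N0, forall N (U : {linear Z -> Z}), (N0 <= N)%N ->
    (forall u, U (J u) = J (tbox Pr (fun _ l => (l < N)%N) u)) ->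
    (forall z, rnorm (U z) <= C0 * rnorm z) -> rnorm (z - U z) < d.
Proof.
move=> d0.
have Hu u : forall d : R, 0 < d -> exists N0, forall N, (N0 <= N)%N ->
    rnorm (J u - J (tbox Pr (fun _ l => (l < N)%N) u)) < d.
  have [m [c [x ->]]] := tensor_span u.
  elim/big_ind: _ => [r r0|v w Hv Hw r r0|k _ r r0].
  - by exists 0%N => N _; rewrite [tbox _ _ _]linear0 subrr rnorm0.
  - have r2 : 0 < r / 2 by rewrite divr_gt0.
    have [N1 H1] := Hv _ r2; have [N2 H2] := Hw _ r2.
    exists (maxn N1 N2) => N; rewrite geq_max => /andP[h1 h2].
    rewrite [tbox _ _ _]linearD ![J (_ + _)]linearD opprD addrACA.
    by apply: le_lt_trans (rnormD _ _) _; have := H1 _ h1; have := H2 _ h2; lra.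
  - have c1 : 0 < modulus (c k) + 1 by rewrite ltr_wpDl ?modulus_ge0.
    have [|N0 H0] := @elem_corner_cvg (x k) (r / (modulus (c k) + 1)); first by rewrite divr_gt0.
    exists N0 => N /H0; rewrite ltr_pdivlMr// => h.
    rewrite [tbox _ _ _]linearZ ![J (_ *: _)]linearZ -scalerBr rnormZ -/(modulus _).
    move: h; set y := rnorm _; have : 0 <= y by apply: rnorm_ge0.
    by have := modulus_ge0 (c k); nra.
have q0 : 0 < d / (C0 + 2) by rewrite divr_gt0// ltr_wpDl.
have [_ [u _ <-] zu] := dense_rnormP Jdense z q0.
have [N0 H0] := Hu u _ q0.
exists N0 => N U NN UJ UC.
have -> : z - U z = (z - J u) + (J u - U (J u)) - U (z - J u).
  by rewrite [U (z - J u)]linearB subrKA opprB subrKA.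
apply: le_lt_trans (rnormD _ _) _; rewrite rnormN.
have := rnormD (z - J u) (J u - U (J u)); have := UC (z - J u).
have := H0 _ NN; rewrite -UJ.
have dq : (C0 + 2) * (d / (C0 + 2)) = d by rewrite mulrC mulfVK// gt_eqF// ltr_wpDl.
have := ler_wpM2l C0_ge0 (ltW zu); move: zu dq; rewrite mulrDl.
set t := d / _; lra.
Qed.

(** An element without coordinates is killed by all the corner projections, and
    these converge strongly to the identity. *)
Let hat_injective z : (forall j, hat j z = 0) -> z = 0.
Proof.
move=> hz; apply/rnorm_eq0/le_anti; rewrite rnorm_ge0 andbT.
apply/ler_addgt0Pr => d d0; rewrite add0r.
have d2 : 0 < d / 2 by rewrite divr_gt0.
have [N0 H0] := corner_converges z d2.
have [U [UJ UC _]] := box_multiplier_ex (fun _ l => (l < N0)%N).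
have zU := H0 N0 U (leqnn _) UJ UC.
have [L [C [C_ge0 LC]]] := corner_bound N0.
pose q := C0 + C * ((size L)%:R * C0) + 1.
have q0 : 0 < q by rewrite ltr_wpDl// addr_ge0// !mulr_ge0.
have [|_ [u _ <-] zu] := dense_rnormP Jdense z (e := d / 2 / q); first by rewrite divr_gt0.
have h1 : rnorm (U (J u)) <= C * ((size L)%:R * C0) * rnorm (z - J u).
  rewrite UJ; apply: le_trans (LC u) _; rewrite -mulrA; apply: ler_wpM2l => //.
  have : \sum_(j <- L) modulus (hat0 j u) <= \sum_(j <- L) C0 * rnorm (z - J u).
    apply: ler_sum => j _; rewrite -hatJ -modulusN -[- _]add0r -[X in X - _](hz j) -linearB.
    exact: hat_le.
  move/le_trans; apply; rewrite big_const_seq count_predT iter_addr_0.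
  by rewrite -mulrA mulr_natl.
have h2 := UC (z - J u); rewrite linearB in h2.
have h3 := rnormD (U z - U (J u)) (U (J u)); rewrite subrK in h3.
have h4 := rnorm_triB z (U z).
rewrite ltr_pdivlMr// /q in zu; have := rnorm_ge0 (z - J u).
move: h1 h2 zu; set t := rnorm (z - J u); set c := C * _ => h1 h2 zu t0.
nra.
Qed.

Lemma diagonal_bound_hat (S : {set 'I_n}) (j0 : 'I_n -> nat) (i0 : 'I_n) (N_ : nat -> nat)
    (M : nat) u : i0 \in S -> {homo N_ : a b / (a <= b)%N} ->
  rnorm (J (\sum_(k < M) tbox Pr (block_pred S j0 (N_ k) (N_ k.+1)) u)) <=
  C0 * C0 ^+ n * rnorm (J u).
Proof.
move=> i0S Nh.
have dm := diagonal_multiplier C0_ge1 hat_product_multiplier Nh j0 M i0S.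
suff -> : J (\sum_(k < M) tbox Pr (block_pred S j0 (N_ k) (N_ k.+1)) u) =
    op hat (fun j => \sum_(k < M) block S j0 (N_ k) (N_ k.+1) j) (J u).
  by have := op_bound hat_injective dm (J u).
apply: (hat_eq hat_injective) => j; rewrite (hat_op dm) !linear_sum mulr_suml.
apply: eq_bigr => k _.
have [U [UJ _ Um]] := box_multiplier_ex (block_pred S j0 (N_ k) (N_ k.+1)).
by rewrite -UJ Um.
Qed.

Hypothesis J_domination : block_dominated Pr (fun u => rnorm (J u)).

Lemma subprojective_hat : subprojective Z.
Proof.
have opJ q u : op hat (box q) (J u) = J (tbox Pr q u).
  have [U [UJ _ Um]] := box_multiplier_ex q.
  by rewrite -UJ; apply: (hat_eq hat_injective) => j; rewrite (hat_box hat_product_multiplier) Um.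
apply: (@subprojective_of_multipliers _ _ _ Z hat C0 C0_ge1 hat_injective hat_product_multiplier _ (range J)).
- move=> z d d0; have [N0 H0] := corner_converges z d0; exists N0 => N NN.
  apply: H0 NN _ _; first by move=> u; apply: opJ.
  exact: (box_bound hat_injective hat_product_multiplier).
- by move=> z d d0; apply: dense_rnormP.
- by move=> a _ [u _ <-]; exists (a *: u) => //; rewrite linearZ.
- by move=> q _ [u _ <-]; exists (tbox Pr q u) => //; rewrite -opJ.
- move=> S j0 S0; have [C HC] := J_domination j0 S0; exists C => N_ M z w Nh H.
  have ex (x : nat -> Z) : (forall k, (k < M)%N -> range J (x k)) ->
      exists u : nat -> tensor X, forall k, (k < M)%N -> x k = J (u k).
    move=> xJ; have ex k : exists u, (k < M)%N -> x k = J u.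
      have [kM|kM] := boolP (k < M)%N; last by exists 0.
      by have [u _ xu] := xJ k kM; exists u.
    by have [u uP] := choice ex; exists u.
  have [u uP] : exists u : nat -> tensor X, forall k, (k < M)%N -> z k = J (u k).
    by apply: ex => k kM; case: (H k kM).
  have [v vP] : exists v : nat -> tensor X, forall k, (k < M)%N -> w k = J (v k).
    by apply: ex => k kM; case: (H k kM).
  have zE k : (k < M)%N -> z k = J (tbox Pr (block_pred S j0 (N_ k) (N_ k.+1)) (u k)).
    by move=> kM; have [_ _ <- _ _] := H k kM; rewrite uP// opJ.
  have wE k : (k < M)%N -> w k = J (tbox Pr (block_pred S j0 (N_ k) (N_ k.+1)) (v k)).
    by move=> kM; have [_ _ _ <- _] := H k kM; rewrite vP// opJ.
  have := HC N_ M u v Nh; rewrite !linear_sum.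
  have -> : \sum_(k < M) z k = \sum_(k < M) J (tbox Pr (block_pred S j0 (N_ k) (N_ k.+1)) (u k)).
    by apply: eq_bigr => k _; apply: zE.
  have -> : \sum_(k < M) w k = \sum_(k < M) J (tbox Pr (block_pred S j0 (N_ k) (N_ k.+1)) (v k)).
    by apply: eq_bigr => k _; apply: wE.
  by apply=> k kM /=; rewrite -zE// -wE//; case: (H k kM).
Qed.

End Hat.

Lemma diagonal_bound (S : {set 'I_n}) (j0 : 'I_n -> nat) (i0 : 'I_n) (N_ : nat -> nat)
    (M : nat) u : i0 \in S -> {homo N_ : a b / (a <= b)%N} ->
  rnorm (J (\sum_(k < M) tbox Pr (block_pred S j0 (N_ k) (N_ k.+1)) u)) <=
  B ^+ n * (B ^+ n) ^+ n * rnorm (J u).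
Proof.
move=> i0S Nh; have [hat [hatJ hat_le]] := hat_ex.
exact: (diagonal_bound_hat hatJ hat_le _ _ _ i0S Nh).
Qed.

Theorem subprojective_of_crossnorm :
  block_dominated Pr (fun u => rnorm (J u)) -> subprojective Z.
Proof.
by move=> dom; have [hat [hatJ hat_le]] := hat_ex; apply: (subprojective_hat hatJ hat_le dom).
Qed.

End Crossnorm.

(** * Almost attained suprema *)
Section NearSup.
Context {R : realType} {cplx : bool}.
Local Notation K := (scalars R cplx).

Lemma near_sup (A : Type) (P : A -> Prop) (h : A -> R) (C : R) :
  (exists a, P a) -> (forall a, P a -> 0 <= h a) -> (forall a, P a -> h a <= C) ->
  exists a, P a /\ forall b, P b -> h b <= 2 * h a.
Proof.
move=> [a0 Pa0] h0 hC; pose E := [set r | exists2 a, P a & r = h a].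
have Es : has_sup E.
  by split; [exists (h a0), a0|exists C => _ [a Pa ->]; apply: hC].
have Eub b : P b -> h b <= sup E by move=> Pb; apply: (sup_upper_bound Es); exists b.
have [s0|s0] := ltP 0 (sup E); last first.
  exists a0; split=> // b Pb; apply: le_trans (Eub _ Pb) _; apply: le_trans s0 _.
  by rewrite mulr_ge0 ?h0.
have [|_ [a Pa ->] ha] := sup_adherent (eps := sup E / 2) _ Es; first by rewrite divr_gt0.
by exists a; split=> // b /Eub; lra.
Qed.

Lemma unit_decomp (V : normedModType K) (x : V) :
  exists2 y, rnorm y <= 1 & x = of_real (rnorm x) *: y.
Proof.
have [x0|x0] := eqVneq (rnorm x) 0.
  by exists 0; rewrite ?rnorm0// x0 of_real0 scale0r; apply: rnorm_eq0.
exists (of_real (rnorm x)^-1 *: x).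
  by rewrite rnormZ -/(modulus _) modulus_of_real ?invr_ge0 ?rnorm_ge0// mulVf.
by rewrite scalerA -of_realM divff// of_real1 scale1r.
Qed.

Lemma near_norming (V : normedModType K) (f : {linear V -> K^o}) (C : R) :
  (forall x, modulus (f x) <= C * rnorm x) ->
  exists2 x, rnorm x <= 1 & forall y, modulus (f y) <= 2 * modulus (f x) * rnorm y.
Proof.
move=> fC; have [|||x [x1 xP]] := @near_sup V (fun x => rnorm x <= 1) (fun x => modulus (f x)) `|C|.
- by exists 0; rewrite rnorm0.
- by move=> x _; apply: modulus_ge0.
- move=> x x1; apply: le_trans (fC x) _; apply: le_trans (ler_norm _) _.
  by rewrite normrM [X in _ * X]ger0_norm ?rnorm_ge0//; apply: ler_piMr.
exists x => // y; have [z z1 yz] := unit_decomp y.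
rewrite [in X in X <= _]yz linearZ [modulus _]modulusM modulus_of_real ?rnorm_ge0//.
by rewrite mulrC; apply: ler_wpM2r; [apply: rnorm_ge0|apply: xP].
Qed.

End NearSup.

(** * Blocks in spaces with coordinates *)
Section Blocks.
Context {R : realType} {cplx : bool} {n : nat}.
Local Notation K := (scalars R cplx).
Variables (X : 'I_n -> completeNormedModType K).
Variables (T : forall i, nat -> {linear X i -> K^o}) (B : R).
Hypothesis coordT : forall i, coordinates (T i) B.
Variable Pr : forall i, pred nat -> {linear X i -> X i}.
Hypothesis PrP : coordinate_projections T B Pr.
Variable N_ : nat -> nat.
Hypothesis N_homo : {homo N_ : a b / (a <= b)%N}.

Definition interval_pred (a b : nat) : pred nat := fun l => (a <= l < b)%N.
Local Notation Q i k := (Pr i (interval_pred (N_ k) (N_ k.+1))).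

Lemma block_proj_idem i k (x : X i) : Q i k (Q i k x) = Q i k x.
Proof. by rewrite (proj_comp coordT PrP); apply: (proj_ext coordT PrP) => l; rewrite andbb. Qed.

Lemma block_proj_disjoint i k l (x : X i) : k <> l -> Q i k (Q i l x) = 0.
Proof.
move=> kl; apply: (coord_eq (coordT _)) => j; rewrite !(projE PrP) linear0 mulrA -natrM mulnb.
case: andP => [[h1 h2]|_]; last by rewrite mul0r.
by case: kl; apply: (block_unique N_homo h1 h2).
Qed.

(** The sum of the [w k] is compared, block by block, with a multiple of the
    restriction of [x] to the union of the blocks. *)
Lemma vector_blocks i (M : nat) (x : X i) (w : nat -> X i) :
  (forall k, (k < M)%N -> Q i k (w k) = w k /\ rnorm (w k) <= B * rnorm (Q i k x)) ->
  rnorm (\sum_(k < M) w k) <= B ^+ 3 * rnorm x.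
Proof.
move=> H; have B1 := coord_ge1 (coordT i); have B0 : 0 <= B := le_trans ler01 B1.
have vanish k l y : ~~ (N_ k <= l < N_ k.+1)%N -> T i l (Q i k y) = 0.
  by move=> /negbTE h; rewrite (projE PrP) /interval_pred h mul0r.
have := coord_block (coordT i) (N_ := N_) (M := M) (v := w) (w := fun k => of_real B *: Q i k x) N_homo.
move=> h; apply: le_trans (h _) _ => {h}.
  move=> k kM; have [wk wle] := H k kM; split=> [l kl|].
    by rewrite -wk linearZ /= !vanish// scaler0.
  by rewrite rnormZ -/(modulus _) modulus_of_real.
rewrite -scaler_sumr rnormZ -/(modulus _) modulus_of_real// !exprS expr0 mulr1 -!mulrA.
do 2 (apply: ler_wpM2l => //).
suff -> : \sum_(k < M) Q i k x = Pr i (interval_pred (N_ 0) (N_ M)) x by apply: (proj_le PrP).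
apply: (coord_eq (coordT _)) => l; rewrite (projE PrP) linear_sum /=.
under eq_bigr => k _ do rewrite (projE PrP).
rewrite -mulr_suml; congr (_ * _).
have [lM|nl] := boolP (interval_pred (N_ 0) (N_ M) l).
  have [k kM kl] := block_exists lM.
  rewrite (bigD1 (Ordinal kM))//= /interval_pred kl big1 ?addr0// => k'.
  rewrite -val_eqE /= => k'k; case: (boolP (N_ k' <= l < _)%N) => // h.
  by case/eqP: k'k; apply: (block_unique N_homo h kl).
rewrite big1// => k _; rewrite /interval_pred; case: (boolP (N_ k <= l < _)%N) => // /andP[h1 h2].
case/negP: nl; rewrite /interval_pred (leq_trans _ h1) ?N_homo//=.
by rewrite (leq_trans h2)// N_homo.
Qed.

(** Functionals glued from blocks no larger than those of [phi] are no larger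
    than [phi], up to a constant.  Testing on [x] involves the numbers
    [t k * rnorm (Q i k x)], and almost norming vectors of the restrictions of
    [phi] assemble, by [vector_blocks], to a vector comparable with [x] on
    which [phi] takes half of their sum as its value. *)
Lemma dual_blocks i (M : nat) (phi : {linear X i -> K^o}) :
  (forall x, modulus (phi x) <= rnorm x) ->
  exists t : nat -> R, [/\ forall k, 0 <= t k,
    forall k x, modulus (phi (Q i k x)) <= t k * rnorm x &
    forall (psi : nat -> {linear X i -> K^o}) (a : nat -> K),
      (forall k x, modulus (psi k x) <= rnorm x) ->
      (forall k, modulus (a k) <= t k) ->
      forall x, modulus (\sum_(k < M) a k * psi k (Q i k x)) <= 2 * B ^+ 3 * rnorm x].
Proof.
move=> phi1.
have ex k : exists2 x, rnorm x <= 1 & forall y, modulus (phi (Q i k y)) <=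
    2 * modulus (phi (Q i k x)) * rnorm y.
  apply: (@near_norming _ _ _ (phi \o Q i k : {linear X i -> K^o}) B) => x /=.
  exact: le_trans (phi1 _) (proj_le PrP _ _).
have ex' k : exists x, rnorm x <= 1 /\ forall y, modulus (phi (Q i k y)) <=
    2 * modulus (phi (Q i k x)) * rnorm y.
  by have [x x1 xP] := ex k; exists x.
have [y yP] := choice ex'.
have m0 k : 0 <= modulus (phi (Q i k (y k))) by apply: modulus_ge0.
exists (fun k => 2 * modulus (phi (Q i k (y k)))); split.
- by move=> k; rewrite mulr_ge0.
- by move=> k x; case: (yP k).
move=> psi a psi1 at1 x.
have [s sP] : exists s : nat -> K, forall k, modulus (s k) = 1 /\
    s k * phi (Q i k (y k)) = of_real (modulus (phi (Q i k (y k)))).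
  have H k : exists s : K, modulus s = 1 /\ s * phi (Q i k (y k)) = of_real (modulus (phi (Q i k (y k)))).
    by have [s s1 sE] := phase (phi (Q i k (y k))); exists s.
  by have [s sP] := choice H; exists s.
pose w k := (s k * of_real (rnorm (Q i k x))) *: Q i k (y k).
have phiw : phi (\sum_(k < M) w k) =
    of_real (\sum_(k < M) modulus (phi (Q i k (y k))) * rnorm (Q i k x)).
  rewrite linear_sum (big_morph of_real (@of_realD R cplx) (@of_real0 R cplx)).
  apply: eq_bigr => k _.
  transitivity (s k * of_real (rnorm (Q i k x)) * phi (Q i k (y k))).
    by rewrite /w linearZ.
  by rewrite mulrAC (sP k).2 of_realM.
have : modulus (phi (\sum_(k < M) w k)) <= B ^+ 3 * rnorm x.
  apply: le_trans (phi1 _) _; apply: vector_blocks => k kM; split.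
    by rewrite /w linearZ block_proj_idem.
  rewrite /w rnormZ -/(modulus _) modulusM (sP k).1 mul1r modulus_of_real ?rnorm_ge0//.
  rewrite mulrC; apply: ler_wpM2r; first exact: rnorm_ge0.
  apply: le_trans (proj_le PrP _ _) _; have [y1 _] := yP k.
  have B1 := coord_ge1 (coordT i); rewrite -[leRHS]mulr1; apply: ler_wpM2l => //.
  exact: le_trans B1.
rewrite phiw modulus_of_real; last first.
  by apply: sumr_ge0 => k _; rewrite mulr_ge0 ?rnorm_ge0.
move=> h; apply: (@le_trans _ _ (2 * \sum_(k < M) modulus (phi (Q i k (y k))) * rnorm (Q i k x))).
  apply: le_trans (rnorm_sum (V := K^o) _ _ _) _; rewrite mulr_sumr.
  apply: ler_sum => k _; rewrite -/(modulus _) modulusM mulrA.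
  apply: ler_pM; rewrite ?modulus_ge0//; exact: psi1.
by rewrite -mulrA; apply: ler_wpM2l.
Qed.

End Blocks.

Lemma dependent_choice_family (I : Type) (A : I -> Type) (P : forall i, A i -> Prop) :
  (forall i, exists a, P i a) -> exists a : forall i, A i, forall i, P i (a i).
Proof.
move=> H; exists (fun i => projT1 (cid (H i))) => i; exact: projT2 (cid (H i)).
Qed.

(** * The injective tensor product *)
Section Injective.
Context {R : realType} {cplx : bool} {n : nat}.
Local Notation K := (scalars R cplx).
Variables (X : 'I_n -> completeNormedModType K).
Hypothesis n_gt0 : (0 < n)%N.
Implicit Types u v : tensor X.

Definition contractive (phi : forall i, {linear X i -> K^o}) : Prop :=
  forall i x, modulus (phi i x) <= rnorm x.

Let zero_contractive : contractive (fun i => \0).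
Proof. by move=> i x; rewrite /modulus rnorm0 rnorm_ge0. Qed.

Let injective_bounded u : exists C : R, forall phi, contractive phi ->
  modulus (u (product_form phi)) <= C.
Proof.
have [m [c [x ->]]] := tensor_span u.
exists (\sum_(k < m) modulus (c k) * \prod_(i < n) rnorm (x k i)) => phi phi1.
rewrite -/(eval_form (product_form phi) _) linear_sum.
apply: le_trans (rnorm_sum (V := K^o) _ _ _) _; apply: ler_sum => k _.
rewrite linearZ rnormZ -/(modulus _); apply: ler_wpM2l; first exact: modulus_ge0.
change (modulus (\prod_(i < n) phi i (x k i)) <= \prod_(i < n) rnorm (x k i)).
rewrite modulus_prod; apply: ler_prod => i _; rewrite modulus_ge0; exact: phi1.
Qed.

Lemma injective_norm_ge u phi : contractive phi ->
  modulus (u (product_form phi)) <= injective_norm u.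
Proof.
move=> phi1; have [C uC] := injective_bounded u.
apply: sup_upper_bound; last by exists phi.
split; first by exists (modulus (u (product_form phi))), phi.
by exists C => _ [psi [psi1 ->]]; apply: uC.
Qed.

Lemma injective_norm_le u (C : R) :
  (forall phi, contractive phi -> modulus (u (product_form phi)) <= C) ->
  injective_norm u <= C.
Proof.
move=> uC; apply: ge_sup; last by move=> _ [phi [phi1 ->]]; apply: uC.
by exists (rnorm (u (product_form (fun i => \0)))), (fun i => \0).
Qed.

Lemma injective_norm_near u : exists phi, contractive phi /\
  injective_norm u <= 2 * modulus (u (product_form phi)).
Proof.
have [C uC] := injective_bounded u.
have [|||phi [phi1 phiP]] := @near_sup R _ contractive (fun phi => modulus (u (product_form phi))) C.
- by exists (fun i => \0).
- by move=> phi _; apply: modulus_ge0.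
- by [].
by exists phi; split=> //; apply: injective_norm_le.
Qed.

(** The functionals are rescaled to contractions; the factor [c i = 0] forces
    [phi i = 0] and is compatible with the convention [0^-1 = 0]. *)
Lemma injective_norm_form u (phi : forall i, {linear X i -> K^o}) (c : 'I_n -> R) :
  (forall i, 0 <= c i) -> (forall i x, modulus (phi i x) <= c i * rnorm x) ->
  modulus (u (product_form phi)) <= (\prod_(i < n) c i) * injective_norm u.
Proof.
move=> c0 phic.
have [psi psiE] : exists psi : forall i, {linear X i -> K^o},
    forall i x, psi i x = of_real (c i)^-1 * phi i x.
  apply: (@dependent_choice_family _ (fun i => {linear X i -> K^o})
    (fun i f => forall x, f x = of_real (c i)^-1 * phi i x)) => i.
  apply: (@linear_of R cplx (X i) K^o (fun x => of_real (c i)^-1 * phi i x)) => a x y.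
  by rewrite linearP mulrDr /GRing.scale /= mulrCA.
have E i x : phi i x = of_real (c i) * psi i x.
  rewrite psiE mulrA -of_realM; have [ci0|ci0] := eqVneq (c i) 0.
    rewrite ci0 mul0r of_real0 mul0r; apply: modulus_eq0; apply/le_anti.
    by rewrite modulus_ge0 andbT; have := phic i x; rewrite ci0 mul0r.
  by rewrite divff// of_real1 mul1r.
rewrite (product_form_scale u E) modulusM modulus_prod.
have -> : \prod_(i < n) modulus (of_real (c i) : K) = \prod_(i < n) c i.
  by apply: eq_bigr => i _; rewrite modulus_of_real.
apply: ler_wpM2l; first by apply: prodr_ge0.
apply: injective_norm_ge => i x; rewrite psiE modulusM modulus_of_real ?invr_ge0//.
have [ci0|ci0] := eqVneq (c i) 0; first by rewrite ci0 invr0 mul0r rnorm_ge0.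
rewrite ler_pdivrMl//; first by rewrite lt_neqAle eq_sym ci0 c0.
Qed.

Lemma injective_norm_lift (A : forall i, {linear X i -> X i}) (C : R) u : 0 <= C ->
  (forall i x, rnorm (A i x) <= C * rnorm x) ->
  injective_norm (tlift A u) <= C ^+ n * injective_norm u.
Proof.
move=> C0 AC; apply: injective_norm_le => phi phi1.
rewrite (@tlift_product _ _ _ A u phi (fun i => phi i \o A i))//.
have -> : C ^+ n = \prod_(i < n) C by rewrite prodr_const card_ord.
by apply: injective_norm_form => // i x /=; apply: le_trans (phi1 _ _) (AC _ _).
Qed.

Lemma injective_norm_elem (x : forall i, X i) :
  injective_norm (elem x) <= \prod_(i < n) rnorm (x i).
Proof.
apply: injective_norm_le => phi phi1.
change (modulus (\prod_(i < n) phi i (x i)) <= \prod_(i < n) rnorm (x i)).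
rewrite modulus_prod; apply: ler_prod => i _; rewrite modulus_ge0; exact: phi1.
Qed.

Variables (T : forall i, nat -> {linear X i -> K^o}) (B : R).
Hypothesis coordT : forall i, coordinates (T i) B.
Variable Pr : forall i, pred nat -> {linear X i -> X i}.
Hypothesis PrP : coordinate_projections T B Pr.
Variable e : forall i, nat -> X i.
Hypothesis eP : forall i l k, T i k (e i l) = (k == l)%:R.

Lemma tbox_idem (q : 'I_n -> pred nat) u : tbox Pr q (tbox Pr q u) = tbox Pr q u.
Proof.
apply: (@eq_on_elem _ _ _ _ (tbox Pr q \o tbox Pr q : {linear tensor X -> tensor X})) => x.
rewrite /= /tbox /= !tlift_elem; congr elem; apply: multi_ext => i.
by rewrite (proj_comp coordT PrP); apply: (proj_ext coordT PrP) => l; rewrite andbb.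
Qed.

(** Given contractions [phi], the block [k] of the first sum evaluates to at most
    its norm times the product of the [t i k].  This norm is at most that of
    the block [Dv k], which is almost attained at some [psi k].  The [psi k],
    weighted by [t i k], are glued along the blocks into functionals [phi'] of
    controlled norm (see [dual_blocks]), at which the second sum takes the
    value bounding the first. *)
Lemma injective_domination : block_dominated Pr (@injective_norm R cplx n X).
Proof.
move=> S j0 /set0Pn[i0 i0S].
have B1 : 1 <= B := coord_ge1 (coordT i0).
have B0 : 0 <= B := le_trans ler01 B1.
pose E : R := \prod_(i < n) (if i \in S then 1 else rnorm (e i (j0 i))).
have E0 : 0 <= E by apply: prodr_ge0 => i _; case: ifP => // _; apply: rnorm_ge0.
exists (2 * E * (\prod_(i < n) (2 * B ^+ 3))) => N_ M u v Nh H.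
pose q k := block_pred S j0 (N_ k) (N_ k.+1).
pose Dv k := tbox Pr (q k) (v k); pose Du k := tbox Pr (q k) (u k).
pose W := \sum_(k < M) Dv k; rewrite -/W.
have qS i k x : i \in S -> Pr i (q k i) x = Pr i (interval_pred (N_ k) (N_ k.+1)) x.
  by move=> iS; apply: (proj_ext coordT PrP) => l; rewrite /q /block_pred iS.
have qNS i k x : i \notin S -> Pr i (q k i) x = T i (j0 i) x *: e i (j0 i).
  move=> iS; rewrite -(proj_point coordT PrP eP); apply: (proj_ext coordT PrP) => l.
  by rewrite /q /block_pred (negbTE iS).
apply: injective_norm_le => phi phi1.
have t_ex i : exists t : nat -> R,
    [/\ forall k, 0 <= t k, forall k x, modulus (phi i (Pr i (q k i) x)) <= t k * rnorm x,
        i \in S -> forall (psi : nat -> {linear X i -> K^o}) (a : nat -> K),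
        (forall k x, modulus (psi k x) <= rnorm x) ->
        (forall k, modulus (a k) <= t k) ->
        forall x, modulus (\sum_(k < M) a k * psi k (Pr i (interval_pred (N_ k) (N_ k.+1)) x))
          <= 2 * B ^+ 3 * rnorm x
        & i \notin S -> forall k, t k = B].
  have [iS|iNS] := boolP (i \in S).
    have [t [t0 t1 t2]] := dual_blocks coordT PrP Nh M (phi1 i).
    by exists t; split=> // k x; rewrite qS.
  by exists (fun=> B); split=> // k x; apply: le_trans (phi1 _ _) (proj_le PrP _ _).
have [t tP] := choice t_ex.
(* Off [S] a block sees [psi k i] only through its value at one unit vector;
   [psi'] replaces it there by the coordinate, which is the same for all
   [k], at the cost of the constant [E]. *)
have [psi psiP] := choice (fun k => injective_norm_near (Dv k)).
have [psi' psi'E] : exists psi' : nat -> forall i, {linear X i -> K^o}, forall k i x,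
    psi' k i x = if i \in S then psi k i (Pr i (interval_pred (N_ k) (N_ k.+1)) x) else T i (j0 i) x.
  have H1 k : exists f : forall i, {linear X i -> K^o}, forall i x,
      f i x = if i \in S then psi k i (Pr i (interval_pred (N_ k) (N_ k.+1)) x) else T i (j0 i) x.
    apply: (@dependent_choice_family _ (fun i => {linear X i -> K^o}) (fun i f => forall x,
      f x = if i \in S then psi k i (Pr i (interval_pred (N_ k) (N_ k.+1)) x) else T i (j0 i) x)) => i.
    case: (i \in S); last by exists (T i (j0 i)).
    by exists (psi k i \o Pr i (interval_pred (N_ k) (N_ k.+1)) : {linear X i -> K^o}).
  by have [f fP] := choice H1; exists f.
have near k : injective_norm (Dv k) <= 2 * E * modulus (Dv k (product_form (psi' k))).
  have [psi1 psi2] := psiP k; apply: le_trans psi2 _; rewrite -mulrA; apply: ler_wpM2l => //.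
  have := @tlift_product_scale _ _ _ (fun i => Pr i (q k i)) (Dv k) (psi k) (psi' k)
    (fun i => if i \in S then 1 else psi k i (e i (j0 i))).
  have -> : tlift (fun i => Pr i (q k i)) (Dv k) = Dv k by exact: tbox_idem.
  move=> ->; last first.
    move=> i x; rewrite psi'E; have [iS|iS] := boolP (i \in S); first by rewrite qS// mul1r.
    by rewrite qNS// linearZ /GRing.scale /= mulrC.
  rewrite modulusM; apply: ler_wpM2r; first exact: modulus_ge0.
  rewrite modulus_prod; apply: ler_prod => i _; rewrite modulus_ge0 /=.
  by case: ifP => _; [rewrite modulus1|apply: psi1].
have [s sP] : exists s : nat -> K, forall k, modulus (s k) = 1 /\
    s k * Dv k (product_form (psi' k)) = of_real (modulus (Dv k (product_form (psi' k)))).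
  have H1 k : exists s : K, modulus s = 1 /\
      s * Dv k (product_form (psi' k)) = of_real (modulus (Dv k (product_form (psi' k)))).
    by have [s s1 sE] := phase (Dv k (product_form (psi' k))); exists s.
  by have [s sE] := choice H1; exists s.
(* The phases [s k] make all blocks contribute positively; one coordinate
   carries them. *)
pose a i k : K := of_real (t i k) * (if i == i0 then s k else 1).
have at1 i k : modulus (a i k) = t i k.
  have [t0 _ _ _] := tP i; rewrite modulusM modulus_of_real//.
  by case: ifP => _; rewrite ?(sP k).1 ?modulus1 mulr1.
have [phi' phi'E] : exists phi' : forall i, {linear X i -> K^o}, forall i x,
    phi' i x = if i \in S then \sum_(k < M) a i k * psi k i (Pr i (interval_pred (N_ k) (N_ k.+1)) x)
      else of_real B * T i (j0 i) x.
  apply: (@dependent_choice_family _ (fun i => {linear X i -> K^o}) (fun i f => forall x,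
    f x = if i \in S then \sum_(k < M) a i k * psi k i (Pr i (interval_pred (N_ k) (N_ k.+1)) x)
      else of_real B * T i (j0 i) x)) => i.
  case: (i \in S).
    apply: (@linear_of R cplx (X i) K^o (fun x => \sum_(k < M) a i k * psi k i (Pr i (interval_pred (N_ k) (N_ k.+1)) x))).
    move=> b x y; rewrite scaler_sumr -big_split; apply: eq_bigr => k _ /=.
    by rewrite !linearP mulrDr /GRing.scale /= mulrCA.
  apply: (@linear_of R cplx (X i) K^o (fun x => of_real B * T i (j0 i) x)) => b x y.
  by rewrite linearP mulrDr /GRing.scale /= mulrCA.
have Wphi' : W (product_form phi') =
    of_real (\sum_(k < M) (\prod_(i < n) t i k) * modulus (Dv k (product_form (psi' k)))).
  rewrite -/(eval_form (product_form phi') W) linear_sum.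
  rewrite (big_morph of_real (@of_realD R cplx) (@of_real0 R cplx)); apply: eq_bigr => k _.
  change (Dv k (product_form phi') = of_real ((\prod_(i < n) t i k) * modulus (Dv k (product_form (psi' k))))).
  have := @tlift_product_scale _ _ _ (fun i => Pr i (q k i)) (Dv k) phi' (psi' k) (a^~ k).
  have -> : tlift (fun i => Pr i (q k i)) (Dv k) = Dv k by exact: tbox_idem.
  move=> ->; last first.
    move=> i x; rewrite phi'E psi'E; have [iS|iS] := boolP (i \in S).
      rewrite qS// (bigD1 k)//= (block_proj_idem coordT PrP) big1 ?addr0// => l lk.
      rewrite (block_proj_disjoint coordT PrP Nh); first by rewrite linear0 mulr0.
      by move=> E1; case/eqP: lk; apply: val_inj.
    rewrite qNS// linearZ eP eqxx [GRing.Scale.PreLaw.sort _ _ _]mulr1 /a.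
    have [_ _ _ tB] := tP i; rewrite tB//; case: eqP => [ii0|]; last by rewrite mulr1.
    by rewrite ii0 i0S in iS.
  have -> : \prod_(i < n) a i k = of_real (\prod_(i < n) t i k) * s k.
    rewrite /a big_split /= (big_morph of_real (@of_realM R cplx) (@of_real1 R cplx)).
    congr (_ * _); rewrite (bigD1 i0)//= eqxx big1 ?mulr1// => i /negbTE -> //.
  by rewrite -mulrA (sP k).2 of_realM.
have Wle : \sum_(k < M) (\prod_(i < n) t i k) * modulus (Dv k (product_form (psi' k))) <=
    (\prod_(i < n) (2 * B ^+ 3)) * injective_norm W.
  have sge0 : 0 <= \sum_(k < M) (\prod_(i < n) t i k) * modulus (Dv k (product_form (psi' k))).
    apply: sumr_ge0 => k _; rewrite mulr_ge0 ?modulus_ge0//.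
    by apply: prodr_ge0 => i _; case: (tP i).
  rewrite -[leLHS](@modulus_of_real R cplx)// -Wphi'.
  apply: injective_norm_form => [i|i x]; first by rewrite mulr_ge0// exprn_ge0.
  rewrite phi'E; have [_ _ tS _] := tP i; have [iS|iS] := boolP (i \in S).
    apply: (tS iS (fun k => psi k i) (a i)) => k; last by rewrite at1.
    by move=> y; have [psi1 _] := psiP k; apply: psi1.
  rewrite modulusM modulus_of_real//; apply: le_trans (ler_wpM2l B0 (coord_le (coordT i) _ _)) _.
  rewrite mulrA; apply: ler_wpM2r; first exact: rnorm_ge0.
  have : 0 <= B * B by apply: mulr_ge0.
  rewrite !exprS expr0; nra.
rewrite -/(eval_form (product_form phi) _) linear_sum.
apply: le_trans (rnorm_sum (V := K^o) _ _ _) _.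
rewrite -mulrA; apply: le_trans (ler_wpM2l _ Wle); last by rewrite mulr_ge0.
rewrite mulr_sumr; apply: ler_sum => k _.
change (modulus (Du k (product_form phi)) <=
  2 * E * ((\prod_(i < n) t i k) * modulus (Dv k (product_form (psi' k))))).
have tp : 0 <= \prod_(i < n) t i k by apply: prodr_ge0 => i _; case: (tP i).
rewrite mulrCA; apply: le_trans (ler_wpM2l tp (near k)).
apply: le_trans (ler_wpM2l tp (H k (ltn_ord k))).
have DuE : tlift (fun i => Pr i (q k i)) (Du k) = Du k by exact: tbox_idem.
rewrite -[X in modulus (tensor_val X _) <= _]DuE.
rewrite (@tlift_product _ _ _ (fun i => Pr i (q k i)) (Du k) phi (fun i => phi i \o Pr i (q k i)))//.
apply: injective_norm_form => [i|i x]; have [t0 t1 _ _] := tP i; first exact: t0.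
exact: t1.
Qed.

End Injective.

(** * The projective tensor product *)
Section Projective.
Context {R : realType} {cplx : bool} {n : nat}.
Local Notation K := (scalars R cplx).
Variables (X : 'I_n -> completeNormedModType K).
Hypothesis n_gt0 : (0 < n)%N.
Implicit Types u v : tensor X.

(** The coefficients are absorbed into the first factor, hence the hypothesis on
    [n]. *)
Lemma tensor_sum_elem u : exists (m : nat) (x : 'I_m -> forall i, X i),
  u = \sum_(k < m) elem (x k).
Proof.
have [m [c [x ->]]] := tensor_span u; pose i0 := Ordinal n_gt0.
exists m, (fun k => dfwith (x k) i0 (c k *: x k i0)).
by apply: eq_bigr => k _; rewrite elemZ dfwith_id.
Qed.

Let prod_ge0 (x : forall i, X i) : 0 <= \prod_(i < n) rnorm (x i).
Proof. by apply: prodr_ge0 => i _; apply: rnorm_ge0. Qed.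

Let repP u (m : nat) (x : 'I_m -> forall i, X i) :
  (u : multilinear_form X -> K^o) = \sum_(k < m) elementary (x k) <->
  u = \sum_(k < m) elem (x k).
Proof.
have E : (\sum_(k < m) elem (x k) : tensor X) = \sum_(k < m) elementary (x k) :> (multilinear_form X -> K^o).
  apply: funext => f; rewrite -/(eval_form f _) linear_sum fct_sumE.
  by [].
by split=> [uE|->//]; apply: val_inj; rewrite /= uE E.
Qed.

Let norms u := [set r : R | exists (m : nat) (x : 'I_m -> forall i, X i),
  (u : multilinear_form X -> K^o) = \sum_(k < m) elementary (x k) /\
  r = \sum_(k < m) \prod_(i < n) rnorm (x k i)].

Let norms_inf u : has_inf (norms u).
Proof.
split; first by have [m [x ux]] := tensor_sum_elem u; exists (\sum_(k < m) \prod_(i < n) rnorm (x k i)), m, x; split=> //; apply/repP.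
by exists 0 => _ [m [x [_ ->]]]; apply: sumr_ge0 => k _; apply: prod_ge0.
Qed.

Lemma projective_norm_le u (m : nat) (x : 'I_m -> forall i, X i) :
  u = \sum_(k < m) elem (x k) ->
  projective_norm u <= \sum_(k < m) \prod_(i < n) rnorm (x k i).
Proof. by move=> ux; apply: (ge_inf (norms_inf u).2); exists m, x; split=> //; apply/repP. Qed.

Lemma projective_norm_near u (d : R) : 0 < d ->
  exists (m : nat) (x : 'I_m -> forall i, X i), u = \sum_(k < m) elem (x k) /\
    \sum_(k < m) \prod_(i < n) rnorm (x k i) < projective_norm u + d.
Proof.
move=> d0; have [_ [m [x [/repP ux ->]]] h] := inf_adherent d0 (norms_inf u).
by exists m, x.
Qed.

(** One half of the duality between the projective tensor product and bounded
    multilinear forms. *)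
Lemma projective_norm_functional (G : {linear tensor X -> K^o}) (C : R) : 0 <= C ->
  (forall x, modulus (G (elem x)) <= C * \prod_(i < n) rnorm (x i)) ->
  forall u, modulus (G u) <= C * projective_norm u.
Proof.
move=> C0 GC u; apply/ler_addgt0Pr => d d0.
have C1 : 0 < C + 1 by rewrite ltr_wpDl.
have [|m [x [ux h]]] := @projective_norm_near u (d / (C + 1)); first by rewrite divr_gt0.
rewrite [in X in X <= _]ux linear_sum; apply: le_trans (rnorm_sum (V := K^o) _ _ _) _.
apply: (@le_trans _ _ (C * \sum_(k < m) \prod_(i < n) rnorm (x k i))).
  by rewrite mulr_sumr; apply: ler_sum => k _; apply: GC.
have := ler_wpM2l C0 (ltW h); have : C * (d / (C + 1)) <= d.
  by rewrite mulrA ler_pdivrMr// mulrC ler_wpM2l ?lerDl// ltW.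
by rewrite mulrDr; lra.
Qed.

Lemma projective_norm_elem (x : forall i, X i) :
  projective_norm (elem x) <= \prod_(i < n) rnorm (x i).
Proof.
by have := @projective_norm_le (elem x) 1 (fun=> x); rewrite !big_ord1; apply.
Qed.

Lemma projective_norm_lift (A : forall i, {linear X i -> X i}) (C : R) u : 0 <= C ->
  (forall i x, rnorm (A i x) <= C * rnorm x) ->
  projective_norm (tlift A u) <= C ^+ n * projective_norm u.
Proof.
move=> C0 AC; apply/ler_addgt0Pr => d d0.
have Cn : 0 <= C ^+ n by apply: exprn_ge0.
have C1 : 0 < C ^+ n + 1 by rewrite ltr_wpDl.
have [|m [x [ux h]]] := @projective_norm_near u (d / (C ^+ n + 1)); first by rewrite divr_gt0.
have Aux : tlift A u = \sum_(k < m) elem (fun i => A i (x k i)).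
  by rewrite ux linear_sum; apply: eq_bigr => k _; rewrite /= tlift_elem.
apply: le_trans (projective_norm_le Aux) _.
apply: (@le_trans _ _ (C ^+ n * \sum_(k < m) \prod_(i < n) rnorm (x k i))).
  rewrite mulr_sumr; apply: ler_sum => k _.
  have -> : C ^+ n = \prod_(i < n) C by rewrite prodr_const card_ord.
  by rewrite -big_split; apply: ler_prod => i _; rewrite rnorm_ge0 /=.
have := ler_wpM2l Cn (ltW h); have : C ^+ n * (d / (C ^+ n + 1)) <= d.
  by rewrite mulrA ler_pdivrMr// mulrC ler_wpM2l ?lerDl// ltW.
by rewrite mulrDr; lra.
Qed.

Lemma projective_norm_form (phi : forall i, {linear X i -> K^o}) (C : R) u : 0 <= C ->
  (forall i x, modulus (phi i x) <= C * rnorm x) ->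
  modulus (u (product_form phi)) <= C ^+ n * projective_norm u.
Proof.
move=> C0 phiC; apply: (projective_norm_functional (G := eval_form (product_form phi))).
  exact: exprn_ge0.
move=> x; change (modulus (\prod_(i < n) phi i (x i)) <= C ^+ n * \prod_(i < n) rnorm (x i)).
have -> : C ^+ n = \prod_(i < n) C by rewrite prodr_const card_ord.
rewrite modulus_prod -big_split; apply: ler_prod => i _; rewrite modulus_ge0; exact: phiC.
Qed.

Variables (T : forall i, nat -> {linear X i -> K^o}) (B : R).
Hypothesis coordT : forall i, coordinates (T i) B.
Variable Pr : forall i, pred nat -> {linear X i -> X i}.
Hypothesis PrP : coordinate_projections T B Pr.
Variable e : forall i, nat -> X i.
Hypothesis eP : forall i l k, T i k (e i l) = (k == l)%:R.
Variables (Z : completeNormedModType K) (J : {linear tensor X -> Z}).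
Hypothesis Jdense : dense (range J).
Hypothesis JN : forall u, rnorm (J u) = projective_norm u.

Let J_lift (A : forall i, {linear X i -> X i}) (C : R) : 0 <= C ->
  (forall i x, rnorm (A i x) <= C * rnorm x) ->
  forall u, rnorm (J (tlift A u)) <= C ^+ n * rnorm (J u).
Proof. by move=> C0 AC u; rewrite !JN; apply: projective_norm_lift. Qed.

Let J_elem (x : forall i, X i) : rnorm (J (elem x)) <= \prod_(i < n) rnorm (x i).
Proof. by rewrite JN; apply: projective_norm_elem. Qed.

Let J_form (phi : forall i, {linear X i -> K^o}) (C : R) : 0 <= C ->
  (forall i x, modulus (phi i x) <= C * rnorm x) ->
  forall u : tensor X, modulus (u (product_form phi)) <= C ^+ n * rnorm (J u).
Proof. by move=> C0 AC u; rewrite !JN; apply: projective_norm_form. Qed.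

Lemma elem_eq0 (x : forall i, X i) i : x i = 0 -> elem x = 0.
Proof. by move=> xi; rewrite -(dfwith_id x i) xi elem0. Qed.

(** Let [G] come from a functional norming the first sum, and let the elementary
    tensor of [om k] almost norm [G] on the block [k], with value [ga k] up to
    constants.  The first sum is then at most the sum of [ga k] times the norms
    of the blocks of the second sum [W].  Expanding [W] into elementary tensors
    reduces to estimating, for each of them, the sum of [ga k] times the product
    of the norms of its block restrictions ([step]): this sum is the value of [G]
    at the diagonal part of a single elementary tensor [elem y], the factors of
    [y] being glued from the [om k] with those norms as weights. *)
Lemma projective_domination : block_dominated Pr (fun u => rnorm (J u)).
Proof.
move=> S j0 /set0Pn[i0 i0S].
have B1 : 1 <= B := coord_ge1 (coordT i0).
have B0 : 0 <= B := le_trans ler01 B1.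
pose CD := B ^+ n * (B ^+ n) ^+ n.
have CD0 : 0 <= CD by rewrite mulr_ge0// ?exprn_ge0.
pose c := B ^+ 3 * (1 + \sum_(i < n) rnorm (e i (j0 i))).
have esum i : rnorm (e i (j0 i)) <= \sum_(i < n) rnorm (e i (j0 i)).
  by rewrite (bigD1 i)//= lerDl; apply: sumr_ge0 => i' _; apply: rnorm_ge0.
have esum0 : 0 <= \sum_(i < n) rnorm (e i (j0 i)) by apply: sumr_ge0 => i _; apply: rnorm_ge0.
have B3 : 1 <= B ^+ 3 by apply: exprn_ege1.
have c0 : 0 <= c by rewrite mulr_ge0 ?addr_ge0 ?exprn_ge0.
exists (2 * B ^+ n * (CD * c ^+ n)) => N_ M u v Nh H.
pose q k := block_pred S j0 (N_ k) (N_ k.+1).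
pose D k := tbox Pr (q k).
set W := \sum_(k < M) tbox Pr _ (v k).
pose Q i k := Pr i (interval_pred (N_ k) (N_ k.+1)).
have qS i k x : i \in S -> Pr i (q k i) x = Q i k x.
  by move=> iS; apply: (proj_ext coordT PrP) => l; rewrite /q /block_pred iS.
have qNS i k x : i \notin S -> Pr i (q k i) x = T i (j0 i) x *: e i (j0 i).
  move=> iS; rewrite -(proj_point coordT PrP eP); apply: (proj_ext coordT PrP) => l.
  by rewrite /q /block_pred (negbTE iS).
have De k x : D k (elem x) = elem (fun i => Pr i (q k i) (x i)) by exact: tlift_elem.
have DD k w : D k (D k w) = D k w by exact: (tbox_idem coordT PrP).
have Ddisj k l w : k <> l -> D k (D l w) = 0.
  move=> kl; apply: (@eq_on_elem _ _ _ _ (D k \o D l : {linear tensor X -> tensor X}) \0) => x /=.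
  rewrite !De; apply: (elem_eq0 (i := i0)); rewrite !qS//.
  exact: (block_proj_disjoint coordT PrP Nh).
have [f [f1 fz]] := hahn_banach (J (\sum_(k < M) D k (u k))) (@rnormD _ _ Z) (@rnormZ _ _ Z).
pose G : {linear tensor X -> K^o} := f \o J.
have GJ w : modulus (G w) <= rnorm (J w) by apply: f1.
have [om omP] : exists om : nat -> forall i, X i, forall k,
    (forall i, rnorm (om k i) <= 1) /\
    forall x, modulus (G (D k (elem x))) <=
      2 * modulus (G (D k (elem (om k)))) * \prod_(i < n) rnorm (x i).
  suff H1 k : exists om : forall i, X i, (forall i, rnorm (om i) <= 1) /\
      forall x, modulus (G (D k (elem x))) <=
        2 * modulus (G (D k (elem om))) * \prod_(i < n) rnorm (x i).
    by have [om omP] := choice H1; exists om.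
  have [|||om [om1 omP]] := @near_sup R _ (fun x : forall i, X i => forall i, rnorm (x i) <= 1)
      (fun x => modulus (G (D k (elem x)))) (B ^+ n).
  - by exists (fun i => 0) => i; rewrite rnorm0.
  - by move=> x _; apply: modulus_ge0.
  - move=> x x1; apply: le_trans (GJ _) _.
    apply: le_trans (J_lift B0 (fun i => proj_le PrP (q k i)) _) _.
    rewrite -[leRHS]mulr1; apply: ler_wpM2l; first exact: exprn_ge0.
    apply: le_trans (J_elem _) _; apply: (@le_trans _ _ (\prod_(i < n) 1)); last by rewrite big1.
    by apply: ler_prod => i _; rewrite rnorm_ge0 x1.
  exists om; split=> // x.
  have [y yP] := @dependent_choice_family _ (fun i => X i)
    (fun i y => rnorm y <= 1 /\ x i = of_real (rnorm (x i)) *: y)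
    (fun i => let: ex_intro2 y y1 yx := unit_decomp (x i) in ex_intro _ y (conj y1 yx)).
  have -> : elem x = (\prod_(i < n) of_real (rnorm (x i))) *: elem y.
    by rewrite -elem_scale; congr elem; apply: multi_ext => i; case: (yP i).
  rewrite 2!linearZ [modulus _]modulusM modulus_prod mulrC.
  have -> : \prod_(i < n) modulus (of_real (rnorm (x i)) : K) = \prod_(i < n) rnorm (x i).
    by apply: eq_bigr => i _; rewrite modulus_of_real ?rnorm_ge0.
  apply: ler_wpM2r => //; apply: omP => i; by case: (yP i).
(* Off [S] the blocks reduce to fixed unit vectors, up to a scalar. *)
pose om' k i := if i \in S then Q i k (om k i) else e i (j0 i).
pose ga k := modulus (G (elem (om' k))).
have ga0 k : 0 <= ga k by apply: modulus_ge0.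
have om_le k : modulus (G (D k (elem (om k)))) <= B ^+ n * ga k.
  have -> : D k (elem (om k)) =
      (\prod_(i < n) (if i \in S then 1 else T i (j0 i) (om k i))) *: elem (om' k).
    rewrite De -elem_scale; congr elem; apply: multi_ext => i; rewrite /om'.
    by have [iS|iS] := boolP (i \in S); [rewrite qS// scale1r|rewrite qNS].
  rewrite linearZ [modulus _]modulusM modulus_prod.
  apply: ler_wpM2r; first exact: modulus_ge0.
  have -> : B ^+ n = \prod_(i < n) B by rewrite prodr_const card_ord.
  apply: ler_prod => i _; rewrite modulus_ge0 /=; case: ifP => _; first by rewrite modulus1.
  apply: le_trans (coord_le (coordT i) _ _) _; rewrite -[leRHS]mulr1; apply: ler_wpM2l => //.
  by have [om1 _] := omP k.
have GD k w : modulus (G (D k w)) <= 2 * B ^+ n * ga k * rnorm (J (D k w)).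
  rewrite -[in X in X <= _]DD JN.
  apply: (projective_norm_functional (G := G \o D k : {linear tensor X -> K^o})).
    by rewrite !mulr_ge0// exprn_ge0.
  move=> x; have [_ omx] := omP k; apply: le_trans (omx x) _; apply: ler_wpM2r => //.
  by rewrite -mulrA; apply: ler_wpM2l.
have step (x : forall i, X i) :
    \sum_(k < M) ga k * \prod_(i < n) rnorm (Pr i (q k i) (x i)) <=
    CD * c ^+ n * \prod_(i < n) rnorm (x i).
  have [s sP] : exists s : nat -> K, forall k, modulus (s k) = 1 /\
      s k * G (elem (om' k)) = of_real (ga k).
    have H1 k : exists s : K, modulus s = 1 /\ s * G (elem (om' k)) = of_real (ga k).
      by have [s s1 sE] := phase (G (elem (om' k))); exists s.
    by have [s sE] := choice H1; exists s.
  pose a i k : K := of_real (rnorm (Pr i (q k i) (x i))) * (if i == i0 then s k else 1).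
  have am i k : modulus (a i k) = rnorm (Pr i (q k i) (x i)).
    rewrite modulusM modulus_of_real ?rnorm_ge0//.
    by case: ifP => _; rewrite ?(sP k).1 ?modulus1 mulr1.
  pose y i := if i \in S then \sum_(k < M) a i k *: om' k i
    else of_real (rnorm (T i (j0 i) (x i) *: e i (j0 i))) *: e i (j0 i).
  have Dy k : (k < M)%N -> D k (elem y) = (\prod_(i < n) a i k) *: elem (om' k).
    move=> kM; rewrite De -elem_scale; congr elem; apply: multi_ext => i.
    rewrite /y; have [iS|iS] := boolP (i \in S).
      rewrite qS// linear_sum (bigD1 (Ordinal kM))//= big1 ?addr0; last first.
        move=> l; rewrite -val_eqE /= => lk; rewrite linearZ /om' iS /=.
        rewrite (block_proj_disjoint coordT PrP Nh) ?scaler0// => E1.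
        by rewrite E1 eqxx in lk.
      by rewrite linearZ /om' iS /= (block_proj_idem coordT PrP).
    rewrite qNS// linearZ eP eqxx [GRing.Scale.PreLaw.sort _ _ _]mulr1 /a /om' (negbTE iS) qNS//.
    case: eqP => [ii0|_]; last by rewrite mulr1.
    by rewrite ii0 i0S in iS.
  have Gy : G (\sum_(k < M) D k (elem y)) =
      of_real (\sum_(k < M) ga k * \prod_(i < n) rnorm (Pr i (q k i) (x i))).
    rewrite linear_sum (big_morph of_real (@of_realD R cplx) (@of_real0 R cplx)).
    apply: eq_bigr => k _; rewrite Dy// linearZ.
    have -> : \prod_(i < n) a i k = of_real (\prod_(i < n) rnorm (Pr i (q k i) (x i))) * s k.
      rewrite /a big_split /= (big_morph of_real (@of_realM R cplx) (@of_real1 R cplx)).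
      congr (_ * _); rewrite (bigD1 i0)//= eqxx big1 ?mulr1// => i /negbTE -> //.
    transitivity (of_real (\prod_(i < n) rnorm (Pr i (q k i) (x i))) * s k * G (elem (om' k))).
      by [].
    by rewrite -mulrA (sP k).2 -of_realM mulrC.
  have s_ge0 : 0 <= \sum_(k < M) ga k * \prod_(i < n) rnorm (Pr i (q k i) (x i)).
    apply: sumr_ge0 => k _; rewrite mulr_ge0//; apply: prodr_ge0 => i _; exact: rnorm_ge0.
  rewrite -[leLHS](@modulus_of_real R cplx)// -Gy; apply: le_trans (GJ _) _.
  apply: le_trans (diagonal_bound coordT PrP eP Jdense J_lift J_elem J_form n_gt0 j0 M (elem y) i0S Nh) _.
  rewrite -/CD -mulrA; apply: ler_wpM2l => //; apply: le_trans (J_elem _) _.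
  have -> : c ^+ n = \prod_(i < n) c by rewrite prodr_const card_ord.
  rewrite -big_split; apply: ler_prod => i _; rewrite rnorm_ge0 /= /y.
  have [iS|iS] := boolP (i \in S).
    apply: (@le_trans _ _ (B ^+ 3 * rnorm (x i))); last first.
      apply: ler_wpM2r; first exact: rnorm_ge0.
      by rewrite /c; apply: ler_peMr; rewrite ?exprn_ge0// lerDl.
    apply: (vector_blocks coordT PrP Nh (w := fun k => a i k *: om' k i)) => k kM.
    rewrite /om' iS linearZ /= (block_proj_idem coordT PrP); split=> //.
    rewrite rnormZ -/(modulus _) am qS// mulrC; apply: ler_wpM2r; first exact: rnorm_ge0.
    apply: le_trans (proj_le PrP _ _) _; rewrite -[leRHS]mulr1; apply: ler_wpM2l => //.
    by have [om1 _] := omP k.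
  rewrite rnormZ -/(modulus _) modulus_of_real ?rnorm_ge0//.
  rewrite -(proj_point coordT PrP eP) mulrC.
  apply: le_trans (ler_wpM2l (rnorm_ge0 _) (proj_le PrP _ _)) _.
  rewrite mulrA; apply: ler_wpM2r; first exact: rnorm_ge0.
  rewrite mulrC /c; apply: ler_pM => //; first exact: rnorm_ge0.
    by rewrite -[leLHS]expr1 ler_weXn2l.
  by apply: le_trans (esum i) _; rewrite lerDr.
have main : \sum_(k < M) ga k * rnorm (J (D k (v k))) <= CD * c ^+ n * rnorm (J W).
  have cn : 0 <= CD * c ^+ n by rewrite mulr_ge0// exprn_ge0.
  apply/ler_addgt0Pr => d d0; have c1 : 0 < CD * c ^+ n + 1 by rewrite ltr_wpDl.
  have [|m [x [Wx h]]] := @projective_norm_near W (d / (CD * c ^+ n + 1)); first by rewrite divr_gt0.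
  apply: (@le_trans _ _ (CD * c ^+ n * \sum_(j < m) \prod_(i < n) rnorm (x j i))).
    apply: (@le_trans _ _ (\sum_(k < M) \sum_(j < m) ga k * \prod_(i < n) rnorm (Pr i (q k i) (x j i)))).
      apply: ler_sum => k _; rewrite -mulr_sumr; apply: ler_wpM2l => //.
      have -> : D k (v k) = \sum_(j < m) elem (fun i => Pr i (q k i) (x j i)).
        transitivity (D k W).
          rewrite /W linear_sum (bigD1 k)//= big1 ?addr0; first by rewrite -[LHS]DD.
          by move=> l lk; apply: Ddisj => E1; case/eqP: lk; apply: val_inj.
        by rewrite Wx linear_sum; apply: eq_bigr => j _; apply: De.
      rewrite linear_sum; apply: le_trans (rnorm_sum _ _ _) _; apply: ler_sum => j _.
      exact: J_elem.
    rewrite exchange_big mulr_sumr /=; apply: ler_sum => j _; exact: step.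
  have := ler_wpM2l cn (ltW h); rewrite JN mulrDr.
  have : CD * c ^+ n * (d / (CD * c ^+ n + 1)) <= d.
    by rewrite mulrA ler_pdivrMr// mulrC ler_wpM2l ?lerDl// ltW.
  lra.
rewrite -[leLHS](@modulus_of_real R cplx) ?rnorm_ge0// -fz.
rewrite -[f _]/(G _) linear_sum; apply: le_trans (rnorm_sum (V := K^o) _ _ _) _.
rewrite -mulrA; apply: le_trans (ler_wpM2l _ main); last by rewrite mulr_ge0// exprn_ge0.
rewrite mulr_sumr; apply: ler_sum => k _; apply: le_trans (GD _ _) _.
rewrite -!mulrA; apply: ler_wpM2l => //; apply: ler_wpM2l; first exact: exprn_ge0.
apply: ler_wpM2l => //; exact: H.
Qed.

End Projective.

(** * Tensor products of sequence spaces *)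

Lemma common_coordinates (R : realType) (cplx : bool) (n : nat)
    (X : 'I_n -> completeNormedModType (scalars R cplx)) :
  (forall i : 'I_n,
     (exists p : R, 1 <= p /\ isomorphic_to (X i) (ell p) (ell_norm p)) \/
     isomorphic_to (X i) c0 c0_norm) ->
  exists (T : forall i, nat -> {linear X i -> (scalars R cplx)^o}) (B : R),
    forall i, coordinates (T i) B.
Proof.
move=> hX.
have H i : exists T : nat -> {linear X i -> (scalars R cplx)^o}, exists B : R, coordinates T B.
  have [[p [p1 iso]]|iso] := hX i.
    exact: isomorphic_coordinates (ell_block_monotone p1) iso.
  exact: isomorphic_coordinates c0_block_monotone iso.
have [T /choice[B TB]] := @dependent_choice_family 'I_n
  (fun i => nat -> {linear X i -> (scalars R cplx)^o}) (fun i T => exists B : R, coordinates T B) H.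
exists T, (\sum_(i < n) B i) => i; apply: coordinates_le (TB i).
rewrite (bigD1 i)//= lerDl; apply: sumr_ge0 => k _.
exact: le_trans ler01 (coord_ge1 (TB k)).
Qed.

Theorem corollary3p3 (R : realType) (cplx : bool) (n : nat) (n_gt0 : (0 < n)%N)
  (X : 'I_n -> completeNormedModType (scalars R cplx))
  (hX : forall i : 'I_n,
     (exists p : R, 1 <= p /\ isomorphic_to (X i) (ell p) (ell_norm p)) \/
     isomorphic_to (X i) c0 c0_norm) :
  (forall Z : completeNormedModType (scalars R cplx),
     is_injective_tensor_product X Z -> subprojective Z) /\
  (forall Z : completeNormedModType (scalars R cplx),
     is_projective_tensor_product X Z -> subprojective Z).
Proof.
have [T [B TB]] := common_coordinates hX.
have [Pr PrP] := coordinate_projections_exist TB.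
have [e eP] := unit_vectors_exist TB.
split=> Z [J [JN Jd]].
- have J_lift (A : forall i, {linear X i -> X i}) (C : R) : 0 <= C ->
      (forall i x, rnorm (A i x) <= C * rnorm x) ->
      forall u, rnorm (J (tlift A u)) <= C ^+ n * rnorm (J u).
    by move=> C0 AC u; rewrite !JN; apply: injective_norm_lift.
  have J_elem (x : forall i, X i) : rnorm (J (elem x)) <= \prod_(i < n) rnorm (x i).
    by rewrite JN; apply: injective_norm_elem.
  have J_form (phi : forall i, {linear X i -> (scalars R cplx)^o}) (C : R) : 0 <= C ->
      (forall i x, modulus (phi i x) <= C * rnorm x) ->
      forall u : tensor X, modulus (u (product_form phi)) <= C ^+ n * rnorm (J u).
    move=> C0 AC u; rewrite JN.
    have -> : C ^+ n = \prod_(i < n) C by rewrite prodr_const card_ord.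
    exact: injective_norm_form.
  apply: (subprojective_of_crossnorm TB PrP eP Jd J_lift J_elem J_form n_gt0).
  have -> : (fun u => rnorm (J u)) = @injective_norm R cplx n X by apply: funext.
  exact: (injective_domination TB PrP eP).
- have J_lift (A : forall i, {linear X i -> X i}) (C : R) : 0 <= C ->
      (forall i x, rnorm (A i x) <= C * rnorm x) ->
      forall u, rnorm (J (tlift A u)) <= C ^+ n * rnorm (J u).
    by move=> C0 AC u; rewrite !JN; apply: projective_norm_lift.
  have J_elem (x : forall i, X i) : rnorm (J (elem x)) <= \prod_(i < n) rnorm (x i).
    by rewrite JN; apply: projective_norm_elem.
  have J_form (phi : forall i, {linear X i -> (scalars R cplx)^o}) (C : R) : 0 <= C ->
      (forall i x, modulus (phi i x) <= C * rnorm x) ->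
      forall u : tensor X, modulus (u (product_form phi)) <= C ^+ n * rnorm (J u).
    by move=> C0 AC u; rewrite JN; apply: projective_norm_form.
  apply: (subprojective_of_crossnorm TB PrP eP Jd J_lift J_elem J_form n_gt0).
  exact: (projective_domination n_gt0 TB PrP eP Jd JN).
Qed.
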